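(* Let $t\in\mathbb{R}$. The axial algebra $M(t)$ is a Majorana algebra if and only if $t\in(0,\frac16)$. If $t\in\{0,\frac16\}$ then there exists a $9$-dimensional quotient of $M(t)$ that is a Majorana algebra.
   Context: Algebras are commutative but not necessarily associative, over a commutative ring $R$ with $1$ containing $\mathbb{R}$ as a subfield. For an idempotent $a\in V$ and $\lambda\in R$ put $V_\lambda^{(a)}=\{v\in V: a\cdot v=\lambda v\}$, and for $\Lambda\subseteq R$ put $V_\Lambda^{(a)}=\bigoplus_{\lambda\in\Lambda}V_\lambda^{(a)}$ ($V_\emptyset^{(a)}=0$). The Monster fusion rule $(\mathcal{M},* )$ has $\mathcal{M}=\{1,0,\frac14,\frac1{32}\}$ and symmetric $*$ with $1*1=\{1\}$, $1*0=\emptyset$, $0*0=\{0\}$, $1*\frac14=0*\frac14=\{\frac14\}$, $\frac14*\frac14=\{1,0\}$, $\lambda*\frac1{32}=\{\frac1{32}\}$ for $\lambda\in\{1,0,\frac14\}$, $\frac1{32}*\frac1{32}=\{1,0,\frac14\}$. An idempotent $a$ is an $(\mathcal{M},* )$-axis if $V=\bigoplus_{\lambda\in\mathcal{M}}V_\lambda^{(a)}$ and $V_\lambda^{(a)}\cdot V_\mu^{(a)}\subseteq V_{\lambda*\mu}^{(a)}$ for all $\lambda,\mu\in\mathcal{M}$; it is primitive if $V_1^{(a)}=Ra$. A primitive Frobenius $(\mathcal{M},* )$-axial algebra (primitive axial algebra of Monster type with a Frobenius form) is an algebra generated by a set $A$ of primitive $(\mathcal{M},* )$-axes with a Frobenius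 form, i.e. a nonzero $R$-bilinear form $\langle\,,\rangle$ with $\langle u,v\cdot w\rangle=\langle u\cdot v,w\rangle$, normalised by $\langle a,a\rangle=1$ for axes $a\in A$. The Miyamoto involution $\tau(a)$ acts as $1$ on $V_1^{(a)}\oplus V_0^{(a)}\oplus V_{1/4}^{(a)}$ and as $-1$ on $V_{1/32}^{(a)}$. A primitive axial algebra of Monster type over $\mathbb{R}$ with Frobenius form $\langle\,,\rangle$ is a Majorana algebra if (i) $\langle\,,\rangle$ is positive definite and (ii) it obeys Norton's inequality: $\langle u\cdot u,v\cdot v\rangle\ge\langle u\cdot v,u\cdot v\rangle$ for all $u,v$. Property $\mathcal{P}$: $A=\{a_1,a_{-1},a_2,a_{-2},a_3,a_{-3}\}$ and on $A$, $\tau(a_1)=\tau(a_{-1})=(a_2,a_{-2})(a_3,a_{-3})$, $\tau(a_2)=\tau(a_{-2})=(a_1,a_{-1})(a_3,a_{-3})$, $\tau(a_3)=\tau(a_{-3})=(a_1,a_{-1})(a_2,a_{-2})$. Shape $4A$: for all distinct $i,j\in\{1,2,3\}$ the subalgebra $\langle\langle a_i,a_j\rangle\rangle$ generated by $a_i,a_j$ is of type $4A$, i.e. it is spanned by $a_{\pm i},a_{\pm j}$ and an idempotent $v=v_{(i,j)}=v_{(j,i)}$ such that, for all signs $\epsilon,\delta$: $a_{\epsilon i}\cdot a_{\delta j}=\frac1{64}(3a_{\epsilon i}+3a_{\delta j}+a_{-\epsilon i}+a_{-\delta j}-3v)$, $a_{\epsilon i}\cdot v=\frac1{16}(5a_{\epsilon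 i}-a_{-\epsilon i}-2a_j-2a_{-j}+3v)$, $a_{\delta j}\cdot v=\frac1{16}(5a_{\delta j}-a_{-\delta j}-2a_i-2a_{-i}+3v)$, $a_i\cdot a_{-i}=a_j\cdot a_{-j}=0$, $\langle a_{\epsilon i},a_{\delta j}\rangle=\frac1{32}$, $\langle a_i,a_{-i}\rangle=\langle a_j,a_{-j}\rangle=0$, $\langle a_{\epsilon i},v\rangle=\langle a_{\delta j},v\rangle=\frac38$, $\langle v,v\rangle=2$. Universal algebra: let $\hat X$ be the free commutative non-associative magma on $\hat a_{\pm1},\hat a_{\pm2},\hat a_{\pm3}$; let $\sim$ be the equivalence relation on $\hat X\times\hat X$ generated by $(\hat x\cdot\hat y,\hat z)\sim(\hat x,\hat y\cdot\hat z)$; let $\hat R=\mathbb{R}[\lambda_{[\hat x,\hat y]}]$ be the polynomial ring with one indeterminate for each $\sim$-class; let $\hat M=\hat R\hat X$ be the algebra of formal $\hat R$-linear combinations of elements of $\hat X$, with $\hat R$-bilinear form $\langle\hat x,\hat y\rangle=\lambda_{[\hat x,\hat y]}$. For ideals $I$ of $\hat M$ and $J\ne\hat R$ of $\hat R$ with $J\hat M\subseteq I$ and $\langle I,\hat M\rangle\subseteq J$, the quotient $\hat M/I$ is an algebra with form over its coefficient ring $\hat R/J$, with marked generators $a_{\pm i}$ the images of $\hat a_{\pm i}$. Let $\mathcal{C}_{4A}$ be the class of such quotients which are primitive Frobenius $(\mathcal{M},* )$-axial algebras (with axes the marked generators) satisfying property $\mathcal{P}$ and having shape $4A$. $M_{4A}$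 denotes the universal member of $\mathcal{C}_{4A}$ (given by the smallest pair $(I,J)$; all members of $\mathcal{C}_{4A}$ are quotients of it), and $R_{4A}=\hat R/J$ its coefficient ring. Specialisation: $R_{4A}$ is the polynomial ring $\mathbb{R}[t]$ in $t=\langle a_1,v_{(2,3)}\rangle$. For a real number $t_0$, $M(t_0)$ denotes the real algebra $M_{4A}/(t-t_0)M_{4A}$ obtained by letting $t$ take the value $t_0$ (a $12$-dimensional axial algebra of Monster type), with axes the images of $a_{\pm1},a_{\pm2},a_{\pm3}$ and with the induced Frobenius form. *)

(* Defs.v *)
From HB Require Import structures.
From mathcomp Require Import all_boot all_order all_algebra.
From mathcomp Require Import finmap monalg.
From mathcomp Require Import boolp classical_sets reals.

Set Implicit Arguments.
Unset Strict Implicit.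
Unset Printing Implicit Defensive.

Import Order.TTheory GRing.Theory Num.Theory.
Local Open Scope ring_scope.
Local Open Scope quotient_scope.

(* A commutative, not necessarily associative algebra [car] with a bilinear   *)
(* form, over a coefficient ring [coef] that receives the reals [K] through   *)
(* [iota], with six marked elements: [gen i true] is a_{i+1} and              *)
(* [gen i false] is a_{-(i+1)}.  The zero ring is allowed as [coef] here, so  *)
(* that quotients exist without side condition; it is excluded wherever       *)
(* axial algebras are discussed, by the injectivity of [iota].                *)
Record algebra (K : realType) := Algebra {
  coef : comPzRingType;
  iota : {rmorphism K -> coef};
  car : lmodType coef;
  prd : car -> car -> car;
  form : car -> car -> coef;
  gen : 'I_3 -> bool -> car;
  prdC : commutative prd;
  prdP : forall c x y z, prd (c *: x + y) z = c *: prd x z + prd y z;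
  formPl : forall c x y z, form (c *: x + y) z = c * form x z + form y z;
  formPr : forall c x y z, form z (c *: x + y) = c * form z x + form z y }.

Section AlgebraTheory.
Variables (K : realType) (A : algebra K).
Implicit Types x y z : car A.

Lemma prdBl x y z : prd (x - y) z = prd x z - prd y z.
Proof. by rewrite addrC -scaleN1r prdP scaleN1r addrC. Qed.
Lemma formBl x y z : form (x - y) z = form x z - form y z.
Proof. by rewrite addrC -scaleN1r formPl mulN1r addrC. Qed.
Lemma formBr x y z : form z (x - y) = form z x - form z y.
Proof. by rewrite addrC -scaleN1r formPr mulN1r addrC. Qed.
Lemma prdZl c x y : prd (c *: x) y = c *: prd x y.
Proof.
have prd0 : prd 0 y = 0 by rewrite -{1}(subrr y) prdBl subrr.
by rewrite -[c *: x]addr0 prdP prd0 addr0.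
Qed.
Lemma formZl c x y : form (c *: x) y = c * form x y.
Proof.
have form0 : form 0 y = 0 by rewrite -(subrr y) formBl subrr.
by rewrite -[c *: x]addr0 formPl form0 addr0.
Qed.
Lemma formZr c x y : form x (c *: y) = c * form x y.
Proof.
have form0 : form x 0 = 0 by rewrite -{1}(subrr x) formBr subrr.
by rewrite -[c *: y]addr0 formPr form0 addr0.
Qed.
End AlgebraTheory.

Section AxialAlgebras.
Variables (K : realType) (A : algebra K).
Local Notation V := (car A).
Local Notation S := (coef A).
Local Notation "x ** y" := (prd x y) (at level 40, left associativity).
Local Notation "<| x , y |>" := (form x y) (at level 0).
Local Notation "r %:S" := (iota A r) (at level 2, format "r %:S").
Implicit Types (a u v w x : V).

Inductive eigval := ev1 | ev0 | ev4 | ev32.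

Definition monster : seq eigval := [:: ev1; ev0; ev4; ev32].

Definition eigval_of (l : eigval) : S :=
  match l with
  | ev1 => 1 | ev0 => 0 | ev4 => (1 / 4 : K)%:S | ev32 => (1 / 32 : K)%:S
  end.

Definition fuse (l m : eigval) : seq eigval :=
  match l, m with
  | ev1, ev1 => [:: ev1]
  | ev1, ev0 | ev0, ev1 => [::]
  | ev0, ev0 => [:: ev0]
  | ev1, ev4 | ev4, ev1 | ev0, ev4 | ev4, ev0 => [:: ev4]
  | ev4, ev4 => [:: ev1; ev0]
  | ev32, ev32 => [:: ev1; ev0; ev4]
  | ev32, _ | _, ev32 => [:: ev32]
  end.

Definition eigen a (l : eigval) v := a ** v = eigval_of l *: v.

Definition eigen_sum a (L : seq eigval) v :=
  exists2 f : eigval -> V, (forall l, eigen a l (f l)) & v = \sum_(l <- L) f l.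

Definition axis a :=
  [/\ a ** a = a,
      forall v, eigen_sum a monster v,
      forall f : eigval -> V, (forall l, eigen a l (f l)) ->
        \sum_(l <- monster) f l = 0 -> forall l, f l = 0
    & forall l m u v, eigen a l u -> eigen a m v ->
        eigen_sum a (fuse l m) (u ** v)].

Definition primitive a := forall v, eigen a ev1 v <-> exists r : S, v = r *: a.

Definition subalgebra (B : set V) :=
  [/\ B 0, forall r u v, B u -> B v -> B (r *: u + v)
    & forall u v, B u -> B v -> B (u ** v)].

Definition generated_by (X : set V) : set V :=
  fun v => forall B : set V, subalgebra B -> (X `<=` B)%classic -> B v.

Definition axes : set V := fun v => exists i e, v = gen A i e.

Definition frobenius :=
  [/\ exists u v, <| u, v |> <> 0,
      forall u v w, <| u, v ** w |> = <| u ** v, w |>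
    & forall i e, <| gen A i e, gen A i e |> = 1].

Definition primitive_frobenius_axial :=
  [/\ injective (iota A),
      forall i e, axis (gen A i e) /\ primitive (gen A i e),
      forall v, generated_by axes v
    & frobenius].

Definition miyamoto a (tau : {linear V -> V}) :=
  (forall l v, l <> ev32 -> eigen a l v -> tau v = v) /\
  (forall v, eigen a ev32 v -> tau v = - v).

Definition property_P :=
  (forall i j d e, gen A i d = gen A j e -> (i, d) = (j, e)) /\
  forall i d, exists2 tau : {linear V -> V}, miyamoto (gen A i d) tau
    & forall j e, tau (gen A j e) = gen A j (if j == i then e else ~~ e).

Definition type_4A (i j : 'I_3) v :=
  let a := gen A in
  [/\ v ** v = v,
      forall x, generated_by (fun y => y = a i true \/ y = a j true) x <->
        exists c1 c2 c3 c4 c5 : S,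
          x = c1 *: a i true + c2 *: a i false
            + c3 *: a j true + c4 *: a j false + c5 *: v,
      forall e d, a i e ** a j d = (1 / 64 : K)%:S *:
        (3 *: a i e + 3 *: a j d + a i (~~ e) + a j (~~ d) - 3 *: v),
      [/\ forall e, a i e ** v = (1 / 16 : K)%:S *:
            (5 *: a i e - a i (~~ e) - 2 *: a j true - 2 *: a j false + 3 *: v),
          forall d, a j d ** v = (1 / 16 : K)%:S *:
            (5 *: a j d - a j (~~ d) - 2 *: a i true - 2 *: a i false + 3 *: v),
          a i true ** a i false = 0 & a j true ** a j false = 0]
    & [/\ forall e d, <| a i e, a j d |> = (1 / 32 : K)%:S,
          <| a i true, a i false |> = 0 /\ <| a j true, a j false |> = 0,
          forall e, <| a i e, v |> = (3 / 8 : K)%:S,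
          forall d, <| a j d, v |> = (3 / 8 : K)%:S
        & <| v, v |> = 2]].

Definition shape_4A :=
  exists2 v : 'I_3 -> 'I_3 -> V, (forall i j, v i j = v j i)
    & forall i j, i != j -> type_4A i j (v i j).

(* The formula for a_i . a_j in an algebra of type 4A, solved for v. *)
Definition v_4A (i j : 'I_3) : V :=
  let a := gen A in
  (1 / 3 : K)%:S *: (3 *: a i true + 3 *: a j true + a i false + a j false
                     - 64 *: (a i true ** a j true)).

Lemma type_4A_v i j v : type_4A i j v -> v = v_4A i j.
Proof.
case=> _ _ /(_ true true) /= E _ _; rewrite /v_4A E scalerA.
have inv_nat n : (n.+1%:R : K)^-1%:S * n.+1%:R = 1 :> S.
  by rewrite -(rmorph_nat (iota A)) -rmorphM mulVf ?pnatr_eq0 ?rmorph1.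
rewrite !div1r [64 * _]mulrC inv_nat scale1r opprB addrC addrNK.
by rewrite scalerA inv_nat scale1r.
Qed.

Definition class_4A := [/\ primitive_frobenius_axial, property_P & shape_4A].

(* An algebra over (a copy of) the reals is one for which [iota] is           *)
(* bijective; the order of the reals is then transported along [iota].        *)
Definition positive (s : S) := exists2 r : K, 0 < r & s = r%:S.
Definition nonnegative (s : S) := exists2 r : K, 0 <= r & s = r%:S.

Definition Majorana :=
  [/\ bijective (iota A),
      primitive_frobenius_axial,
      forall u, u <> 0 -> positive <| u, u |>
    & forall u v,
        nonnegative (<| u ** u, v ** v |> - <| u ** v, u ** v |>)].

Definition has_dimension (n : nat) :=
  bijective (iota A) /\
  exists b : 'I_n -> V,
    forall x, exists! c : 'rV[S]_n, x = \sum_(i < n) c 0 i *: b i.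

End AxialAlgebras.

(* Pairs (I, J) of ideals by which one can divide an algebra together with    *)
(* its coefficient ring and form.  As the form is not assumed symmetric, both *)
(* <I, V> and <V, I> have to lie in J for the form to pass to the quotient.   *)
Record ideal_pair (K : realType) (A : algebra K) := IdealPair {
  idI : set (car A);
  idJ : set (coef A);
  idI0 : idI 0;
  idIP : forall c x y, idI x -> idI y -> idI (c *: x + y);
  idIM : forall x y, idI x -> idI (prd x y);
  idJ0 : idJ 0;
  idJP : forall c r s, idJ r -> idJ s -> idJ (c * r + s);
  idJI : forall r x, idJ r -> idI (r *: x);
  idIJl : forall x y, idI x -> idJ (form x y);
  idIJr : forall x y, idI x -> idJ (form y x) }.

Section Quotients.
Variables (K : realType) (A : algebra K) (P : ideal_pair A).

Definition idIb : pred (car A) := fun x => `[< idI P x >].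
Definition idJb : pred (coef A) := fun x => `[< idJ P x >].

Fact idIb_closed : zmod_closed idIb.
Proof.
split; first exact/asboolP/idI0.
move=> x y /asboolP Ix /asboolP Iy; apply/asboolP.
by rewrite addrC -scaleN1r; apply: idIP.
Qed.

Fact idJb_closed : zmod_closed idJb.
Proof.
split; first exact/asboolP/idJ0.
move=> x y /asboolP Ix /asboolP Iy; apply/asboolP.
by rewrite addrC -mulN1r; apply: idJP.
Qed.

HB.instance Definition _ := GRing.isZmodClosed.Build (car A) idIb idIb_closed.
HB.instance Definition _ := GRing.isZmodClosed.Build (coef A) idJb idJb_closed.

Definition idIz : zmodClosed (car A) := GRing.ZmodClosed.clone (car A) idIb _.
Definition idJz : zmodClosed (coef A) := GRing.ZmodClosed.clone (coef A) idJb _.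

Definition qcar := Quotient.quot idIz.
Definition qcoef := Quotient.quot idJz.
HB.instance Definition _ := GRing.Zmodule.on qcar.
HB.instance Definition _ := GRing.Zmodule.on qcoef.

Definition pi_car (x : car A) : qcar := \pi_(Quotient.quot idIz) x.
Definition pi_coef (r : coef A) : qcoef := \pi_(Quotient.quot idJz) r.
Definition rep_car (x : qcar) : car A := repr (x : Quotient.quot idIz).
Definition rep_coef (r : qcoef) : coef A := repr (r : Quotient.quot idJz).

Lemma pi_carE x y : pi_car x = pi_car y <-> idI P (x - y).
Proof.
split; first by move/eqP; rewrite -Quotient.idealrBE => /asboolP.
by move=> h; apply/eqP; rewrite -Quotient.idealrBE; apply/asboolP.
Qed.

Lemma pi_coefE r s : pi_coef r = pi_coef s <-> idJ P (r - s).
Proof.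
split; first by move/eqP; rewrite -Quotient.idealrBE => /asboolP.
by move=> h; apply/eqP; rewrite -Quotient.idealrBE; apply/asboolP.
Qed.

Lemma rep_carK : cancel rep_car pi_car. Proof. exact: reprK. Qed.
Lemma rep_coefK : cancel rep_coef pi_coef. Proof. exact: reprK. Qed.

Lemma pi_carD : {morph pi_car : x y / x + y}.
Proof. by move=> x y; exact: Quotient.pi_add. Qed.
Lemma pi_coefD : {morph pi_coef : x y / x + y}.
Proof. by move=> x y; exact: Quotient.pi_add. Qed.
Lemma pi_coef0 : pi_coef 0 = 0.
Proof. by apply: (addIr (pi_coef 0)); rewrite add0r -pi_coefD add0r. Qed.

Lemma rep_pi_car x : idI P (rep_car (pi_car x) - x).
Proof. by apply/pi_carE; rewrite rep_carK. Qed.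
Lemma rep_pi_coef r : idJ P (rep_coef (pi_coef r) - r).
Proof. by apply/pi_coefE; rewrite rep_coefK. Qed.

Lemma idIZ c x : idI P x -> idI P (c *: x).
Proof. by move=> Ix; rewrite -[_ *: _]addr0; apply: idIP => //; apply: idI0. Qed.
Lemma idJM c x : idJ P x -> idJ P (c * x).
Proof. by move=> Jx; rewrite -[_ * _]addr0; apply: idJP => //; apply: idJ0. Qed.
Lemma idID x y : idI P x -> idI P y -> idI P (x + y).
Proof. by move=> Ix Iy; rewrite -[x]scale1r; apply: idIP. Qed.
Lemma idJD x y : idJ P x -> idJ P y -> idJ P (x + y).
Proof. by move=> Ix Iy; rewrite -[x]mul1r; apply: idJP. Qed.

Definition qone : qcoef := pi_coef 1.
Definition qmul (r s : qcoef) : qcoef := pi_coef (rep_coef r * rep_coef s).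

Lemma pi_qmul : {morph pi_coef : r s / r * s >-> qmul r s}.
Proof.
move=> r s; apply/esym/pi_coefE.
have -> : rep_coef (pi_coef r) * rep_coef (pi_coef s) - r * s
  = rep_coef (pi_coef s) * (rep_coef (pi_coef r) - r)
    + r * (rep_coef (pi_coef s) - s).
  by rewrite !mulrBr [in RHS]addrA [r * _ in RHS]mulrC addrNK mulrC.
by apply: idJD; apply: idJM; apply: rep_pi_coef.
Qed.

Lemma qmulA : associative qmul.
Proof.
move=> x y z; rewrite -[x]rep_coefK -[y]rep_coefK -[z]rep_coefK.
by rewrite -!pi_qmul mulrA.
Qed.
Lemma qmulC : commutative qmul.
Proof.
by move=> x y; rewrite -[x]rep_coefK -[y]rep_coefK -!pi_qmul mulrC.
Qed.
Lemma qmul1 : left_id qone qmul.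
Proof. by move=> x; rewrite -[x]rep_coefK -!pi_qmul mul1r. Qed.
Lemma qmulDl : left_distributive qmul +%R.
Proof.
move=> x y z; rewrite -[x]rep_coefK -[y]rep_coefK -[z]rep_coefK.
by rewrite -!(pi_qmul, pi_coefD) mulrDl.
Qed.

HB.instance Definition _ :=
  GRing.Zmodule_isComPzRing.Build qcoef qmulA qmulC qmul1 qmulDl.

Lemma pi_coef1 : pi_coef 1 = 1. Proof. by []. Qed.
Lemma pi_coefM : {morph pi_coef : r s / r * s}. Proof. exact: pi_qmul. Qed.

Definition qscale (r : qcoef) (x : qcar) : qcar :=
  pi_car (rep_coef r *: rep_car x).

Lemma pi_carZ r x : pi_car (r *: x) = qscale (pi_coef r) (pi_car x).
Proof.
apply/esym/pi_carE.
have -> : rep_coef (pi_coef r) *: rep_car (pi_car x) - r *: x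
  = (rep_coef (pi_coef r) - r) *: rep_car (pi_car x)
    + r *: (rep_car (pi_car x) - x).
  by rewrite scalerBl scalerBr addrA addrNK.
by apply: idID; [apply/idJI/rep_pi_coef | apply/idIZ/rep_pi_car].
Qed.

Lemma qscaleA a b v : qscale a (qscale b v) = qscale (a * b) v.
Proof.
rewrite -[a]rep_coefK -[b]rep_coefK -[v]rep_carK.
by rewrite -pi_coefM -!pi_carZ scalerA.
Qed.
Lemma qscale1 : left_id 1 qscale.
Proof. by move=> v; rewrite -[v]rep_carK -pi_coef1 -pi_carZ scale1r. Qed.
Lemma qscaleDr : right_distributive qscale +%R.
Proof.
move=> a u v; rewrite -[a]rep_coefK -[u]rep_carK -[v]rep_carK.
by rewrite -pi_carD -!pi_carZ scalerDr pi_carD.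
Qed.
Lemma qscaleDl v : {morph qscale^~ v : a b / a + b}.
Proof.
move=> a b; rewrite -[a]rep_coefK -[b]rep_coefK -[v]rep_carK.
by rewrite -pi_coefD -!pi_carZ scalerDl pi_carD.
Qed.

HB.instance Definition _ := GRing.Zmodule_isLmodule.Build qcoef qcar
  qscaleA qscale1 qscaleDr qscaleDl.

Definition qiota (r : K) : qcoef := pi_coef (iota A r).

Fact qiota_zmod : zmod_morphism qiota.
Proof.
move=> r s; rewrite /qiota rmorphB /=.
by apply: (addIr (pi_coef (iota A s))); rewrite subrK -pi_coefD subrK.
Qed.
Fact qiota_monoid : monoid_morphism qiota.
Proof.
by split=> [|r s]; rewrite /qiota ?rmorph1 // rmorphM pi_coefM.
Qed.
HB.instance Definition _ := GRing.isZmodMorphism.Build K qcoef qiota qiota_zmod.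
HB.instance Definition _ :=
  GRing.isMonoidMorphism.Build K qcoef qiota qiota_monoid.

Definition qprd (x y : qcar) : qcar := pi_car (prd (rep_car x) (rep_car y)).
Definition qform (x y : qcar) : qcoef := pi_coef (form (rep_car x) (rep_car y)).

Lemma pi_prd x y : qprd (pi_car x) (pi_car y) = pi_car (prd x y).
Proof.
apply/pi_carE.
have -> : prd (rep_car (pi_car x)) (rep_car (pi_car y)) - prd x y
  = prd (rep_car (pi_car x) - x) (rep_car (pi_car y))
    + prd (rep_car (pi_car y) - y) x.
  by rewrite !prdBl addrA [prd _ x]prdC addrNK [prd y x]prdC.
by apply: idID; apply/idIM/rep_pi_car.
Qed.

Lemma pi_form x y : qform (pi_car x) (pi_car y) = pi_coef (form x y).
Proof.
apply/pi_coefE.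
have -> : form (rep_car (pi_car x)) (rep_car (pi_car y)) - form x y
  = form (rep_car (pi_car x) - x) (rep_car (pi_car y))
    + form x (rep_car (pi_car y) - y).
  by rewrite formBl formBr addrA addrNK.
by apply: idJD; [apply/idIJl/rep_pi_car | apply/idIJr/rep_pi_car].
Qed.

Fact qprdC : commutative qprd.
Proof. by move=> x y; rewrite /qprd prdC. Qed.
Fact qprdP (c : qcoef) x y z : qprd (c *: x + y) z = c *: qprd x z + qprd y z.
Proof.
rewrite -[c]rep_coefK -[x]rep_carK -[y]rep_carK -[z]rep_carK.
rewrite {1}/GRing.scale /= -pi_carZ -pi_carD !pi_prd prdP pi_carD pi_carZ.
by [].
Qed.
Fact qformPl (c : qcoef) x y z :
  qform (c *: x + y) z = c * qform x z + qform y z.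
Proof.
rewrite -[c]rep_coefK -[x]rep_carK -[y]rep_carK -[z]rep_carK.
rewrite {1}/GRing.scale /= -pi_carZ -pi_carD !pi_form formPl pi_coefD pi_coefM.
by [].
Qed.
Fact qformPr (c : qcoef) x y z :
  qform z (c *: x + y) = c * qform z x + qform z y.
Proof.
rewrite -[c]rep_coefK -[x]rep_carK -[y]rep_carK -[z]rep_carK.
rewrite {1}/GRing.scale /= -pi_carZ -pi_carD !pi_form formPr pi_coefD pi_coefM.
by [].
Qed.

Definition quotient : algebra K :=
  @Algebra K qcoef qiota qcar qprd qform (fun i e => pi_car (gen A i e))
    qprdC qprdP qformPl qformPr.

End Quotients.

(* The quotient of an algebra by (s V, s S), s a scalar. *)
Section Specialisation.
Variables (K : realType) (A : algebra K) (s : coef A).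

Definition multI : set (car A) := fun x => exists y, x = s *: y.
Definition multJ : set (coef A) := fun r => exists q, r = s * q.

Fact multI0 : multI 0. Proof. by exists 0; rewrite scaler0. Qed.
Fact multIP c x y : multI x -> multI y -> multI (c *: x + y).
Proof.
by move=> [x' ->] [y' ->]; exists (c *: x' + y'); rewrite scalerDr !scalerA mulrC.
Qed.
Fact multIM x y : multI x -> multI (prd x y).
Proof. by move=> [x' ->]; exists (prd x' y); rewrite prdZl. Qed.
Fact multJ0 : multJ 0. Proof. by exists 0; rewrite mulr0. Qed.
Fact multJP c q r : multJ q -> multJ r -> multJ (c * q + r).
Proof.
by move=> [q' ->] [r' ->]; exists (c * q' + r'); rewrite mulrDr mulrCA.
Qed.
Fact multJI r x : multJ r -> multI (r *: x).
Proof. by move=> [r' ->]; exists (r' *: x); rewrite scalerA. Qed.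
Fact multIJl x y : multI x -> multJ (form x y).
Proof. by move=> [x' ->]; exists (form x' y); rewrite formZl. Qed.
Fact multIJr x y : multI x -> multJ (form y x).
Proof. by move=> [x' ->]; exists (form y x'); rewrite formZr. Qed.

Definition mult_pair : ideal_pair A :=
  IdealPair multI0 multIP multIM multJ0 multJP multJI multIJl multIJr.

End Specialisation.

(* Binary trees with leaves labelled by the six generators: representatives   *)
(* of the elements of the free commutative magma.                             *)
Inductive tree := Leaf of 'I_3 * bool | Node of tree & tree.

Fixpoint tree_encode (x : tree) : GenTree.tree ('I_3 * bool)%type :=
  match x with
  | Leaf a => GenTree.Leaf a
  | Node x y => GenTree.Node 0 [:: tree_encode x; tree_encode y]
  end.

Fixpoint tree_decode (x : GenTree.tree ('I_3 * bool)%type) : option tree :=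
  match x with
  | GenTree.Leaf a => Some (Leaf a)
  | GenTree.Node _ [:: x; y] =>
      if tree_decode x is Some x' then
        if tree_decode y is Some y' then Some (Node x' y') else None
      else None
  | _ => None
  end.

Fact tree_encodeK : pcancel tree_encode tree_decode.
Proof. by elim=> //= x -> y ->. Qed.

HB.instance Definition _ := Choice.copy tree (pcan_type tree_encodeK).

(* Equality up to commutativity at every node. *)
Fixpoint tree_eqv (x y : tree) : bool :=
  match x, y with
  | Leaf a, Leaf b => a == b
  | Node x1 x2, Node y1 y2 =>
      tree_eqv x1 y1 && tree_eqv x2 y2 || tree_eqv x1 y2 && tree_eqv x2 y1
  | _, _ => false
  end.

Fact tree_eqv_refl : reflexive tree_eqv.
Proof. by elim=> [a|x IHx y IHy] /=; rewrite ?eqxx ?IHx ?IHy. Qed.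
Fact tree_eqv_sym : symmetric tree_eqv.
Proof.
elim=> [a|x IHx y IHy] [b|z t] //; first by apply: eq_sym.
by rewrite /= !IHx !IHy [tree_eqv t x && _]andbC.
Qed.
Fact tree_eqv_trans : transitive tree_eqv.
Proof.
move=> y x; elim: x y => [a|x1 IH1 x2 IH2] [b|y1 y2] [c|z1 z2] //.
  by move=> /eqP ->.
rewrite /=.
have T1 u v : tree_eqv x1 u -> tree_eqv u v -> tree_eqv x1 v by exact: IH1.
have T2 u v : tree_eqv x2 u -> tree_eqv u v -> tree_eqv x2 v by exact: IH2.
case/orP=> /andP[h1 h2] /orP[] /andP[k1 k2]; apply/orP.
- by left; rewrite (T1 _ _ h1 k1) (T2 _ _ h2 k2).
- by right; rewrite (T1 _ _ h1 k1) (T2 _ _ h2 k2).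
- by right; rewrite (T1 _ _ h1 k2) (T2 _ _ h2 k1).
- by left; rewrite (T1 _ _ h1 k2) (T2 _ _ h2 k1).
Qed.

Canonical tree_eqv_equiv :=
  EquivRel tree_eqv tree_eqv_refl tree_eqv_sym tree_eqv_trans.

(* The free commutative magma on six generators. *)
Definition magma := {eq_quot tree_eqv_equiv}.
HB.instance Definition _ := Choice.on magma.
HB.instance Definition _ : EqQuotient tree tree_eqv magma :=
  EqQuotient.on magma.

Definition mgen (i : 'I_3) (e : bool) : magma := \pi_magma (Leaf (i, e)).
Definition mdot (x y : magma) : magma := \pi_magma (Node (repr x) (repr y)).

Lemma mdotC : commutative mdot.
Proof.
by move=> x y; apply/eqmodP => /=; rewrite !tree_eqv_refl orbT.
Qed.

Lemma mdot_pi (x y : tree) : mdot (\pi_magma x) (\pi_magma y) = \pi_magma (Node x y).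
Proof.
have E z : tree_eqv (repr (\pi_magma z)) z.
  by apply/(@eqquotP _ tree_eqv magma); rewrite reprK.
by apply/eqmodP; rewrite /= !E.
Qed.

Inductive assoc_eqv : magma * magma -> magma * magma -> Prop :=
| assoc_step x y z : assoc_eqv (mdot x y, z) (x, mdot y z)
| assoc_refl p : assoc_eqv p p
| assoc_sym p q : assoc_eqv p q -> assoc_eqv q p
| assoc_trans q p r : assoc_eqv p q -> assoc_eqv q r -> assoc_eqv p r.

Definition assoc_eqvb (p q : magma * magma) : bool := `[< assoc_eqv p q >].

Fact assoc_eqvb_refl : reflexive assoc_eqvb.
Proof. by move=> p; apply/asboolP/assoc_refl. Qed.
Fact assoc_eqvb_sym : symmetric assoc_eqvb.
Proof. by move=> p q; apply/asboolP/asboolP => /assoc_sym. Qed.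
Fact assoc_eqvb_trans : transitive assoc_eqvb.
Proof.
by move=> q p r /asboolP pq /asboolP qr; apply/asboolP/(assoc_trans pq).
Qed.

Canonical assoc_eqv_equiv :=
  EquivRel assoc_eqvb assoc_eqvb_refl assoc_eqvb_sym assoc_eqvb_trans.

Definition pair_class := {eq_quot assoc_eqv_equiv}.
HB.instance Definition _ := Choice.on pair_class.
HB.instance Definition _ : EqQuotient (magma * magma)%type assoc_eqvb pair_class
  := EqQuotient.on pair_class.

Definition pclass (x y : magma) : pair_class := \pi_pair_class (x, y).

Lemma pclass_mdot x y z : pclass (mdot x y) z = pclass x (mdot y z).
Proof. exact/eqmodP/asboolP/assoc_step. Qed.

Section BilinearExtension.
Variables (R : comNzRingType) (X : choiceType).

Definition lin_ext (W : lmodType R) (f : X -> W) (u : {malg R[X]}) : W :=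
  \sum_(x <- msupp u) u@_x *: f x.

Lemma lin_extEw (W : lmodType R) (f : X -> W) (d : {fset X}) u :
  (msupp u `<=` d)%fset -> lin_ext f u = \sum_(x <- d) u@_x *: f x.
Proof.
move=> le; rewrite /lin_ext (big_fset_incl _ le) // => x _ xu.
by rewrite mcoeff_outdom // scale0r.
Qed.

Lemma lin_extP (W : lmodType R) (f : X -> W) c u v :
  lin_ext f (c *: u + v) = c *: lin_ext f u + lin_ext f v.
Proof.
set d := (msupp u `|` msupp v `|` msupp (c *: u + v))%fset.
rewrite !(@lin_extEw W f d) /d; first last.
- exact: fsubsetUr.
- by rewrite -fsetUA; apply: fsubsetUl.
- by rewrite fsetUAC; apply: fsubsetUr.
rewrite scaler_sumr -big_split /=; apply: eq_bigr => x _.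
by rewrite mcoeffD mcoeffZ scalerDl scalerA.
Qed.

Lemma lin_ext_comb (W : lmodType R) (f g : X -> W) c u :
  lin_ext (fun x => c *: f x + g x) u = c *: lin_ext f u + lin_ext g u.
Proof.
rewrite scaler_sumr -big_split /=; apply: eq_bigr => x _.
by rewrite scalerDr !scalerA [c * _]mulrC.
Qed.

Definition bilin_ext (W : lmodType R) (f : X -> X -> W) (u v : {malg R[X]}) :=
  lin_ext (fun x => lin_ext (f x) v) u.

Lemma bilin_extE (W : lmodType R) (f : X -> X -> W) u v :
  bilin_ext f u v =
  \sum_(x <- msupp u) \sum_(y <- msupp v) (u@_x * v@_y) *: f x y.
Proof.
apply: eq_bigr => x _; rewrite scaler_sumr; apply: eq_bigr => y _.
by rewrite scalerA.
Qed.

Lemma bilin_extC (W : lmodType R) (f : X -> X -> W) u v :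
  commutative f -> bilin_ext f u v = bilin_ext f v u.
Proof.
move=> fC; rewrite !bilin_extE exchange_big /=.
by apply: eq_bigr => y _; apply: eq_bigr => x _; rewrite mulrC fC.
Qed.

Lemma bilin_extPl (W : lmodType R) (f : X -> X -> W) c u v w :
  bilin_ext f (c *: u + v) w = c *: bilin_ext f u w + bilin_ext f v w.
Proof. exact: lin_extP. Qed.

Lemma bilin_extPr (W : lmodType R) (f : X -> X -> W) c u v w :
  bilin_ext f w (c *: u + v) = c *: bilin_ext f w u + bilin_ext f w v.
Proof.
rewrite -lin_ext_comb; congr (lin_ext _ w).
by apply/funext => t; rewrite lin_extP.
Qed.

End BilinearExtension.

Section FreeAlgebra.
Variable K : realType.

Definition Rhat := {malg K[{cmonom pair_class}]}.
HB.instance Definition _ := GRing.ComNzRing.on Rhat.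

Definition lambda (x y : magma) : Rhat := << ucm (pclass x y) >>.

Definition Mhat := {malg Rhat[magma]}.
HB.instance Definition _ := GRing.Lmodule.on Mhat.

Definition Mprd : Mhat -> Mhat -> Mhat := bilin_ext (fun x y => << mdot x y >>).
Definition Mform : Mhat -> Mhat -> Rhat :=
  @bilin_ext Rhat magma Rhat^o lambda.

Fact MprdC : commutative Mprd.
Proof. by move=> u v; apply: bilin_extC => x y; rewrite mdotC. Qed.

Fact MprdP c x y z : Mprd (c *: x + y) z = c *: Mprd x z + Mprd y z.
Proof. exact: bilin_extPl. Qed.

Fact MformPl c x y z : Mform (c *: x + y) z = c * Mform x z + Mform y z.
Proof. exact: (@bilin_extPl Rhat magma Rhat^o lambda). Qed.

Fact MformPr c x y z : Mform z (c *: x + y) = c * Mform z x + Mform z y.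
Proof. exact: (@bilin_extPr Rhat magma Rhat^o lambda). Qed.

Lemma MprdE (x y : magma) : Mprd << x >> << y >> = << mdot x y >>.
Proof.
rewrite /Mprd bilin_extE !msuppU oner_eq0 !big_seq_fset1 !mcoeffUU mulr1.
exact: scale1r.
Qed.

Lemma MformE (x y : magma) : Mform << x >> << y >> = lambda x y.
Proof.
rewrite /Mform bilin_extE !msuppU oner_eq0 !big_seq_fset1 !mcoeffUU mulr1.
exact: mul1r.
Qed.

Definition free_algebra : algebra K :=
  @Algebra K Rhat (@malgC {cmonom pair_class} K) Mhat Mprd Mform
    (fun i e => << mgen i e >>) MprdC MprdP MformPl MformPr.

End FreeAlgebra.

Section UniversalAlgebra.
Variable K : realType.
Local Notation Mh := (free_algebra K).

Definition in_class_4A (P : ideal_pair Mh) :=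
  ~ idJ P 1 /\ class_4A (quotient P).

Definition le_pair (P Q : ideal_pair Mh) :=
  (idI P `<=` idI Q)%classic /\ (idJ P `<=` idJ Q)%classic.

Definition smallest_pair (P : ideal_pair Mh) :=
  in_class_4A P /\ forall Q, in_class_4A Q -> le_pair P Q.

Definition capI : set (car Mh) := fun x => forall P, in_class_4A P -> idI P x.
Definition capJ : set (coef Mh) := fun r => forall P, in_class_4A P -> idJ P r.

Fact capI0 : capI 0. Proof. by move=> P _; apply: idI0. Qed.
Fact capIP c x y : capI x -> capI y -> capI (c *: x + y).
Proof. by move=> Ix Iy P CP; apply: idIP; [apply: Ix | apply: Iy]. Qed.
Fact capIM x y : capI x -> capI (prd x y).
Proof. by move=> Ix P CP; apply/idIM/Ix. Qed.
Fact capJ0 : capJ 0. Proof. by move=> P _; apply: idJ0. Qed.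
Fact capJP c r s : capJ r -> capJ s -> capJ (c * r + s).
Proof. by move=> Jr Js P CP; apply: idJP; [apply: Jr | apply: Js]. Qed.
Fact capJI r x : capJ r -> capI (r *: x).
Proof. by move=> Jr P CP; apply/idJI/Jr. Qed.
Fact capIJl x y : capI x -> capJ (form x y).
Proof. by move=> Ix P CP; apply/idIJl/Ix. Qed.
Fact capIJr x y : capI x -> capJ (form y x).
Proof. by move=> Ix P CP; apply/idIJr/Ix. Qed.

(* The smallest pair is taken to be the intersection of all pairs in the      *)
(* class, as [smallest_pairE] justifies.                                      *)
Definition pair_4A : ideal_pair Mh :=
  IdealPair capI0 capIP capIM capJ0 capJP capJI capIJl capIJr.

Lemma smallest_pairE P :
  smallest_pair P -> idI P = idI pair_4A /\ idJ P = idJ pair_4A.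
Proof.
case=> CP leP; split; apply/seteqP; split=> x.
- by move=> Px Q /leP [+ _]; apply.
- by apply.
- by move=> Px Q /leP [_ +]; apply.
- by apply.
Qed.

Definition M4A : algebra K := quotient pair_4A.

Definition t_4A : coef M4A := form (gen M4A 0 true) (v_4A M4A 1 2%:R).

(* The algebra M(t), over the ring R_4A / (t_4A - t), a copy of the reals. *)
Definition M_at (t : K) : algebra K :=
  quotient (mult_pair (t_4A - iota M4A t)).

End UniversalAlgebra.

(* Main.v *)
(* M_4A is an explicit 12-dimensional algebra N over R[c], where c = 1 - 12 t. *)
(* Put s_i = a_i + a_-i and d_i = a_i - a_-i.  For -1 <= c <= 1 the s_i are    *)
(* the projections on unit vectors v_i of a 3-dimensional Hermitian space with *)
(* |<v_i,v_j>| = 1/4, the phase of <v_1,v_2><v_2,v_3><v_3,v_1> having real     *)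
(* part c, and they generate a Jordan algebra of Hermitian matrices x.         *)
(* Moreover d_i x = <v_i|x|v_i> d_i, d_i d_i = s_i, and d_i d_j = 0.           *)
(*                                                                             *)
(* Universality: every algebra of the class receives a linear map from N.  As  *)
(* products of eigenvectors of an axis obey the fusion rules in both algebras, *)
(* the axis acts on the failure of multiplicativity at two eigenvectors by two *)
(* different scalars; this forces multiplicativity, first on the s_i and then  *)
(* on products with them.                                                      *)
(*                                                                             *)
(* Positivity: for |c| <= 1 the form is 2 tr(xy) on the Hermitian part, hence  *)
(* positive semidefinite, and the difference in Norton's inequality is there a *)
(* multiple of |[x,y]|^2; the d_i only add Cauchy-Schwarz terms                *)
(* <v_i|x^2|v_i> - <v_i|x|v_i>^2 and squares.  The form is definite if         *)
(* |c| < 1, it has a 3-dimensional radical if |c| = 1, and a vector of norm    *)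
(* proportional to 1 - c^2 rules out |c| >= 1.                                 *)

From HB Require Import structures.
From mathcomp Require Import all_boot all_order all_algebra.
From mathcomp Require Import finmap monalg complex ring lra.
From mathcomp Require Import boolp classical_sets reals.
Require Import Defs.

Set Implicit Arguments.
Unset Strict Implicit.
Unset Printing Implicit Defensive.

Import Order.TTheory GRing.Theory Num.Theory.
Local Open Scope ring_scope.

(** The algebra M(t) becomes computable through an explicit model. For every coefficient ring
    containing the reals and every scalar c, the free module of rank 12 called [model] satisfies all
    axioms of the class ([model_class_4A]). Every member A of the class receives a homomorphism from
    the model over its own coefficient ring, with c = [cA4 A] ([universal_hom]). Over the polynomial
    ring, with c = X, the model is therefore initial in the class, and the smallest pair of ideals
    of the free algebra is the kernel of evaluation in it ([generic_universal], [pair_4AE]). As 12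
    <a_1, v_(2,3)> = 1 - c ([model_t]), giving t a real value amounts to evaluating X at 1 - 12 t
    ([M_at_model]), and the interval 0 < t < 1/6 becomes -1 < c < 1.

    Universality rests on the defects [dl] and [phi] of the only possible linear map [Psi]. If u and
    w are eigenvectors of an axis in the model and their images are eigenvectors in A, the fusion
    rules hold for both products, so the axis acts on [dl u w] in a prescribed way ([dl_fuse],
    [dl_fuse44]). Playing several such conditions against each other leaves only zero: for products
    with axes in [dl_phase1'], for the form in [phi_all], for all products in [dl_S_mul] and
    [dl_all].

    For |c| <= 1 choose a unit complex number w with real part c. Elements without D coordinates act
    on a three-dimensional space with a basis v_i of Gram matrix [gram] / 4, which is positive
    definite for all these c ([gram_LDL]). Their product is the Jordan product and their form is
    twice the trace form ([herm_prd], [herm_tr]). The form is thus a sum of squares, and Norton's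
    difference is the squared norm of a commutator ([norton_even]). The D coordinates add Norton
    differences of even elements and squares ([norton_gap_split]).

    The radical of the form is the kernel of [herm], given by R + w Q = 0 in each pair of
    coordinates ([form_eq0]). It is zero when w is not real. When c = 1 or c = -1, w is real, the
    matrices are real symmetric, and 6 + 3 = 9 dimensions survive in the quotient by the radical
    ([nine_dimensional_quotient]). Conversely Q_0 - c R_0 is a nonzero vector of norm 960 (1 - c^2),
    so a Majorana algebra needs |c| < 1 ([Majorana_bounds]). *)

(** * Bilinearity and eigenspaces in a general algebra *)

Section AlgebraExtra.
Variables (K : realType) (A : algebra K).
Local Notation V := (car A).
Local Notation "x ** y" := (prd x y) (at level 40, left associativity).
Implicit Types (x y z : V).

Lemma prdDl x y z : (x + y) ** z = x ** z + y ** z.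
Proof. by rewrite -[x in LHS]scale1r prdP scale1r. Qed.
Lemma prdDr x y z : z ** (x + y) = z ** x + z ** y.
Proof. by rewrite prdC prdDl !(prdC z). Qed.
Lemma prdZr c x y : x ** (c *: y) = c *: (x ** y).
Proof. by rewrite prdC prdZl prdC. Qed.
Lemma prd0l x : 0 ** x = 0.
Proof. by rewrite -[X in X ** _](subrr x) prdBl subrr. Qed.

Lemma prd0r x : x ** 0 = 0. Proof. by rewrite prdC prd0l. Qed.
Lemma prdBr x y z : z ** (x - y) = z ** x - z ** y.
Proof. by rewrite prdC prdBl !(prdC z). Qed.
Lemma prdNr x y : x ** (- y) = - (x ** y).
Proof. by rewrite -scaleN1r prdZr scaleN1r. Qed.
Lemma formDr x y z : form z (x + y) = form z x + form z y.
Proof. by rewrite -[x in LHS]scale1r formPr mul1r. Qed.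
Lemma form0l x : form 0 x = 0.
Proof. by rewrite -[X in form X _](subrr x) formBl subrr. Qed.
Lemma form0r x : form x 0 = 0.
Proof. by rewrite -[X in form _ X](subrr x) formBr subrr. Qed.

Lemma iota_scale_inj (r : K) x : r != 0 -> iota A r *: x = 0 -> x = 0.
Proof.
move=> r0 /(congr1 (fun y => iota A r^-1 *: y)).
by rewrite scalerA -rmorphM mulVf // rmorph1 scale1r scaler0.
Qed.

Lemma natr_scale_inj n x : n.+1%:R *: x = 0 -> x = 0.
Proof.
rewrite -(rmorph_nat (iota A)) => /iota_scale_inj; apply.
by rewrite pnatr_eq0.
Qed.

Lemma iota_mul_inj (r : K) (s : coef A) : r != 0 -> iota A r * s = 0 -> s = 0.
Proof.
move=> r0 /(congr1 (fun q => iota A r^-1 * q)).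
by rewrite mulrA -rmorphM mulVf // rmorph1 mul1r mulr0.
Qed.

Lemma natr_mul_inj n (s : coef A) : n.+1%:R * s = 0 -> s = 0.
Proof.
rewrite -(rmorph_nat (iota A)) => /iota_mul_inj; apply.
by rewrite pnatr_eq0.
Qed.

(** Eigenvalues are taken in the field [K], where differences of distinct ones are invertible; the
    coefficient ring may have zero divisors. *)
Definition ev (l : eigval) : K :=
  match l with ev1 => 1 | ev0 => 0 | ev4 => 1 / 4 | ev32 => 1 / 32 end.

Lemma eigval_ofE l : eigval_of A l = iota A (ev l).
Proof. by case: l; rewrite /= ?rmorph1 ?rmorph0. Qed.

Lemma ev_inj : injective ev.
Proof.
move=> l m; apply: contraPP => lm.
by case: l m lm => -[] //= _; lra.
Qed.

Lemma eigen0 a l : eigen a l (0 : V).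
Proof. by rewrite /eigen prd0r scaler0. Qed.
Lemma eigenP a l c x y : eigen a l x -> eigen a l y -> eigen a l (c *: x + y).
Proof.
rewrite /eigen => ex ey.
by rewrite prdDr prdZr ex ey scalerDr !scalerA mulrC.
Qed.
Lemma eigenZ a l c x : eigen a l x -> eigen a l (c *: x).
Proof. by move=> ex; rewrite -[_ *: _]addr0; apply: eigenP => //; apply: eigen0. Qed.

(** The operator a - m kills the component for m and scales the others by real numbers. Applying it
    for the three eigenvalues other than l isolates [f l] times a nonzero real, which can be
    cancelled. Directness of the eigenspace sum is therefore automatic over any coefficient ring. *)
Lemma eigen_free a (f : eigval -> V) : (forall l, eigen a l (f l)) ->
  \sum_(l <- monster) f l = 0 -> forall l, f l = 0.
Proof.
have step m (g : eigval -> V) : (forall l, eigen a l (g l)) ->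
    \sum_(l <- monster) g l = 0 ->
    \sum_(l <- monster) iota A (ev l - ev m) *: g l = 0.
  move=> eg g0; transitivity (a ** (\sum_(l <- monster) g l)
    - iota A (ev m) *: \sum_(l <- monster) g l); last first.
    by rewrite g0 prd0r scaler0 subrr.
  rewrite (big_morph (prd a) (fun x y => prdDr x y a) (prd0r a)) scaler_sumr -sumrB.
  by apply: eq_bigr => l _; rewrite eg eigval_ofE -scalerBl rmorphB.
move=> ef f0.
have H m1 m2 m3 : \sum_(l <- monster) iota A
    ((ev l - ev m3) * ((ev l - ev m2) * (ev l - ev m1))) *: f l = 0.
  rewrite -[RHS](step m3 (fun l => iota A (ev l - ev m2) *:
    (iota A (ev l - ev m1) *: f l))).
  - by apply: eq_bigr => l _; rewrite !scalerA -!rmorphM mulrA.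
  - by move=> l; do 2!apply: eigenZ.
  - by apply: (step) => [l|]; [apply: eigenZ | apply: (step)].
move=> l.
have nz (m : eigval) : m <> l -> ev l - ev m != 0.
  by move=> ml; rewrite subr_eq0; apply/eqP => /ev_inj /esym.
have [m1 [m2 [m3 [n1 n2 n3 Hl]]]] : exists m1 m2 m3, [/\ m1 <> l, m2 <> l, m3 <> l
    & \sum_(n <- monster) iota A
      ((ev n - ev m3) * ((ev n - ev m2) * (ev n - ev m1))) *: f n
      = iota A ((ev l - ev m3) * ((ev l - ev m2) * (ev l - ev m1))) *: f l].
  case: {nz} l.
  - exists ev0, ev4, ev32; split=> //.
    rewrite !big_cons big_nil !subrr !mulr0 !mul0r !mulr0 rmorph0 !scale0r.
    by rewrite !addr0.
  - exists ev1, ev4, ev32; split=> //.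
    rewrite !big_cons big_nil !subrr !mulr0 !mul0r !mulr0 rmorph0 !scale0r.
    by rewrite !addr0 add0r.
  - exists ev1, ev0, ev32; split=> //.
    rewrite !big_cons big_nil !subrr !mulr0 !mul0r !mulr0 rmorph0 !scale0r.
    by rewrite !addr0 !add0r.
  - exists ev1, ev0, ev4; split=> //.
    rewrite !big_cons big_nil !subrr !mulr0 !mul0r !mulr0 rmorph0 !scale0r.
    by rewrite !addr0 !add0r.
have := H m1 m2 m3; rewrite Hl => /iota_scale_inj; apply.
by rewrite !mulf_neq0 ?nz.
Qed.


Lemma eigen_sum_eigen a l x : eigen a l x -> eigen_sum a [:: l] x.
Proof.
move=> ex; exists (fun m => if ev m == ev l then x else 0).
  by move=> m; case: eqP => [/ev_inj ->|_] //; apply: eigen0.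
by rewrite big_seq1 eqxx.
Qed.

Lemma eigen_sum1 a l x : eigen_sum a [:: l] x -> eigen a l x.
Proof. by case=> f ef ->; rewrite big_seq1. Qed.

End AlgebraExtra.

(** * Homomorphisms *)

(** Quotients change the coefficient ring together with the algebra, so [hv] is semilinear over
    [hc]. Preserving the marked generators and the form makes homomorphisms out of the free algebra
    unique. *)
Record ahom (K : realType) (A B : algebra K) := Ahom {
  hc : {rmorphism coef A -> coef B};
  hv : car A -> car B;
  hcI : forall r, hc (iota A r) = iota B r;
  hvP : forall c x y, hv (c *: x + y) = hc c *: hv x + hv y;
  hvM : forall x y, hv (prd x y) = prd (hv x) (hv y);
  hvF : forall x y, hc (form x y) = form (hv x) (hv y);
  hvG : forall i e, hv (gen A i e) = gen B i e }.

Section AhomTheory.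
Variables (K : realType) (A B : algebra K) (F : ahom A B).
Implicit Types x y : car A.

Lemma hvD x y : hv F (x + y) = hv F x + hv F y.
Proof. by rewrite -[x in LHS]scale1r hvP rmorph1 scale1r. Qed.
Lemma hv0 : hv F 0 = 0.
Proof. by apply: (addIr (hv F 0)); rewrite -hvD add0r add0r. Qed.
Lemma hvZ c x : hv F (c *: x) = hc F c *: hv F x.
Proof. by rewrite -[_ *: _ in LHS]addr0 hvP hv0 addr0. Qed.
Lemma hvN x : hv F (- x) = - hv F x.
Proof. by rewrite -scaleN1r hvZ rmorphN1 scaleN1r. Qed.
Lemma hvB x y : hv F (x - y) = hv F x - hv F y.
Proof. by rewrite hvD hvN. Qed.
Lemma hv_sum I (r : seq I) (P : pred I) (f : I -> car A) :
  hv F (\sum_(i <- r | P i) f i) = \sum_(i <- r | P i) hv F (f i).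
Proof. by rewrite (big_morph (hv F) hvD hv0). Qed.

Lemma hc_eigval l : hc F (eigval_of A l) = eigval_of B l.
Proof. by rewrite !eigval_ofE hcI. Qed.

Lemma hv_eigen a l x : eigen a l x -> eigen (hv F a) l (hv F x).
Proof. by rewrite /eigen -hvM => ->; rewrite hvZ hc_eigval. Qed.

Lemma hv_eigen_sum a L x : eigen_sum a L x -> eigen_sum (hv F a) L (hv F x).
Proof.
move=> [f ef ->]; exists (fun l => hv F (f l)); last exact: hv_sum.
by move=> l; apply: hv_eigen.
Qed.

Lemma hv_generated (X : set (car A)) (Y : set (car B)) x :
  (forall y, X y -> Y (hv F y)) ->
  generated_by X x -> generated_by Y (hv F x).
Proof.
move=> XY gx C [C0 CP CM] YC; apply: (gx (fun y => C (hv F y))); last first.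
  by move=> y Xy; apply/YC/XY.
split=> [|r u v Cu Cv|u v Cu Cv]; first by rewrite hv0.
- by rewrite hvP; apply: CP.
- by rewrite hvM; apply: CM.
Qed.

Lemma hv_v_4A i j : hv F (v_4A A i j) = v_4A B i j.
Proof.
by rewrite /v_4A hvZ hvB !hvD !hvZ hvM !hvG !rmorph_nat hcI.
Qed.

Fact kerIP c x y : hv F x = 0 -> hv F y = 0 -> hv F (c *: x + y) = 0.
Proof. by move=> hx hy; rewrite hvP hx hy scaler0 addr0. Qed.
Fact kerIM x y : hv F x = 0 -> hv F (prd x y) = 0.
Proof. by move=> hx; rewrite hvM hx prd0l. Qed.
Fact kerJP c r s : hc F r = 0 -> hc F s = 0 -> hc F (c * r + s) = 0.
Proof. by move=> hr hs; rewrite rmorphD rmorphM hr hs mulr0 addr0. Qed.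
Fact kerJI r x : hc F r = 0 -> hv F (r *: x) = 0.
Proof. by move=> hr; rewrite hvZ hr scale0r. Qed.
Fact kerIJl x y : hv F x = 0 -> hc F (form x y) = 0.
Proof. by move=> hx; rewrite hvF hx form0l. Qed.
Fact kerIJr x y : hv F x = 0 -> hc F (form y x) = 0.
Proof. by move=> hx; rewrite hvF hx form0r. Qed.

Definition ker_pair : ideal_pair A :=
  @IdealPair K A (fun x => hv F x = 0) (fun r => hc F r = 0)
    hv0 kerIP kerIM (rmorph0 (hc F)) kerJP kerJI kerIJl kerIJr.

Local Notation Q := (quotient ker_pair).

Definition ker_hc (r : coef Q) : coef B := hc F (rep_coef r).
Definition ker_hv (x : car Q) : car B := hv F (rep_car x).

Lemma ker_hc_pi r : ker_hc (pi_coef ker_pair r) = hc F r.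
Proof.
by apply/eqP; rewrite -subr_eq0 -rmorphB; apply/eqP/(rep_pi_coef ker_pair).
Qed.
Lemma ker_hv_pi x : ker_hv (pi_car ker_pair x) = hv F x.
Proof.
by apply/eqP; rewrite -subr_eq0 -hvB; apply/eqP/(rep_pi_car ker_pair).
Qed.

Fact ker_hc_zmod : zmod_morphism ker_hc.
Proof.
move=> r s; rewrite -[r]rep_coefK -[s]rep_coefK.
rewrite !ker_hc_pi -rmorphB -ker_hc_pi; congr ker_hc.
apply: (addIr (pi_coef ker_pair (rep_coef s))).
by rewrite subrK -pi_coefD subrK.
Qed.
Fact ker_hc_monoid : monoid_morphism ker_hc.
Proof.
split; first by rewrite -[1](pi_coef1 ker_pair) ker_hc_pi rmorph1.
move=> r s; rewrite -[r]rep_coefK -[s]rep_coefK.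
by rewrite -(pi_coefM ker_pair) !ker_hc_pi rmorphM.
Qed.
HB.instance Definition _ :=
  GRing.isZmodMorphism.Build (coef Q) (coef B) ker_hc ker_hc_zmod.
HB.instance Definition _ :=
  GRing.isMonoidMorphism.Build (coef Q) (coef B) ker_hc ker_hc_monoid.

Fact ker_hcI r : ker_hc (iota Q r) = iota B r.
Proof. by rewrite /= /qiota ker_hc_pi hcI. Qed.
Fact ker_hvP (c : coef Q) (x y : car Q) : ker_hv (c *: x + y) = ker_hc c *: ker_hv x + ker_hv y.
Proof.
rewrite -[c]rep_coefK -[x]rep_carK -[y]rep_carK.
have -> : pi_coef ker_pair (rep_coef c) *: pi_car ker_pair (rep_car x)
  + pi_car ker_pair (rep_car y) = pi_car ker_pair (rep_coef c *: rep_car x + rep_car y).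
  by rewrite pi_carD pi_carZ.
by rewrite !ker_hv_pi ker_hc_pi hvP.
Qed.
Fact ker_hvM (x y : car Q) : ker_hv (@prd K Q x y) = prd (ker_hv x) (ker_hv y).
Proof.
rewrite -[x]rep_carK -[y]rep_carK /= pi_prd.
by rewrite !ker_hv_pi hvM.
Qed.
Fact ker_hvF (x y : car Q) : ker_hc (@form K Q x y) = form (ker_hv x) (ker_hv y).
Proof.
rewrite -[x]rep_carK -[y]rep_carK /= pi_form.
by rewrite ker_hc_pi !ker_hv_pi hvF.
Qed.
Fact ker_hvG i e : ker_hv (gen Q i e) = gen B i e.
Proof. by rewrite /= ker_hv_pi hvG. Qed.

(** The injective map of the first isomorphism theorem; it is an isomorphism when [F] is surjective
    ([ker_hom_bij]). *)
Definition ker_hom : ahom Q B :=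
  @Ahom K Q B ker_hc ker_hv ker_hcI ker_hvP ker_hvM ker_hvF ker_hvG.

Lemma ker_hc_inj : injective ker_hc.
Proof.
move=> r s; rewrite -[r]rep_coefK -[s]rep_coefK !ker_hc_pi => E.
by apply/pi_coefE; rewrite /= rmorphB E subrr.
Qed.
Lemma ker_hv_inj : injective ker_hv.
Proof.
move=> r s; rewrite -[r]rep_carK -[s]rep_carK !ker_hv_pi => E.
by apply/pi_carE; rewrite /= hvB E subrr.
Qed.

End AhomTheory.

Section AhomCategory.
Variables (K : realType) (A B C : algebra K).

Definition comp_ahom (G : ahom B C) (F : ahom A B) : ahom A C.
Proof.
apply: (@Ahom K A C (hc G \o hc F) (hv G \o hv F)).
- by move=> r; rewrite /= !hcI.
- by move=> c x y; rewrite /= !hvP.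
- by move=> x y; rewrite /= !hvM.
- by move=> x y; rewrite /= !hvF.
- by move=> i e; rewrite /= !hvG.
Defined.

Variable P : ideal_pair A.

Fact pi_coef_zmod : zmod_morphism (pi_coef P).
Proof.
move=> r s; apply: (addIr (pi_coef P s)).
by rewrite subrK -pi_coefD subrK.
Qed.
Fact pi_coef_monoid : monoid_morphism (pi_coef P).
Proof. by split => // r s; rewrite pi_coefM. Qed.
HB.instance Definition _ :=
  GRing.isZmodMorphism.Build (coef A) (coef (quotient P)) (pi_coef P) pi_coef_zmod.
HB.instance Definition _ :=
  GRing.isMonoidMorphism.Build (coef A) (coef (quotient P)) (pi_coef P)
    pi_coef_monoid.

Fact pi_carP c x y :
  pi_car P (c *: x + y) = (pi_coef P c : coef (quotient P)) *: (pi_car P x : car (quotient P)) + pi_car P y.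
Proof. by rewrite pi_carD pi_carZ. Qed.

Definition pi_hom : ahom A (quotient P) :=
  @Ahom K A (quotient P) (pi_coef P) (pi_car P) (fun=> erefl) pi_carP
    (fun x y => esym (pi_prd P x y)) (fun x y => esym (pi_form P x y))
    (fun i e => erefl).

End AhomCategory.

Lemma ideal_pair_eq (K : realType) (A : algebra K) (P Q : ideal_pair A) :
  idI P = idI Q -> idJ P = idJ Q -> P = Q.
Proof.
case: P Q => [I J I0 IP IM J0 JP JI IJl IJr] [I' J' I0' IP' IM' J0' JP' JI' IJl' IJr'] /= EI EJ.
subst I' J'; congr IdealPair; exact: Prop_irrelevance.
Qed.

Section InverseAhom.
Variables (K : realType) (A B : algebra K) (F : ahom A B).
Hypothesis Fc : bijective (hc F).
Hypothesis Fv : bijective (hv F).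

Lemma inverse_ahom : exists G : ahom B A,
  [/\ cancel (hc F) (hc G), cancel (hc G) (hc F),
      cancel (hv F) (hv G) & cancel (hv G) (hv F)].
Proof.
case: Fc => gc FcK gcK; case: Fv => gv FvK gvK.
have gzm : zmod_morphism gc.
  by move=> r s; apply: (can_inj FcK); rewrite rmorphB !gcK.
have gmm : monoid_morphism gc.
  split=> [|r s]; apply: (can_inj FcK); first by rewrite gcK rmorph1.
  by rewrite rmorphM !gcK.
pose zm := GRing.isZmodMorphism.Build (coef B) (coef A) gc gzm.
pose mm := GRing.isMonoidMorphism.Build (coef B) (coef A) gc gmm.
pose g : {rmorphism coef B -> coef A} := HB.pack gc zm mm.
have gI r : g (iota B r) = iota A r by rewrite -(hcI F); apply: FcK.
have gP c x y : gv (c *: x + y) = g c *: gv x + gv y.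
  by apply: (can_inj FvK); rewrite hvP !gvK; congr (_ *: _ + _); rewrite gcK.
have gM x y : gv (prd x y) = prd (gv x) (gv y).
  by apply: (can_inj FvK); rewrite hvM !gvK.
have gF x y : g (form x y) = form (gv x) (gv y).
  by apply: (can_inj FcK); rewrite hvF !gvK; apply: gcK.
have gG i e : gv (gen B i e) = gen A i e.
  by apply: (can_inj FvK); rewrite hvG gvK.
by exists (Ahom gI gP gM gF gG).
Qed.

End InverseAhom.

(** * Transfer of the axioms to quotients and along isomorphisms *)

Section Transfer.
Variables (K : realType).
Implicit Types A B : algebra K.

Lemma axisI A (a : car A) :
  prd a a = a -> (forall v, eigen_sum a monster v) ->
  (forall l m u v, eigen a l u -> eigen a m v ->
    eigen_sum a (fuse l m) (prd u v)) -> axis a.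
Proof. by move=> aa dec fus; split=> // f; apply: eigen_free. Qed.

Lemma eigen_component A (a : car A) l u (f : eigval -> car A) :
  (forall m, eigen a m (f m)) -> eigen a l u -> u = \sum_(m <- monster) f m ->
  u = f l.
Proof.
move=> ef eu Eu.
pose g m := f m - (if ev K m == ev K l then u else 0).
have eg m : eigen a m (g m).
  rewrite /g -scaleN1r addrC; apply: eigenP => //.
  by case: eqP => [/ev_inj ->|_] //; apply: eigen0.
have g0 : \sum_(m <- monster) g m = 0.
  rewrite /g big_split /= -Eu sumrN.
  suff -> : \sum_(m <- monster) (if ev K m == ev K l then u else 0) = u.
    by rewrite subrr.
  have ne m n : m <> n -> (ev K m == ev K n) = false.
    by move=> mn; apply/eqP => /ev_inj.
  by case: {eu eg g} l; rewrite /monster !big_cons big_nil !eqxx !ne //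
    ?addr0 ?add0r.
have := eigen_free eg g0 l.
by rewrite /g eqxx => /eqP; rewrite subr_eq0 => /eqP ->.
Qed.

(** An eigenvector of a quotient lifts to an eigenvector: decompose any representative and keep the
    component for the same eigenvalue, which has the right image by [eigen_component]. Fusion rules
    and primitivity then descend. *)
Lemma quotient_axial A (P : ideal_pair A) :
  injective (iota (quotient P)) -> primitive_frobenius_axial A ->
  primitive_frobenius_axial (quotient P).
Proof.
move=> inj [_ ax genA [_ assoc g1]]; pose p := pi_hom P.
have nz : (1 : coef (quotient P)) <> 0.
  move=> /eqP; rewrite -(rmorph1 (iota (quotient P))).
  rewrite -(rmorph0 (iota (quotient P))) => /eqP /inj /eqP.
  by rewrite oner_eq0.
have lift l i e (u : car (quotient P)) : eigen (gen (quotient P) i e) l u ->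
    exists2 u', eigen (gen A i e) l u' & u = hv p u'.
  move=> eu; have [_ /(_ (rep_car u)) [f ef Ef] _ _] := (ax i e).1.
  exists (f l) => //; apply: (eigen_component (f := fun m => hv p (f m)) _ eu).
    by move=> m; apply: (hv_eigen p (ef m)).
  by rewrite -hv_sum -Ef /= rep_carK.
split=> //.
- move=> i e; have [[aa dec _ fus] prim] := ax i e; split.
    apply: axisI => [|v|l m u v].
    + by rewrite -(hvG p) -hvM aa.
    + by rewrite -[v]rep_carK; apply: (hv_eigen_sum p).
    + move=> /lift [u' eu ->] /lift [v' ev ->].
      by rewrite -hvM; apply: (hv_eigen_sum p); apply: fus.
  move=> v; split=> [/lift [v' /prim [r ->] ->]|[r ->]].
    by exists (hc p r); rewrite hvZ hvG.
  apply: eigenZ; rewrite /eigen scale1r -(hvG p) -hvM.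
  by rewrite aa.
- move=> v; rewrite -[v]rep_carK.
  apply: (@hv_generated _ _ _ p _ _ _) (genA (rep_car v)) => y [i [e ->]].
  by exists i, e; rewrite hvG.
- split; last first.
  + by move=> i e; rewrite -(hvG p) -hvF g1 rmorph1.
  + move=> u v w; rewrite -[u]rep_carK -[v]rep_carK -[w]rep_carK.
    rewrite -!(hvM p (rep_car _)) -!(hvF p).
    by rewrite assoc.
  + exists (gen (quotient P) 0 true), (gen (quotient P) 0 true).
    by rewrite -(hvG p) -hvF g1 rmorph1.
Qed.

Section Iso.
Variables (A B : algebra K) (F : ahom A B) (G : ahom B A).
Hypothesis FcK : cancel (hc F) (hc G).
Hypothesis GcK : cancel (hc G) (hc F).
Hypothesis FvK : cancel (hv F) (hv G).
Hypothesis GvK : cancel (hv G) (hv F).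

Lemma iso_axial : primitive_frobenius_axial B -> primitive_frobenius_axial A.
Proof.
move=> [inj ax genB [_ assoc g1]].
have nz : (1 : coef A) <> 0.
  move=> /(congr1 (hc F)); rewrite rmorph1 rmorph0 => /eqP.
  rewrite -(rmorph1 (iota B)) -(rmorph0 (iota B)) => /eqP /inj /eqP.
  by rewrite oner_eq0.
split.
- by move=> r s /(congr1 (hc F)); rewrite !hcI => /inj.
- move=> i e; have [[aa dec _ fus] prim] := ax i e; split.
    apply: axisI => [|v|l m u v eu ev].
    + by apply: (can_inj FvK); rewrite hvM !hvG.
    + rewrite -(FvK v) -(hvG G); exact: hv_eigen_sum.
    + rewrite -(FvK (prd u v)) -(hvG G) hvM; apply: hv_eigen_sum.
      by apply: fus; rewrite -(hvG F); apply: hv_eigen.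
  move=> v; split=> [|[r ->]].
    move=> /(hv_eigen F); rewrite hvG => /prim [r Er].
    by exists (hc G r); rewrite -(FvK v) Er hvZ hvG.
  rewrite -(FvK (_ *: _)) hvZ hvG -(hvG G); apply/hv_eigen.
  by apply/prim; exists (hc F r).
- move=> v; rewrite -(FvK v).
  apply: (@hv_generated _ _ _ G _ _ _) (genB _) => y [i [e ->]].
  by exists i, e; rewrite hvG.
- split.
  + by exists (gen A 0 true), (gen A 0 true) => E;
      apply: nz; apply: (can_inj FcK); rewrite -E hvF !hvG g1 rmorph1.
  + by move=> u v w; apply: (can_inj FcK); rewrite !hvF !hvM assoc.
  + by move=> i e; apply: (can_inj FcK); rewrite hvF !hvG g1 rmorph1.
Qed.

Lemma iso_miyamoto i e (tau : {linear car B -> car B}) : miyamoto (gen B i e) tau ->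
  exists2 tau' : {linear car A -> car A}, miyamoto (gen A i e) tau'
    & forall v, tau' v = hv G (tau (hv F v)).
Proof.
move=> [t1 t32]; pose f v := hv G (tau (hv F v)).
have flin : linear f.
  move=> c x y; rewrite /f hvP linearP hvP.
  by rewrite FcK.
pose lin := GRing.isLinear.Build (coef A) (car A) (car A) *:%R f flin.
exists (HB.pack_for {linear car A -> car A} f lin) => //.
split=> [l v nl ev|v ev] /=; rewrite /f.
  rewrite (t1 l) ?FvK //.
  by rewrite -(hvG F); apply: hv_eigen.
rewrite t32 ?hvN ?FvK //.
by rewrite -(hvG F); apply: hv_eigen.
Qed.

Lemma iso_type_4A i j v : type_4A i j (hv F v) -> type_4A i j v.
Proof.
move=> [vv span ab [av bv aa bb] [fab [fa fb] fav fbv fvv]].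
have S := (hvZ, hvB, hvD, hvM, hvG, hcI, (rmorph_nat (hc F)), hv0).
have E x y : hv F x = hv F y -> x = y by apply: (can_inj FvK).
have Ec x y : hc F x = hc F y -> x = y by apply: (can_inj FcK).
split.
- by apply: E; rewrite hvM vv.
- move=> x; split.
    move=> gx; have /span : generated_by
        (fun y => y = gen B i true \/ y = gen B j true) (hv F x).
      by apply: hv_generated gx => y [] ->; rewrite hvG; [left|right].
    move=> [c1 [c2 [c3 [c4 [c5 Ex]]]]].
    exists (hc G c1), (hc G c2), (hc G c3), (hc G c4), (hc G c5).
    by apply: E; rewrite Ex !S !GcK.
  move=> [c1 [c2 [c3 [c4 [c5 Ex]]]]].
  rewrite -(FvK x); apply: hv_generated
    (_ : generated_by (fun y => y = gen B i true \/ y = gen B j true) _).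
    by move=> y [] ->; rewrite hvG; [left|right].
  apply/span; exists (hc F c1), (hc F c2), (hc F c3), (hc F c4), (hc F c5).
  by rewrite Ex !S.
- by move=> e d; apply: E; rewrite !S ab.
- by split=> *; apply: E; rewrite !S ?av ?bv ?aa ?bb.
- split=> *; first by apply: Ec; rewrite hvF !S fab.
  + by split; apply: Ec; rewrite hvF !S rmorph0.
  + by apply: Ec; rewrite hvF !S fav.
  + by apply: Ec; rewrite hvF !S fbv.
  + by apply: Ec; rewrite hvF !S fvv.
Qed.

Lemma iso_class_4A : class_4A B -> class_4A A.
Proof.
move=> [ax [inj tau] [v vC tv]]; split; first exact: iso_axial.
  split=> [i j d e E|i d].
    by apply: inj; rewrite -!(hvG F) E.
  have [t /iso_miyamoto [t' mt' Et'] Et] := tau i d.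
  by exists t' => // j e; rewrite Et' hvG Et hvG.
exists (fun i j => hv G (v i j)) => [i j|i j ij]; first by rewrite vC.
by apply: iso_type_4A; rewrite GvK; apply: tv.
Qed.

Lemma iso_Majorana : bijective (iota B) -> primitive_frobenius_axial B ->
  (forall u : car B, u <> 0 -> positive (form u u)) ->
  (forall u v : car B,
    nonnegative (form (prd u u) (prd v v) - form (prd u v) (prd u v))) ->
  Majorana A.
Proof.
move=> [g gK Kg] ax pos nort; split; last 2 first.
- move=> u u0; have [|r r0 Er] := pos (hv F u).
    by move=> E; apply: u0; rewrite -(FvK u) E hv0.
  by exists r => //; apply: (can_inj FcK); rewrite hvF hcI.
- move=> u v; have [r r0 Er] := nort (hv F u) (hv F v).
  by exists r => //; apply: (can_inj FcK); rewrite rmorphB !hvF !hvM hcI.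
- exists (g \o hc F) => x /=; first by rewrite hcI gK.
  by apply: (can_inj FcK); rewrite hcI Kg.
- exact: iso_axial.
Qed.

End Iso.
End Transfer.

(** * The generic algebra *)

(* Locked, here and below, to keep unification from unfolding products. *)
HB.lock Definition nxt (i : 'I_3) : 'I_3 := ordS i.

Lemma nxt3 i : nxt (nxt (nxt i)) = i.
Proof. rewrite nxt.unlock; by apply: val_inj; case: i => [[|[|[|]]]]. Qed.
Lemma nxt_neq i : (nxt i == i) = false.
Proof. by rewrite nxt.unlock; case: i => [[|[|[|]]]]. Qed.
Lemma nxt2_neq i : (nxt (nxt i) == i) = false.
Proof. by rewrite nxt.unlock; case: i => [[|[|[|]]]]. Qed.
Lemma ord3_cases i j : [\/ j = i, j = nxt i | j = nxt (nxt i)].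
Proof.
rewrite nxt.unlock; case: i j => [[|[|[|//]]] ?] [[|[|[|//]]] ?];
  by [apply: Or31; apply: val_inj | apply: Or32; apply: val_inj
     | apply: Or33; apply: val_inj].
Qed.

Notation rS := (@Ordinal 4 0 isT).
Notation rR := (@Ordinal 4 1 isT).
Notation rQ := (@Ordinal 4 2 isT).
Notation rD := (@Ordinal 4 3 isT).

Lemma row4_ind (P : 'I_4 -> Prop) : P rS -> P rR -> P rQ -> P rD -> forall a, P a.
Proof.
move=> pS pR pQ pD [[|[|[|[|//]]]] p].
- by rewrite (_ : Ordinal p = rS) //; apply: val_inj.
- by rewrite (_ : Ordinal p = rR) //; apply: val_inj.
- by rewrite (_ : Ordinal p = rQ) //; apply: val_inj.
- by rewrite (_ : Ordinal p = rD) //; apply: val_inj.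
Qed.

(* The rows hold the coordinates with respect to S_i = 16 s_i, R_i, Q_i and   *)
(* D_i = 16 d_i, where s_i = a_i + a_-i, d_i = a_i - a_-i and, for {i,j,k} =  *)
(* {1,2,3}, R_i = 128 s_j s_k and S_i R_i = 2 (Q_j + Q_k); this scaling makes *)
(* the structure constants integral polynomials in c = 1 - 12 t.              *)
Section Model.
Variables (S : comPzRingType) (c : S).
Local Notation V := 'M[S]_(4, 3).
Implicit Types u v w : V.

Definition mS u v (i : 'I_3) := let j := nxt i in let k := nxt j in
  4 * u rS i * (v rR j + v rR k) + 4 * c * u rS i * (v rQ j + v rQ k)
  + 4 * c * u rR j * v rR k + 16 * c * (u rR j * v rQ j + u rR k * v rQ k)
  + 4 * (u rR j * v rQ k + u rR k * v rQ j) + 4 * c * u rQ j * v rQ k.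
Definition mR u v (i : 'I_3) := let j := nxt i in let k := nxt j in
  2 * u rS j * v rS k + 8 * (u rS j + u rS k) * v rR i
  + 2 * (u rS j * v rQ j + u rS k * v rQ k) + 2 * u rR i * (v rR j + v rR k)
  + 4 * c * u rR i * (v rQ j + v rQ k)
  + 8 * (u rR j * v rQ k + u rR k * v rQ j) + 2 * u rQ i * (v rQ j + v rQ k)
  + 16 * c * u rQ j * v rQ k.
Definition mQ u v (i : 'I_3) := let j := nxt i in let k := nxt j in
  2 * (u rS j * v rR j + u rS k * v rR k) + 8 * (u rS j + u rS k) * v rQ i
  + 8 * u rR j * v rR k + 4 * u rR i * v rQ i - 2 * u rR i * (v rQ j + v rQ k)
  + 2 * (u rR j + u rR k) * v rQ i - 8 * u rQ j * v rQ k.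
(** The number <v_i|x|v_i> for the even part x of [u]. It is also the form of [u] with S_i, divided
    by 32. *)
Definition kap u (i : 'I_3) := let j := nxt i in let k := nxt j in
  16 * u rS i + (u rS j + u rS k) + 8 * (u rR j + u rR k) + 2 * c * u rR i
  + 8 * c * (u rQ j + u rQ k) + 2 * u rQ i.

End Model.

HB.lock Definition mprd (S : comPzRingType) (c : S) (u v : 'M[S]_(4, 3)) : 'M[S]_(4, 3) :=
  \matrix_(a, i)
  let j := nxt i in let k := nxt j in
  match val a with
  | 0 => mS c u v i + mS c v u i + 16 * (u rS i * v rS i + u rR j * v rR j
           + u rR k * v rR k + u rQ j * v rQ j + u rQ k * v rQ k + u rD i * v rD i)
  | 1 => mR c u v i + mR c v u i + 4 * u rR i * v rR i - 4 * u rQ i * v rQ i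
  | 2 => mQ u v i + mQ v u i + 8 * c * u rQ i * v rQ i
  | _ => u rD i * kap c v i + v rD i * kap c u i
  end.

HB.lock Definition bas (S : comPzRingType) (a : 'I_4) (i : 'I_3) : 'M[S]_(4, 3) := delta_mx a i.

Section ModelProduct.
Variables (S : comPzRingType) (c : S).
Local Notation V := 'M[S]_(4, 3).
Implicit Types u v w : V.
Local Notation mS := (mS c).
Local Notation mR := (mR c).
Local Notation kap := (kap c).
Local Notation mprd := (mprd c).
Local Notation bas := (@bas S).

Lemma scE (k : S) u a i : (k *: u) a i = k * u a i. Proof. by rewrite mxE. Qed.
Lemma adE u v a i : (u + v) a i = u a i + v a i. Proof. by rewrite mxE. Qed.
Lemma opE u a i : (- u) a i = - u a i. Proof. by rewrite mxE. Qed.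
Definition linE := (adE, opE, scE).

Lemma mprdE u v a i : mprd u v a i =
  let j := nxt i in let k := nxt j in
  match val a with
  | 0 => mS u v i + mS v u i + 16 * (u rS i * v rS i + u rR j * v rR j
           + u rR k * v rR k + u rQ j * v rQ j + u rQ k * v rQ k + u rD i * v rD i)
  | 1 => mR u v i + mR v u i + 4 * u rR i * v rR i - 4 * u rQ i * v rQ i
  | 2 => mQ u v i + mQ v u i + 8 * c * u rQ i * v rQ i
  | _ => u rD i * kap v i + v rD i * kap u i
  end.
Proof. by rewrite mprd.unlock mxE. Qed.

(** Twice the trace of the Hermitian matrix: S_i, R_i and Q_i have traces 16, 8 and 8 c, and D_i
    counts as 0. *)
Definition mtr u : S :=
  let l i := 32 * u rS i + 16 * u rR i + 16 * c * u rQ i in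
  l ord0 + l (nxt ord0) + l (nxt (nxt ord0)).
Definition mform u v := mtr (mprd u v).

Fact mprdC : commutative mprd.
Proof.
move=> u v; apply/matrixP => a i; elim/row4_ind: a; rewrite !mprdE /=; ring.
Qed.
Fact mprdP k u v w : mprd (k *: u + v) w = k *: mprd u w + mprd v w.
Proof.
apply/matrixP => a i; elim/row4_ind: a; rewrite !linE !mprdE /= /mS /mR /mQ /kap !linE; ring.
Qed.
Lemma mtrP k u v : mtr (k *: u + v) = k * mtr u + mtr v.
Proof. by rewrite /mtr !linE; ring. Qed.
Fact mformPl k u v w : mform (k *: u + v) w = k * mform u w + mform v w.
Proof. by rewrite /mform mprdP mtrP. Qed.
Fact mformPr k u v w : mform w (k *: u + v) = k * mform w u + mform w v.
Proof. by rewrite /mform ![mprd w _]mprdC mprdP mtrP. Qed.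

Lemma basE a i b j : bas a i b j = ((b == a) && (j == i))%:R.
Proof. by rewrite bas.unlock mxE. Qed.
Definition bE := (basE, eqxx, nxt_neq, nxt2_neq, nxt3).

Lemma mtr_rot i u : mtr u =
  let l j := 32 * u rS j + 16 * u rR j + 16 * c * u rQ j in
  l i + l (nxt i) + l (nxt (nxt i)).
Proof.
by rewrite /mtr; case: (ord3_cases ord0 i) => -> /=; rewrite ?nxt3 //; ring.
Qed.

Lemma matrix_linear_ind (P : V -> Prop) :
  P 0 -> (forall k u v, P u -> P v -> P (k *: u + v)) ->
  (forall a i, P (bas a i)) -> forall u, P u.
Proof.
move=> P0 PP Pb u; rewrite [u]matrix_sum_delta.
have PD v w : P v -> P w -> P (v + w).
  by move=> Pv Pw; rewrite -[v]scale1r; apply: PP.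
elim/big_ind: _ => // a _; elim/big_ind: _ => // i _.
by rewrite -[_ *: _]addr0; apply: PP => //; have := Pb a i; rewrite bas.unlock.
Qed.

(** The multiplication tables of the basis are tuples of equations, so that one rewrite turns every
    coordinate of a product into a linear expression in the coordinates of [u]. *)
Lemma mprd_S i u :
  ((mprd (bas rS i) u rS i = 16 * u rS i + 4 * (u rR (nxt i) + u rR (nxt (nxt i))) + 4 * c * (u rQ (nxt i) + u rQ (nxt (nxt i))))%R
  * (mprd (bas rS i) u rS (nxt i) = 0)%R
  * (mprd (bas rS i) u rS (nxt (nxt i)) = 0)%R
  * (mprd (bas rS i) u rR i = 0)%R
  * (mprd (bas rS i) u rR (nxt i) = 2 * u rS (nxt (nxt i)) + 8 * u rR (nxt i) + 2 * u rQ i)%R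
  * (mprd (bas rS i) u rR (nxt (nxt i)) = 2 * u rS (nxt i) + 8 * u rR (nxt (nxt i)) + 2 * u rQ i)%R
  * (mprd (bas rS i) u rQ i = 0)%R
  * (mprd (bas rS i) u rQ (nxt i) = 2 * u rR i + 8 * u rQ (nxt i))%R
  * (mprd (bas rS i) u rQ (nxt (nxt i)) = 2 * u rR i + 8 * u rQ (nxt (nxt i)))%R
  * (mprd (bas rS i) u rD i = 16 * u rD i)%R
  * (mprd (bas rS i) u rD (nxt i) = u rD (nxt i))%R
  * (mprd (bas rS i) u rD (nxt (nxt i)) = u rD (nxt (nxt i)))%R)%type.
Proof. by do !split; rewrite mprdE /= /mS /mR /mQ /kap !bE /=; ring. Qed.
Lemma mprd_R i u :
  ((mprd (bas rR i) u rS i = 0)%R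
  * (mprd (bas rR i) u rS (nxt i) = 4 * u rS (nxt i) + 4 * c * u rR (nxt (nxt i)) + 16 * u rR i + 16 * c * u rQ i + 4 * u rQ (nxt (nxt i)))%R
  * (mprd (bas rR i) u rS (nxt (nxt i)) = 4 * u rS (nxt (nxt i)) + 4 * c * u rR (nxt i) + 16 * u rR i + 16 * c * u rQ i + 4 * u rQ (nxt i))%R
  * (mprd (bas rR i) u rR i = 8 * (u rS (nxt i) + u rS (nxt (nxt i))) + 4 * u rR i + 2 * (u rR (nxt i) + u rR (nxt (nxt i))) + 4 * c * (u rQ (nxt i) + u rQ (nxt (nxt i))))%R
  * (mprd (bas rR i) u rR (nxt i) = 2 * u rR (nxt i) + 8 * u rQ (nxt (nxt i)))%R
  * (mprd (bas rR i) u rR (nxt (nxt i)) = 2 * u rR (nxt (nxt i)) + 8 * u rQ (nxt i))%R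
  * (mprd (bas rR i) u rQ i = 4 * u rQ i - 2 * (u rQ (nxt i) + u rQ (nxt (nxt i))))%R
  * (mprd (bas rR i) u rQ (nxt i) = 2 * u rS i + 8 * u rR (nxt (nxt i)) + 2 * u rQ (nxt i))%R
  * (mprd (bas rR i) u rQ (nxt (nxt i)) = 2 * u rS i + 8 * u rR (nxt i) + 2 * u rQ (nxt (nxt i)))%R
  * (mprd (bas rR i) u rD i = 2 * c * u rD i)%R
  * (mprd (bas rR i) u rD (nxt i) = 8 * u rD (nxt i))%R
  * (mprd (bas rR i) u rD (nxt (nxt i)) = 8 * u rD (nxt (nxt i)))%R)%type.
Proof. by do !split; rewrite mprdE /= /mS /mR /mQ /kap !bE /=; ring. Qed.
Lemma mprd_Q i u :
  ((mprd (bas rQ i) u rS i = 0)%R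
  * (mprd (bas rQ i) u rS (nxt i) = 4 * c * u rS (nxt i) + 16 * c * u rR i + 4 * u rR (nxt (nxt i)) + 16 * u rQ i + 4 * c * u rQ (nxt (nxt i)))%R
  * (mprd (bas rQ i) u rS (nxt (nxt i)) = 4 * c * u rS (nxt (nxt i)) + 16 * c * u rR i + 4 * u rR (nxt i) + 16 * u rQ i + 4 * c * u rQ (nxt i))%R
  * (mprd (bas rQ i) u rR i = 2 * (u rQ (nxt i) + u rQ (nxt (nxt i))) - 4 * u rQ i)%R
  * (mprd (bas rQ i) u rR (nxt i) = 2 * u rS i + 4 * c * u rR (nxt i) + 8 * u rR (nxt (nxt i)) + 2 * u rQ (nxt i) + 16 * c * u rQ (nxt (nxt i)))%R
  * (mprd (bas rQ i) u rR (nxt (nxt i)) = 2 * u rS i + 4 * c * u rR (nxt (nxt i)) + 8 * u rR (nxt i) + 2 * u rQ (nxt (nxt i)) + 16 * c * u rQ (nxt i))%R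
  * (mprd (bas rQ i) u rQ i = 8 * (u rS (nxt i) + u rS (nxt (nxt i))) + 4 * u rR i + 2 * (u rR (nxt i) + u rR (nxt (nxt i))) + 8 * c * u rQ i)%R
  * (mprd (bas rQ i) u rQ (nxt i) = - 2 * u rR (nxt i) - 8 * u rQ (nxt (nxt i)))%R
  * (mprd (bas rQ i) u rQ (nxt (nxt i)) = - 2 * u rR (nxt (nxt i)) - 8 * u rQ (nxt i))%R
  * (mprd (bas rQ i) u rD i = 2 * u rD i)%R
  * (mprd (bas rQ i) u rD (nxt i) = 8 * c * u rD (nxt i))%R
  * (mprd (bas rQ i) u rD (nxt (nxt i)) = 8 * c * u rD (nxt (nxt i)))%R)%type.
Proof. by do !split; rewrite mprdE /= /mS /mR /mQ /kap !bE /=; ring. Qed.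
Lemma mprd_D i u :
  ((mprd (bas rD i) u rS i = 16 * u rD i)%R
  * (mprd (bas rD i) u rS (nxt i) = 0)%R
  * (mprd (bas rD i) u rS (nxt (nxt i)) = 0)%R
  * (mprd (bas rD i) u rR i = 0)%R
  * (mprd (bas rD i) u rR (nxt i) = 0)%R
  * (mprd (bas rD i) u rR (nxt (nxt i)) = 0)%R
  * (mprd (bas rD i) u rQ i = 0)%R
  * (mprd (bas rD i) u rQ (nxt i) = 0)%R
  * (mprd (bas rD i) u rQ (nxt (nxt i)) = 0)%R
  * (mprd (bas rD i) u rD i = kap u i)%R
  * (mprd (bas rD i) u rD (nxt i) = 0)%R
  * (mprd (bas rD i) u rD (nxt (nxt i)) = 0)%R)%type.
Proof. by do !split; rewrite mprdE /= /mS /mR /mQ /kap !bE /=; ring. Qed.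

Lemma mformE i u v : mform u v =
  let g l := let j := nxt l in let k := nxt j in
    32 * (u rS l * kap v l)
    + u rR l * (64 * c * v rS l + 256 * (v rS j + v rS k) + 1088 * v rR l
      + (256 * c + 64) * (v rR j + v rR k) + 1088 * c * v rQ l
      + (64 * c + 256) * (v rQ j + v rQ k))
    + u rQ l * (64 * v rS l + 256 * c * (v rS j + v rS k) + 1088 * c * v rR l
      + (64 * c + 256) * (v rR j + v rR k) + (960 + 128 * c ^+ 2) * v rQ l
      + (64 + 256 * c) * (v rQ j + v rQ k))
    + 512 * (u rD l * v rD l) in
  g i + g (nxt i) + g (nxt (nxt i)).
Proof.
rewrite /mform (mtr_rot i) /= !mprdE /= /mS /mR /mQ /kap !nxt3.
ring.
Qed.

(** Both sides are linear in [v], which may therefore be a basis vector; the four tables then leave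
    polynomial identities in the coordinates of [u] and [w]. *)
Lemma mformA u v w : mform u (mprd v w) = mform (mprd u v) w.
Proof.
elim/matrix_linear_ind: v => [|k v v' IH IH'|a i].
- have m0 x : mprd 0 x = 0.
    by rewrite -[X in mprd X](subrr 0) -scaleN1r addrC mprdP scaleN1r addNr.
  by rewrite [mprd u _]mprdC !m0 /mform [mprd u _]mprdC !m0.
- by rewrite mprdP mformPr [mprd u _]mprdC mprdP mformPl ![mprd _ u]mprdC IH IH'.
rewrite [mprd u _]mprdC !(mformE i) /= /kap !nxt3.
elim/row4_ind: a.
- rewrite !mprd_S. ring.
- rewrite !mprd_R. ring.
- rewrite !mprd_Q. ring.
- rewrite !mprd_D /kap ?nxt3. ring.
Qed.

End ModelProduct.

Section Sign.
Variable S : comPzRingType.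
Definition sg (e : bool) : S := if e then 1 else -1.
Lemma sgN e : sg (~~ e) = - sg e.
Proof. by case: e; rewrite /= ?opprK. Qed.
Lemma sgM e : sg e * sg e = 1.
Proof. by case: e; rewrite /= ?mulrNN mulr1. Qed.
End Sign.

(** This is 32 times an axis: S_i + D_i = 16 (s_i + d_i) = 32 a_i, and with a minus sign 32 a_-i.
    Its eigenvalues are the integers [eign]. *)
HB.lock Definition ax (S : comPzRingType) (i : 'I_3) (e : bool) : 'M[S]_(4, 3) :=
  bas S rS i + sg S e *: bas S rD i.

(** * The axes of the model and their eigenspaces *)

Section ModelAxes.
Variables (K : realType) (S : comPzRingType) (io : {rmorphism K -> S}) (c : S).
Local Notation V := 'M[S]_(4, 3).
Implicit Types u v w : V.
Local Notation bas := (@bas S).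
Local Notation "x ** y" := (mprd c x y) (at level 40, left associativity).

Local Notation ax := (ax S).
Local Notation sg := (sg S).
Definition model : algebra K :=
  @Algebra K S io V (mprd c) (mform c) (fun i e => io (1 / 32) *: ax i e)
    (mprdC c) (mprdP c) (mformPl c) (mformPr c).

(** Positive integers can be cancelled because the reals map into the coefficient ring. This lemma
    solves the eigenvector equations one coordinate at a time. *)
Lemma canc n (s t a b : S) : a = b -> n.+1%:R * (s - t) = a - b -> s = t.
Proof.
move=> -> /eqP; rewrite subrr => /eqP /(natr_mul_inj (A := model)) /eqP.
by rewrite subr_eq0 => /eqP.
Qed.

Definition eign (l : eigval) : S :=
  match l with ev1 => 32 | ev0 => 0 | ev4 => 8 | ev32 => 1 end.

Lemma eignE l : eigval_of model l = io (1 / 32) * eign l.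
Proof.
rewrite eigval_ofE; case: l => /=; rewrite ?mulr0 ?mulr1 ?rmorph0 //.
  by rewrite -(rmorph_nat io) -rmorphM; congr (io _); field.
by rewrite -(rmorph_nat io) -rmorphM; congr (io _); field.
Qed.

Lemma eigen_ax i e l v : eigen (gen model i e) l v <-> ax i e ** v = eign l *: v.
Proof.
have G : @prd K model (gen model i e) v = io (1 / 32) *: (ax i e ** v).
  exact: (prdZl (A := model)).
rewrite /eigen eignE G -scalerA; split=> [E|->] //.
apply/eqP; rewrite -subr_eq0; apply/eqP.
apply: (iota_scale_inj (A := model) (r := 1 / 32)).
  by rewrite mulf_neq0 ?oner_eq0 // invr_eq0 pnatr_eq0.
by rewrite /= scalerBr E subrr.
Qed.

Lemma axE i e a l :
  ax i e a l = ((a == rS) && (l == i))%:R + sg e * ((a == rD) && (l == i))%:R.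
Proof. by rewrite ax.unlock adE scE !basE. Qed.

Lemma mprd_ax i e u :
  ((ax i e ** u) rS i = 16 * u rS i + 4 * (u rR (nxt i) + u rR (nxt (nxt i)))
     + 4 * c * (u rQ (nxt i) + u rQ (nxt (nxt i))) + 16 * sg e * u rD i)
  * ((ax i e ** u) rS (nxt i) = 0) * ((ax i e ** u) rS (nxt (nxt i)) = 0)
  * ((ax i e ** u) rR i = 0)
  * ((ax i e ** u) rR (nxt i) = 2 * u rS (nxt (nxt i)) + 8 * u rR (nxt i) + 2 * u rQ i)
  * ((ax i e ** u) rR (nxt (nxt i)) = 2 * u rS (nxt i) + 8 * u rR (nxt (nxt i)) + 2 * u rQ i)
  * ((ax i e ** u) rQ i = 0)
  * ((ax i e ** u) rQ (nxt i) = 2 * u rR i + 8 * u rQ (nxt i))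
  * ((ax i e ** u) rQ (nxt (nxt i)) = 2 * u rR i + 8 * u rQ (nxt (nxt i)))
  * ((ax i e ** u) rD i = 16 * u rD i + sg e * kap c u i)
  * ((ax i e ** u) rD (nxt i) = u rD (nxt i))
  * ((ax i e ** u) rD (nxt (nxt i)) = u rD (nxt (nxt i))).
Proof.
have E a l : (ax i e ** u) a l = (bas rS i ** u) a l + sg e * (bas rD i ** u) a l.
  by rewrite ax.unlock addrC mprdP addrC adE scE.
by do !split; rewrite E mprd_S mprd_D; ring.
Qed.

Lemma row3_ext i u v :
  (forall a, [/\ u a i = v a i, u a (nxt i) = v a (nxt i)
                 & u a (nxt (nxt i)) = v a (nxt (nxt i))]) -> u = v.
Proof.
move=> E; apply/matrixP => a l; have [E1 E2 E3] := E a.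
by case: (ord3_cases i l) => ->.
Qed.


Lemma ax_eigenP n i e u :
  16 * u rS i + 4 * (u rR (nxt i) + u rR (nxt (nxt i)))
     + 4 * c * (u rQ (nxt i) + u rQ (nxt (nxt i))) + 16 * sg e * u rD i = n * u rS i ->
  0 = n * u rS (nxt i) -> 0 = n * u rS (nxt (nxt i)) -> 0 = n * u rR i ->
  2 * u rS (nxt (nxt i)) + 8 * u rR (nxt i) + 2 * u rQ i = n * u rR (nxt i) ->
  2 * u rS (nxt i) + 8 * u rR (nxt (nxt i)) + 2 * u rQ i = n * u rR (nxt (nxt i)) ->
  0 = n * u rQ i -> 2 * u rR i + 8 * u rQ (nxt i) = n * u rQ (nxt i) ->
  2 * u rR i + 8 * u rQ (nxt (nxt i)) = n * u rQ (nxt (nxt i)) ->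
  16 * u rD i + sg e * kap c u i = n * u rD i ->
  u rD (nxt i) = n * u rD (nxt i) -> u rD (nxt (nxt i)) = n * u rD (nxt (nxt i)) ->
  ax i e ** u = n *: u.
Proof.
move=> *; apply: (@row3_ext i) => a; elim/row4_ind: a; split;
  by rewrite mprd_ax scE.
Qed.

(** The eigencomponents of 32 v. On the even part this is the Peirce decomposition for the
    idempotent s_i: multiplication by S_i has eigenvalues 16, 8 and 0, and the component for 16 is q
    S_i / 16. As d_i annihilates the other two Peirce spaces, these are eigenspaces of the axis for
    1/4 and 0. The opposite axis is a further 0-eigenvector, and D_j, D_k span the
    1/32-eigenspace. *)
Definition dec i e v (l : eigval) : V :=
  let j := nxt i in let k := nxt j in let s := bas rS i in
  let q := kap c v i in
  match l with
  | ev1 => (q + 16 * sg e * v rD i) *: ax i e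
  | ev0 => (q - 16 * sg e * v rD i) *: ax i (~~ e)
      + 2 *: (16 *: (v - v rD i *: bas rD i - v rD j *: bas rD j - v rD k *: bas rD k)
              + q *: s
              - 2 *: (s ** v - (16 * v rD i) *: bas rD i - v rD j *: bas rD j
                      - v rD k *: bas rD k))
  | ev4 => 4 *: (s ** v - (16 * v rD i) *: bas rD i - v rD j *: bas rD j
                   - v rD k *: bas rD k - q *: s)
  | ev32 => 32 *: (v rD j *: bas rD j + v rD k *: bas rD k)
  end.

Definition mxR := (mprd_S, mprd_ax, nxt3).
Lemma basN i : ((i == nxt i) = false) * ((i == nxt (nxt i)) = false)
  * ((nxt i == nxt (nxt i)) = false) * ((nxt (nxt i) == nxt i) = false).
Proof. by rewrite nxt.unlock; case: i => [[|[|[|]]]]. Qed.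
Definition entE := (linE, basE, axE, eqxx, nxt_neq, nxt2_neq, basN).

Lemma dec_sum i e v : \sum_(l <- monster) dec i e v l = 32 *: v.
Proof.
rewrite /monster !big_cons big_nil addr0.
apply: (@row3_ext i) => a; elim/row4_ind: a; split;
  rewrite /dec !entE ?mprd_S /= ?sgN; ring: (sgM S e).
Qed.

Lemma eigen1_V1 i e v : ax i e ** v = 32 *: v -> v = (sg e * v rD i) *: ax i e.
Proof.
move=> /matrixP E.
have e1 a l : (ax i e ** v) a l = 32 * v a l by rewrite E ?linE ?mxE.
(* The value n.+1 is 32 minus the scalar 0, 8, 1 or 16 by which the axis acts on the coordinate, up
   to coordinates already known. *)
have Sj : v rS (nxt i) = 0 by apply: (canc (n := 31) (esym (e1 rS (nxt i)))); rewrite mxR; ring.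
have Sk : v rS (nxt (nxt i)) = 0 by apply: (canc (n := 31) (esym (e1 rS (nxt (nxt i))))); rewrite mxR; ring.
have R : v rR i = 0 by apply: (canc (n := 31) (esym (e1 rR i))); rewrite mxR; ring.
have Q : v rQ i = 0 by apply: (canc (n := 31) (esym (e1 rQ i))); rewrite mxR; ring.
have Rj : v rR (nxt i) = 0 by apply: (canc (n := 23) (esym (e1 rR (nxt i)))); rewrite mxR Sk Q; ring.
have Rk : v rR (nxt (nxt i)) = 0 by apply: (canc (n := 23) (esym (e1 rR (nxt (nxt i))))); rewrite mxR Sj Q; ring.
have Qj : v rQ (nxt i) = 0 by apply: (canc (n := 23) (esym (e1 rQ (nxt i)))); rewrite mxR R; ring.
have Qk : v rQ (nxt (nxt i)) = 0 by apply: (canc (n := 23) (esym (e1 rQ (nxt (nxt i))))); rewrite mxR R; ring.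
have Dj : v rD (nxt i) = 0 by apply: (canc (n := 30) (esym (e1 rD (nxt i)))); rewrite mxR; ring.
have Dk : v rD (nxt (nxt i)) = 0 by apply: (canc (n := 30) (esym (e1 rD (nxt (nxt i))))); rewrite mxR; ring.
have Si : v rS i = sg e * v rD i.
  by apply: (canc (n := 15) (esym (e1 rS i))); rewrite mxR Rj Rk Qj Qk; ring.
apply: (@row3_ext i) => a; elim/row4_ind: a; split;
  rewrite !entE ?(Si, Sj, Sk, R, Rj, Rk, Q, Qj, Qk, Dj, Dk) /=; ring: (sgM S e).
Qed.

(* Coordinates of [16 *: v] for [v] in the 0-eigenspace. *)
Record isV0 i e v (p q r t m : S) : Prop := IsV0 {
  V0Si : v rS i = p + q + 2 * c * r + 2 * t - sg e * m;
  V0Sj : v rS (nxt i) = 16 * p; V0Sk : v rS (nxt (nxt i)) = 16 * q;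
  V0Ri : v rR i = 16 * r; V0Rj : v rR (nxt i) = - 4 * q - 4 * t;
  V0Rk : v rR (nxt (nxt i)) = - 4 * p - 4 * t;
  V0Qi : v rQ i = 16 * t; V0Qj : v rQ (nxt i) = - 4 * r; V0Qk : v rQ (nxt (nxt i)) = - 4 * r;
  V0Di : v rD i = m; V0Dj : v rD (nxt i) = 0; V0Dk : v rD (nxt (nxt i)) = 0 }.

Lemma eigen0_V0 i e v : ax i e ** v = 0 -> exists p q r t m, isV0 i e (16 *: v) p q r t m.
Proof.
move=> /matrixP E.
have e1 a l : (ax i e ** v) a l = 0 by rewrite E ?linE ?mxE.
exists (v rS (nxt i)), (v rS (nxt (nxt i))), (v rR i), (v rQ i), (16 * v rD i).
have Rj : 4 * v rR (nxt i) = - v rS (nxt (nxt i)) - v rQ i.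
  by apply: (canc (n := 1) (e1 rR (nxt i))); rewrite mxR; ring.
have Rk : 4 * v rR (nxt (nxt i)) = - v rS (nxt i) - v rQ i.
  by apply: (canc (n := 1) (e1 rR (nxt (nxt i)))); rewrite mxR; ring.
have Qj : 4 * v rQ (nxt i) = - v rR i.
  by apply: (canc (n := 1) (e1 rQ (nxt i))); rewrite mxR; ring.
have Qk : 4 * v rQ (nxt (nxt i)) = - v rR i.
  by apply: (canc (n := 1) (e1 rQ (nxt (nxt i)))); rewrite mxR; ring.
have F : 16 * v rS i + 4 * v rR (nxt i) + 4 * v rR (nxt (nxt i))
   + c * (4 * v rQ (nxt i)) + c * (4 * v rQ (nxt (nxt i))) + 16 * sg e * v rD i = 0.
  by rewrite -(e1 rS i) mxR; ring.
split; rewrite ?scE //.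
- by apply: (canc (n := 0) F); rewrite Rj Rk Qj Qk; ring.
- by transitivity (4 * (4 * v rR (nxt i))); [ring | rewrite Rj; ring].
- by transitivity (4 * (4 * v rR (nxt (nxt i)))); [ring | rewrite Rk; ring].
- by transitivity (4 * (4 * v rQ (nxt i))); [ring | rewrite Qj; ring].
- by transitivity (4 * (4 * v rQ (nxt (nxt i)))); [ring | rewrite Qk; ring].
- by have := e1 rD (nxt i); rewrite mxR => ->; rewrite mulr0.
- by have := e1 rD (nxt (nxt i)); rewrite mxR => ->; rewrite mulr0.
Qed.

(* Coordinates of [2 *: v] for [v] in the 1/4-eigenspace. *)
Record isV4 i v (p q r t : S) : Prop := IsV4 {
  V4Si : v rS i = - p - q - c * (r + t);
  V4Sj : v rS (nxt i) = 0; V4Sk : v rS (nxt (nxt i)) = 0;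
  V4Ri : v rR i = 0; V4Rj : v rR (nxt i) = 2 * p; V4Rk : v rR (nxt (nxt i)) = 2 * q;
  V4Qi : v rQ i = 0; V4Qj : v rQ (nxt i) = 2 * r; V4Qk : v rQ (nxt (nxt i)) = 2 * t;
  V4Di : v rD i = 0; V4Dj : v rD (nxt i) = 0; V4Dk : v rD (nxt (nxt i)) = 0 }.

Lemma eigen4_V4 i e v : ax i e ** v = 8 *: v -> exists p q r t, isV4 i (2 *: v) p q r t.
Proof.
move=> /matrixP E.
have e1 a l : (ax i e ** v) a l = 8 * v a l by rewrite E ?linE ?mxE.
exists (v rR (nxt i)), (v rR (nxt (nxt i))), (v rQ (nxt i)), (v rQ (nxt (nxt i))).
have Sj : v rS (nxt i) = 0 by apply: (canc (n := 7) (esym (e1 rS (nxt i)))); rewrite mxR; ring.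
have Sk : v rS (nxt (nxt i)) = 0 by apply: (canc (n := 7) (esym (e1 rS (nxt (nxt i))))); rewrite mxR; ring.
have R : v rR i = 0 by apply: (canc (n := 7) (esym (e1 rR i))); rewrite mxR; ring.
have Q : v rQ i = 0 by apply: (canc (n := 7) (esym (e1 rQ i))); rewrite mxR; ring.
have Dj : v rD (nxt i) = 0 by apply: (canc (n := 6) (esym (e1 rD (nxt i)))); rewrite mxR; ring.
have Dk : v rD (nxt (nxt i)) = 0 by apply: (canc (n := 6) (esym (e1 rD (nxt (nxt i))))); rewrite mxR; ring.
have F := e1 rS i; rewrite mxR in F.
have G := e1 rD i; rewrite mxR /kap Sj Sk R Q in G.
have Di : v rD i = 0.
  have H : sg e * (2 * (8 * v rS i)) = sg e * (2 * (16 * v rS i + 4 * (v rR (nxt i) + v rR (nxt (nxt i))) +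
    4 * c * (v rQ (nxt i) + v rQ (nxt (nxt i))) + 16 * sg e * v rD i)).
    by rewrite F.
  have H' : 8 * v rD i + sg e * (2 * (8 * v rS i)) = 16 * v rD i +
    sg e * (16 * v rS i + (0 + 0) + 8 * (v rR (nxt i) + v rR (nxt (nxt i))) +
     2 * c * 0 + 8 * c * (v rQ (nxt i) + v rQ (nxt (nxt i))) + 2 * 0) + sg e * (2 * (8 * v rS i)).
    by rewrite G.
  rewrite {1}H in H'.
  by apply: (canc (n := 23) H'); ring: (sgM S e).
split; rewrite ?scE ?(Sj, Sk, R, Q, Dj, Dk, Di) ?mulr0 //.
by rewrite Di in F; apply: (canc (n := 3) F); ring.
Qed.

Record isV32 i v (p q : S) : Prop := IsV32 {
  V32Si : v rS i = 0; V32Sj : v rS (nxt i) = 0; V32Sk : v rS (nxt (nxt i)) = 0;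
  V32Ri : v rR i = 0; V32Rj : v rR (nxt i) = 0; V32Rk : v rR (nxt (nxt i)) = 0;
  V32Qi : v rQ i = 0; V32Qj : v rQ (nxt i) = 0; V32Qk : v rQ (nxt (nxt i)) = 0;
  V32Di : v rD i = 0; V32Dj : v rD (nxt i) = p; V32Dk : v rD (nxt (nxt i)) = q }.

Lemma eigen32_V32 i e v : ax i e ** v = v -> exists p q, isV32 i v p q.
Proof.
move=> /matrixP E.
have e1 a l : (ax i e ** v) a l = v a l by rewrite E.
exists (v rD (nxt i)), (v rD (nxt (nxt i))).
have Sj : v rS (nxt i) = 0 by rewrite -e1 mxR.
have Sk : v rS (nxt (nxt i)) = 0 by rewrite -e1 mxR.
have R : v rR i = 0 by rewrite -e1 mxR.
have Q : v rQ i = 0 by rewrite -e1 mxR.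
have Rj : v rR (nxt i) = 0 by apply: (canc (n := 6) (e1 rR (nxt i))); rewrite mxR Sk Q; ring.
have Rk : v rR (nxt (nxt i)) = 0 by apply: (canc (n := 6) (e1 rR (nxt (nxt i)))); rewrite mxR Sj Q; ring.
have Qj : v rQ (nxt i) = 0 by apply: (canc (n := 6) (e1 rQ (nxt i))); rewrite mxR R; ring.
have Qk : v rQ (nxt (nxt i)) = 0 by apply: (canc (n := 6) (e1 rQ (nxt (nxt i)))); rewrite mxR R; ring.
have F := e1 rS i; rewrite mxR Rj Rk Qj Qk in F.
have G := e1 rD i; rewrite mxR /kap Sj Sk R Q Rj Rk Qj Qk in G.
have Si : v rS i = 0.
  (* The S_i and D_i coordinates determine each other, which gives 225 x = 256 x for the first of
     them, hence 31 x = 0. *)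
  have H : 15 * v rS i = - 16 * sg e * v rD i by apply: (canc (n := 0) F); ring.
  have H' : 15 * v rD i = - 16 * sg e * v rS i by apply: (canc (n := 0) G); ring.
  have H2 : 15 * (15 * v rS i) = 256 * v rS i.
    transitivity (- 16 * sg e * (15 * v rD i)); first by rewrite H; ring.
    by rewrite H'; ring: (sgM S e).
  by apply: (canc (n := 30) (esym H2)); ring.
split=> //; rewrite Si in G.
by apply: (canc (n := 14) G); ring.
Qed.

Lemma V0_eigen i e v p q r t m : isV0 i e v p q r t m -> ax i e ** v = 0.
Proof.
case=> Si Sj Sk Ri Rj Rk Qi Qj Qk Di Dj Dk.
apply: (@row3_ext i) => a; elim/row4_ind: a; split;
  rewrite ?mxR ?entE /kap ?(Si, Sj, Sk, Ri, Rj, Rk, Qi, Qj, Qk, Di, Dj, Dk) ?mxE;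
  ring: (sgM S e).
Qed.
Lemma V4_eigen i e v p q r t : isV4 i v p q r t -> ax i e ** v = 8 *: v.
Proof.
case=> Si Sj Sk Ri Rj Rk Qi Qj Qk Di Dj Dk.
apply: (@row3_ext i) => a; elim/row4_ind: a; split;
  rewrite ?mxR ?entE /kap ?(Si, Sj, Sk, Ri, Rj, Rk, Qi, Qj, Qk, Di, Dj, Dk) ?mxE;
  ring: (sgM S e).
Qed.
Lemma V32_eigen i e v p q : isV32 i v p q -> ax i e ** v = v.
Proof.
case=> Si Sj Sk Ri Rj Rk Qi Qj Qk Di Dj Dk.
apply: (@row3_ext i) => a; elim/row4_ind: a; split;
  rewrite ?mxR ?entE /kap ?(Si, Sj, Sk, Ri, Rj, Rk, Qi, Qj, Qk, Di, Dj, Dk) ?mxE;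
  ring: (sgM S e).
Qed.
Lemma V1_eigen i e : ax i e ** ax i e = 32 *: ax i e.
Proof.
apply: (@row3_ext i) => a; elim/row4_ind: a; split;
  rewrite ?mxR ?entE /kap ?nxt3 ?entE /=; ring: (sgM S e).
Qed.

Lemma dec_eigen i e v l : ax i e ** dec i e v l = eign l *: dec i e v l.
Proof.
case: l; rewrite /eign.
- rewrite /dec; set q := (q in q *: _).
  have -> : ax i e ** (q *: ax i e) = q *: (ax i e ** ax i e) := prdZr (A := model) _ _ _.
  by rewrite V1_eigen !scalerA mulrC.
- rewrite scale0r; apply: (@V0_eigen _ _ _ (2 * v rS (nxt i)) (2 * v rS (nxt (nxt i)))
    (2 * v rR i) (2 * v rQ i) (- sg e * (kap c v i - 16 * sg e * v rD i))).
  by split; rewrite /dec !entE ?mprd_S /= ?sgN /kap; ring: (sgM S e).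
- apply: (@V4_eigen _ _ _ (4 * v rS (nxt (nxt i)) + 16 * v rR (nxt i) + 4 * v rQ i)
    (4 * v rS (nxt i) + 16 * v rR (nxt (nxt i)) + 4 * v rQ i)
    (4 * v rR i + 16 * v rQ (nxt i)) (4 * v rR i + 16 * v rQ (nxt (nxt i)))).
  by split; rewrite /dec !entE ?mprd_S /= /kap; ring.
- rewrite scale1r; apply: (@V32_eigen _ _ _ (32 * v rD (nxt i)) (32 * v rD (nxt (nxt i)))).
  by split; rewrite /dec !entE /=; ring.
Qed.
End ModelAxes.

(** * The Monster fusion rules in the model *)

Section ModelFusion.
Variables (K : realType) (S : comPzRingType) (io : {rmorphism K -> S}) (c : S).
Local Notation V := 'M[S]_(4, 3).
Implicit Types u v w : V.
Local Notation bas := (@bas S).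
Local Notation model := (model io c).
Local Notation "x ** y" := (mprd c x y) (at level 40, left associativity).

(** With both eigenspaces parametrised, a fusion rule is a list of polynomial identities in the
    parameters, one for each coordinate of [ax_eigenP]. *)
Lemma fuse00 i e u v p q r t m p' q' r' t' m' :
  isV0 c i e u p q r t m -> isV0 c i e v p' q' r' t' m' ->
  ax S i e ** (u ** v) = 0 *: (u ** v).
Proof.
case=> Si Sj Sk Ri Rj Rk Qi Qj Qk Di Dj Dk [Si' Sj' Sk' Ri' Rj' Rk' Qi' Qj' Qk' Di' Dj' Dk'].
pose E := (Si, Sj, Sk, Ri, Rj, Rk, Qi, Qj, Qk, Di, Dj, Dk).
pose E' := (Si', Sj', Sk', Ri', Rj', Rk', Qi', Qj', Qk', Di', Dj', Dk').
apply: ax_eigenP; rewrite ?/kap ?[mprd c u v _ _]mprdE /= /mS /mR /mQ /kap ?nxt3 ?E ?E';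
  ring: (sgM S e).
Qed.

Lemma fuse04 i e u v p q r t m p' q' r' t' :
  isV0 c i e u p q r t m -> isV4 c i v p' q' r' t' ->
  ax S i e ** (u ** v) = 8 *: (u ** v).
Proof.
case=> Si Sj Sk Ri Rj Rk Qi Qj Qk Di Dj Dk [Si' Sj' Sk' Ri' Rj' Rk' Qi' Qj' Qk' Di' Dj' Dk'].
pose E := (Si, Sj, Sk, Ri, Rj, Rk, Qi, Qj, Qk, Di, Dj, Dk).
pose E' := (Si', Sj', Sk', Ri', Rj', Rk', Qi', Qj', Qk', Di', Dj', Dk').
apply: ax_eigenP; rewrite ?/kap ?[mprd c u v _ _]mprdE /= /mS /mR /mQ /kap ?nxt3 ?E ?E';
  ring: (sgM S e).
Qed.

Lemma fuse032 i e u v p q r t m p' q' :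
  isV0 c i e u p q r t m -> isV32 i v p' q' ->
  ax S i e ** (u ** v) = 1 *: (u ** v).
Proof.
case=> Si Sj Sk Ri Rj Rk Qi Qj Qk Di Dj Dk [Si' Sj' Sk' Ri' Rj' Rk' Qi' Qj' Qk' Di' Dj' Dk'].
pose E := (Si, Sj, Sk, Ri, Rj, Rk, Qi, Qj, Qk, Di, Dj, Dk).
pose E' := (Si', Sj', Sk', Ri', Rj', Rk', Qi', Qj', Qk', Di', Dj', Dk').
apply: ax_eigenP; rewrite ?/kap ?[mprd c u v _ _]mprdE /= /mS /mR /mQ /kap ?nxt3 ?E ?E';
  ring: (sgM S e).
Qed.

Lemma fuse432 i e u v p q r t p' q' :
  isV4 c i u p q r t -> isV32 i v p' q' ->
  ax S i e ** (u ** v) = 1 *: (u ** v).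
Proof.
case=> Si Sj Sk Ri Rj Rk Qi Qj Qk Di Dj Dk [Si' Sj' Sk' Ri' Rj' Rk' Qi' Qj' Qk' Di' Dj' Dk'].
pose E := (Si, Sj, Sk, Ri, Rj, Rk, Qi, Qj, Qk, Di, Dj, Dk).
pose E' := (Si', Sj', Sk', Ri', Rj', Rk', Qi', Qj', Qk', Di', Dj', Dk').
apply: ax_eigenP; rewrite ?/kap ?[mprd c u v _ _]mprdE /= /mS /mR /mQ /kap ?nxt3 ?E ?E';
  ring: (sgM S e).
Qed.

(** The four equations say that the 1/4-component of the even vector [w] vanishes. Removing its
    component along the axis then leaves a 0-eigenvector, which is what the rule for 1/4 times 1/4
    asks for. *)
Lemma ax_even i e w :
  w rS (nxt (nxt i)) + 4 * w rR (nxt i) + w rQ i = 0 ->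
  w rS (nxt i) + 4 * w rR (nxt (nxt i)) + w rQ i = 0 ->
  w rR i + 4 * w rQ (nxt i) = 0 -> w rR i + 4 * w rQ (nxt (nxt i)) = 0 ->
  (forall l, w rD l = 0) ->
  let w' := 32 *: w - kap c w i *: ax S i e in ax S i e ** w' = 0 *: w'.
Proof.
move=> E1 E2 E3 E4 E0 w'.
apply: ax_eigenP; rewrite /w' /kap !entE /= ?E0.
- transitivity (- 32 * (w rS (nxt (nxt i)) + 4 * w rR (nxt i) + w rQ i)
    - 32 * (w rS (nxt i) + 4 * w rR (nxt (nxt i)) + w rQ i)
    - 32 * c * (w rR i + 4 * w rQ (nxt i)) - 32 * c * (w rR i + 4 * w rQ (nxt (nxt i)))).
    ring: (sgM S e).
  by rewrite E1 E2 E3 E4; ring.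
- ring.
- ring.
- ring.
- by transitivity (64 * (w rS (nxt (nxt i)) + 4 * w rR (nxt i) + w rQ i)); [ring | rewrite E1; ring].
- by transitivity (64 * (w rS (nxt i) + 4 * w rR (nxt (nxt i)) + w rQ i)); [ring | rewrite E2; ring].
- ring.
- by transitivity (64 * (w rR i + 4 * w rQ (nxt i))); [ring | rewrite E3; ring].
- by transitivity (64 * (w rR i + 4 * w rQ (nxt (nxt i)))); [ring | rewrite E4; ring].
- ring: (sgM S e).
- ring.
- ring.
Qed.

Lemma fuse44 i e u v p q r t p' q' r' t' :
  isV4 c i u p q r t -> isV4 c i v p' q' r' t' ->
  let w := 32 *: (u ** v) - kap c (u ** v) i *: ax S i e in
  ax S i e ** w = 0 *: w.
Proof.
case=> Si Sj Sk Ri Rj Rk Qi Qj Qk Di Dj Dk [Si' Sj' Sk' Ri' Rj' Rk' Qi' Qj' Qk' Di' Dj' Dk'].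
pose E := (Si, Sj, Sk, Ri, Rj, Rk, Qi, Qj, Qk, Di, Dj, Dk).
pose E' := (Si', Sj', Sk', Ri', Rj', Rk', Qi', Qj', Qk', Di', Dj', Dk').
apply: ax_even => [||||l]; last first.
  by rewrite mprdE /=; case: (ord3_cases i l) => ->; rewrite ?nxt3 !E !E'; ring.
all: by rewrite ![mprd c u v _ _]mprdE /= /mS /mR /mQ ?nxt3 ?E ?E'; ring.
Qed.

(** Since D_j D_k = 0 and D_j D_j = 16 S_j, the product is even and has no 1/32-component. *)
Lemma fuse3232 i e u v p q p' q' : isV32 i u p q -> isV32 i v p' q' ->
  dec c i e (u ** v) ev32 = 0.
Proof.
case=> Si Sj Sk Ri Rj Rk Qi Qj Qk Di Dj Dk [Si' Sj' Sk' Ri' Rj' Rk' Qi' Qj' Qk' Di' Dj' Dk'].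
pose E := (Si, Sj, Sk, Ri, Rj, Rk, Qi, Qj, Qk, Di, Dj, Dk).
pose E' := (Si', Sj', Sk', Ri', Rj', Rk', Qi', Qj', Qk', Di', Dj', Dk').
rewrite /dec ![mprd c u v rD _]mprdE /= /kap ?nxt3 ?E ?E'.
by rewrite !(mulr0, mul0r, addr0) !scale0r addr0 scaler0.
Qed.
End ModelFusion.

(** * The model as a primitive Frobenius axial algebra *)

Section ModelClass.
Variables (K : realType) (S : comPzRingType) (io : {rmorphism K -> S}) (c : S).
Local Notation V := 'M[S]_(4, 3).
Implicit Types u v w : V.
Local Notation bas := (@bas S).
Local Notation model := (model io c).
Local Notation ax := (ax S).
Local Notation sg := (sg S).
Local Notation "x ** y" := (mprd c x y) (at level 40, left associativity).



Lemma eigen_sum_cancel (A : algebra K) (a : car A) L n x :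
  eigen_sum a L (n.+1%:R *: x) -> eigen_sum a L x.
Proof.
move=> [f ef E]; exists (fun l => iota A n.+1%:R^-1 *: f l).
  by move=> l; apply: eigenZ.
rewrite -scaler_sumr -E scalerA -(rmorph_nat (iota A)) -rmorphM mulVf ?pnatr_eq0 //.
by rewrite rmorph1 scale1r.
Qed.

Lemma mprdZZ n m u v : (n%:R *: u) ** (m%:R *: v) = (n * m)%:R *: (u ** v).
Proof.
have := prdZl (A := model) n%:R u (m%:R *: v); rewrite /= => ->.
by have := prdZr (A := model) m%:R u v; rewrite /= => ->; rewrite scalerA natrM.
Qed.

(** The parametrisations describe 16 u in the 0-eigenspace and 2 u in the 1/4-eigenspace; these
    factors are removed here. *)
Lemma eigen_sum_cancelM a L n m u v :
  @eigen_sum K model a L ((n.+1%:R *: u) ** (m.+1%:R *: v)) -> @eigen_sum K model a L (u ** v).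
Proof. by rewrite mprdZZ mulSn addSn => /eigen_sum_cancel. Qed.

(** The fusion table is symmetric, so commutativity leaves ten cases. Those with eigenvalue 1 hold
    by primitivity; the others are the [fuse] lemmas. *)
Lemma ax_fusion i e l m u v : ax i e ** u = eign S l *: u -> ax i e ** v = eign S m *: v ->
  @eigen_sum K model (gen model i e) (fuse l m) (u ** v).
Proof.
have step l' u' v' : ax i e ** (u' ** v') = eign S l' *: (u' ** v') ->
    @eigen_sum K model (gen model i e) [:: l'] (u' ** v').
  by move=> E; apply: eigen_sum_eigen; apply/eigen_ax.
have sum0 : @eigen_sum K model (gen model i e) [::] 0.
  by exists (fun=> 0) => [l'|]; [apply: eigen0 | rewrite big_nil].
have mZl k (x y : V) : (k *: x) ** y = k *: (x ** y) := prdZl (A := model) k x y.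
wlog lm : l m u v / (match l, m with
    | ev1, _ | ev0, ev0 | ev0, ev4 | ev0, ev32 | ev4, ev4 | ev4, ev32 | ev32, ev32 => true
    | _, _ => false end).
  move=> H; case: l m => -[] Eu Ev; first [exact: H | rewrite mprdC; exact: H Ev Eu].
have row1 m' : ax i e ** v = eign S m' *: v -> u = (sg e * u rD i) *: ax i e ->
    @eigen_sum K model (gen model i e) [:: m'] (u ** v).
  move=> Em' ->; rewrite mZl Em'; apply: eigen_sum_eigen.
  by do 2!apply: eigenZ; apply/eigen_ax.
case: l m lm => -[] // _ Eu Ev.
- exact: row1 Ev (eigen1_V1 io Eu).
- rewrite (eigen1_V1 io Eu) mZl Ev scale0r scaler0.
  exact: sum0.
- exact: row1 Ev (eigen1_V1 io Eu).
- exact: row1 Ev (eigen1_V1 io Eu).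
- rewrite /= scale0r in Eu; rewrite /= scale0r in Ev.
  have [p [q [r [t [m Hu]]]]] := eigen0_V0 io Eu.
  have [p' [q' [r' [t' [m' Hv]]]]] := eigen0_V0 io Ev.
  apply: (@eigen_sum_cancelM _ _ 15 15).
  exact/step/(fuse00 Hu Hv).
- rewrite /= scale0r in Eu.
  have [p [q [r [t [m Hu]]]]] := eigen0_V0 io Eu.
  have [p' [q' [r' [t' Hv]]]] := eigen4_V4 io Ev.
  apply: (@eigen_sum_cancelM _ _ 15 1).
  exact/step/(fuse04 Hu Hv).
- rewrite /= scale0r in Eu; rewrite /= scale1r in Ev.
  have [p [q [r [t [m Hu]]]]] := eigen0_V0 io Eu.
  have [p' [q' Hv]] := eigen32_V32 io Ev.
  apply: (@eigen_sum_cancelM _ _ 15 0).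
  rewrite scale1r; exact/step/(fuse032 Hu Hv).
- have [p [q [r [t Hu]]]] := eigen4_V4 io Eu.
  have [p' [q' [r' [t' Hv]]]] := eigen4_V4 io Ev.
  apply: (@eigen_sum_cancelM _ _ 1 1).
  apply: (@eigen_sum_cancel _ _ _ 31); set w := _ ** _.
  pose k := kap c w i; have E0 := fuse44 e Hu Hv; rewrite -/w -/k in E0.
  exists (fun l => match l with ev1 => k *: ax i e | ev0 => 32 *: w - k *: ax i e
                   | _ => 0 end).
    case; try exact: eigen0; last by apply/eigen_ax.
    by apply: eigenZ; apply/eigen_ax; rewrite V1_eigen.
  by rewrite !big_cons big_nil addr0 addrC subrK.
- rewrite /= scale1r in Ev.
  have [p [q [r [t Hu]]]] := eigen4_V4 io Eu.
  have [p' [q' Hv]] := eigen32_V32 io Ev.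
  apply: (@eigen_sum_cancelM _ _ 1 0).
  rewrite scale1r; exact/step/(fuse432 e Hu Hv).
- rewrite /= scale1r in Eu; rewrite /= scale1r in Ev.
  have [p [q Hu]] := eigen32_V32 io Eu.
  have [p' [q' Hv]] := eigen32_V32 io Ev.
  apply: (@eigen_sum_cancel _ _ _ 31); rewrite -(dec_sum c i e).
  exists (dec c i e (u ** v)); first by move=> l; apply/eigen_ax; exact: (dec_eigen io).
  by rewrite /monster !big_cons big_nil (fuse3232 _ _ Hu Hv) addr0.
Qed.

Lemma io_scale (r : K) n v : r * n%:R = 1 -> io r *: (n%:R *: v) = v.
Proof. by move=> E; rewrite scalerA -(rmorph_nat io) -rmorphM E rmorph1 scale1r. Qed.

Lemma ax_gen i e : ax i e = 32 *: (gen model i e : V).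
Proof.
rewrite /= scalerA mulrC -scalerA io_scale //.
by rewrite mul1r mulVf // pnatr_eq0.
Qed.

Lemma model_axis i e : axis (gen model i e).
Proof.
apply: axisI => [|v|l m u v /eigen_ax Eu /eigen_ax Ev]; last exact: ax_fusion.
  rewrite -[RHS]scale1r; apply: (_ : eigen (gen model i e) ev1 (gen model i e)).
  by apply: eigenZ; apply/eigen_ax; apply: V1_eigen.
apply: (@eigen_sum_cancel _ _ _ 31); rewrite -(dec_sum c i e).
by exists (dec c i e v) => // l; apply/eigen_ax; exact: (dec_eigen io).
Qed.

Lemma model_primitive i e : primitive (gen model i e).
Proof.
move=> v; split=> [/eigen_ax E|[r ->]].
  exists (sg e * v rD i * 32); rewrite -scalerA -ax_gen.
  exact: (eigen1_V1 io E).
by do 2!apply: eigenZ; apply/eigen_ax; apply: V1_eigen.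
Qed.

Lemma generated_subalgebra (A : algebra K) (X : set (car A)) :
  subalgebra (generated_by X).
Proof.
split=> [B [B0 _ _] _|r u v gu gv B sB XB|u v gu gv B sB XB]; first exact: B0.
  by have [_ BP _] := sB; apply: BP; [apply: gu | apply: gv].
by have [_ _ BM] := sB; apply: BM; [apply: gu | apply: gv].
Qed.

Lemma mprd_SS i : bas rS i ** bas rS (nxt i) = 2 *: bas rR (nxt (nxt i)).
Proof.
apply: (@row3_ext _ i) => a; elim/row4_ind: a; split;
  rewrite ?scE ?mprd_S ?basE ?eqxx ?nxt_neq ?nxt2_neq ?basN /=; ring.
Qed.
Lemma mprd_SR i :
  bas rS i ** bas rR i = 2 *: (bas rQ (nxt i) + bas rQ (nxt (nxt i))).
Proof.
apply: (@row3_ext _ i) => a; elim/row4_ind: a; split;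
  rewrite ?scE ?adE ?mprd_S ?basE ?eqxx ?nxt_neq ?nxt2_neq ?basN /=; ring.
Qed.

Lemma mprd_SSd i : bas rS i ** bas rS i = 16 *: bas rS i.
Proof.
apply: (@row3_ext _ i) => b; elim/row4_ind: b; split;
  rewrite scE mprd_S !basE ?eqxx ?basN ?nxt_neq ?nxt2_neq /=; ring.
Qed.
Lemma mprd_SRj i : bas rS i ** bas rR (nxt i) = 8 *: bas rR (nxt i) + 4 *: bas rS i.
Proof.
apply: (@row3_ext _ i) => b; elim/row4_ind: b; split;
  rewrite !linE mprd_S !basE ?eqxx ?basN ?nxt_neq ?nxt2_neq /=; ring.
Qed.
End ModelClass.

Section ModelClass2.
Variables (K : realType) (S : comPzRingType) (io : {rmorphism K -> S}) (c : S).
Local Notation V := 'M[S]_(4, 3).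
Implicit Types u v w : V.
Local Notation bas := (@bas S).
Local Notation model := (model io c).
Local Notation ax := (ax S).
Local Notation sg := (sg S).
Local Notation "x ** y" := (mprd c x y) (at level 40, left associativity).

Lemma io_cancel n (P : V -> Prop) :
  (forall r u v, P u -> P v -> P (r *: u + v)) -> P 0 ->
  forall v, P (n.+1%:R *: v) -> P v.
Proof.
move=> PP P0 v Pv; rewrite -(@io_scale K S io n.+1%:R^-1 n.+1 v).
  by rewrite -[X in P X]addr0; apply: PP.
by rewrite mulVf // pnatr_eq0.
Qed.

(** The elements S_i and D_i together with iterated products by the S_i span the model. Indeed R_k
    is half of S_i S_j, and with X_i = S_i R_i = 2 (Q_j + Q_k) one has X_j + X_k - X_i = 4 Q_i. *)
Lemma model_ind (P : V -> Prop) : P 0 ->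
  (forall r u v, P u -> P v -> P (r *: u + v)) ->
  (forall i, P (bas rS i)) -> (forall i, P (bas rD i)) ->
  (forall i j, P (bas rS i ** bas rS j)) ->
  (forall i, P (bas rS i ** bas rR i)) -> forall v, P v.
Proof.
move=> P0 PP PS PD PSS PSR; have Pn := io_cancel PP P0.
have PB u v : P u -> P v -> P (u - v).
  by move=> Pu Pv; rewrite addrC -scaleN1r; apply: PP.
have PA u v : P u -> P v -> P (u + v).
  by move=> Pu Pv; rewrite -[u]scale1r; apply: PP.
apply: matrix_linear_ind => // a i; elim/row4_ind: a => //.
  by rewrite -(nxt3 i); apply: (Pn 1); rewrite -(mprd_SS c).
apply: (Pn 3); set X := (fun i => bas rS i ** bas rR i).
suff -> : 4 *: bas rQ i = X (nxt i) + X (nxt (nxt i)) - X i by apply: PB; [apply: PA|]; apply: PSR.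
rewrite /X !mprd_SR !nxt3 -scalerDr -scalerBr.
have -> : bas rQ (nxt (nxt i)) + bas rQ i + (bas rQ i + bas rQ (nxt i)) -
   (bas rQ (nxt i) + bas rQ (nxt (nxt i))) = 2 *: bas rQ i.
  by apply/matrixP => b l; rewrite !linE; ring.
by rewrite scalerA -natrM.
Qed.

Lemma axD i : ax i true + ax i false = 2 *: bas rS i.
Proof. by apply/matrixP => b l; rewrite !linE !axE basE /=; ring. Qed.
Lemma axB i : ax i true - ax i false = 2 *: bas rD i.
Proof. by apply/matrixP => b l; rewrite !linE !axE basE /=; ring. Qed.

Lemma model_generated v : generated_by (@axes K model) v.
Proof.
have [G0 GP GM] := generated_subalgebra (@axes K model).
have Gax i e : generated_by (@axes K model) (ax i e).
  rewrite (ax_gen io c) -[_ *: _]addr0; apply: GP => // B _; apply.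
  by exists i, e.
have Pn n := @io_cancel n (generated_by (@axes K model)) GP G0.
have GS i : generated_by (@axes K model) (bas rS i).
  by apply: (Pn 1%N); rewrite -axD -[ax i true]scale1r; apply: GP.
have GD i : generated_by (@axes K model) (bas rD i).
  by apply: (Pn 1%N); rewrite -axB addrC -scaleN1r; apply: GP.
apply: model_ind => //.
- by move=> i j; apply: GM.
- by move=> i; apply: (GM) => //; rewrite -(nxt3 i); apply: (Pn 1%N); rewrite -(mprd_SS c);
    apply: GM.
Qed.

Lemma formZZ (A : algebra K) r s (x y : car A) :
  form (r *: x) (s *: y) = r * s * form x y.
Proof. by rewrite formZl formZr mulrA. Qed.

Lemma form_gen (i j : 'I_3) d e : form (gen model i d) (gen model j e) =
  io (1 / 32) * io (1 / 32) * mform c (ax i d) (ax j e).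
Proof. exact: (formZZ (A := model)). Qed.

Lemma mform_ax i d e : mform c (ax i d) (ax i e) = 512 * (1 + sg d * sg e).
Proof.
rewrite (mformE _ i) /= /kap ?nxt3 !axE ?eqxx ?basN ?nxt_neq ?nxt2_neq /=.
ring.
Qed.
Lemma mform_ax_nxt i d e : mform c (ax i d) (ax (nxt i) e) = 32.
Proof.
rewrite (mformE _ i) /= /kap ?nxt3 !axE ?eqxx ?basN ?nxt_neq ?nxt2_neq /=.
ring.
Qed.
Lemma mformC u v : mform c u v = mform c v u.
Proof. by rewrite /mform mprdC. Qed.

Lemma io_val (r : K) n : r * n.+1%:R = 1 -> io r * n.+1%:R = 1.
Proof. by move=> E; rewrite -(rmorph_nat io) -rmorphM E rmorph1. Qed.

Lemma form_gen_gen i e : form (gen model i e) (gen model i e) = 1.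
Proof.
rewrite form_gen mform_ax sgM.
transitivity (io (1 / 32) * 32 * (io (1 / 32) * 32)); first by ring.
by rewrite io_val ?mulr1 //; field.
Qed.

Lemma model_axial : injective io -> primitive_frobenius_axial model.
Proof.
move=> inj; split=> //.
- by move=> i e; split; [apply: model_axis | apply: model_primitive].
- exact: model_generated.
- split; last exact: form_gen_gen.
  + exists (gen model 0 true), (gen model 0 true); rewrite form_gen_gen.
    move=> /eqP; rewrite -(rmorph1 io) -(rmorph0 io) => /eqP /inj /eqP.
    by rewrite oner_eq0.
  + by move=> u v w; exact: mformA.
Qed.
End ModelClass2.

(** * Property P and the shape 4A of the model *)

(** This is 24 times the idempotent v_(i,j). In the Hermitian picture v_(i,j) is the projection on
    v_i - v_j, with phases chosen such that <v_i,v_j> = 1/4: the matrix is 16 |v_i - v_j><v_i -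
    v_j|, and v_i - v_j has squared norm 3/2. *)
HB.lock Definition v4 (S : comPzRingType) (i : 'I_3) : 'M[S]_(4, 3) :=
  bas S rS i + bas S rS (nxt i) - bas S rR (nxt (nxt i)).

Section ModelShape.
Variables (K : realType) (S : comPzRingType) (io : {rmorphism K -> S}) (c : S).
Local Notation V := 'M[S]_(4, 3).
Implicit Types u v w : V.
Local Notation bas := (@bas S).
Local Notation model := (model io c).
Local Notation ax := (ax S).
Local Notation sg := (sg S).
Local Notation "x ** y" := (mprd c x y) (at level 40, left associativity).
Local Notation tau := (io (1 / 192)).

Lemma ioE (r : K) n : r * 192 = n%:R -> io r = n%:R * tau.
Proof.
move=> E; rewrite -(rmorph_nat io) -rmorphM; congr (io _).
by rewrite -E; field.
Qed.
Lemma tau1 : tau * 192 = 1.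
Proof. by rewrite -(rmorph_nat io) -rmorphM -(rmorph1 io); congr (io _); field. Qed.

Lemma mZZ r s u v : (r *: u) ** (s *: v) = (r * s) *: (u ** v).
Proof.
have := prdZl (A := model) r u (s *: v); rewrite /= => ->.
by have := prdZr (A := model) s u v; rewrite /= => ->; rewrite scalerA.
Qed.

Local Notation v4 := (v4 S).
Local Notation v i := (io (1 / 24) *: v4 i).

Lemma v4E i a l : v4 i a l = ((a == rS) && (l == i))%:R
  + ((a == rS) && (l == nxt i))%:R - ((a == rR) && (l == nxt (nxt i)))%:R.
Proof. by rewrite v4.unlock !linE !basE. Qed.
Lemma v4_mprd i u a l : (v4 i ** u) a l =
  (bas rS i ** u) a l + (bas rS (nxt i) ** u) a l - (bas rR (nxt (nxt i)) ** u) a l.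
Proof.
rewrite v4.unlock -[bas rS i in LHS]scale1r -addrA mprdP [_ - _ in LHS]addrC -scaleN1r mprdP.
by rewrite !linE; ring.
Qed.

Lemma v4_idem i : v4 i ** v4 i = 24 *: v4 i.
Proof.
have Sj := mprd_S c (nxt i) (v4 i); have Rk := mprd_R c (nxt (nxt i)) (v4 i).
rewrite !nxt3 in Sj Rk.
apply: (@row3_ext _ i) => a; elim/row4_ind: a; split; rewrite scE v4_mprd
  mprd_S Sj Rk ?nxt3 ?v4E ?eqxx ?basN ?nxt_neq ?nxt2_neq /=; ring.
Qed.

Lemma ax_ax i d e : 2 *: (ax i d ** ax (nxt i) e) =
  3 *: ax i d + 3 *: ax (nxt i) e + ax i (~~ d) + ax (nxt i) (~~ e) - 4 *: v4 i.
Proof.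
apply: (@row3_ext _ i) => a; elim/row4_ind: a; split; rewrite !linE
  mprd_ax /kap ?nxt3 ?linE ?axE ?v4E ?eqxx ?basN ?nxt_neq ?nxt2_neq /= ?sgN; ring.
Qed.
Lemma ax_v4 i e : 2 *: (ax i e ** v4 i) =
  15 *: ax i e - 3 *: ax i (~~ e) - 6 *: ax (nxt i) true - 6 *: ax (nxt i) false + 12 *: v4 i.
Proof.
apply: (@row3_ext _ i) => a; elim/row4_ind: a; split; rewrite !linE
  mprd_ax /kap ?nxt3 ?linE ?axE ?v4E ?eqxx ?basN ?nxt_neq ?nxt2_neq /= ?sgN; ring.
Qed.
Lemma ax_v4' i e : 2 *: (ax (nxt i) e ** v4 i) =
  15 *: ax (nxt i) e - 3 *: ax (nxt i) (~~ e) - 6 *: ax i true - 6 *: ax i false + 12 *: v4 i.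
Proof.
apply: (@row3_ext _ (nxt i)) => a; elim/row4_ind: a; split; rewrite !linE
  mprd_ax /kap ?nxt3 ?linE ?axE ?v4E ?eqxx ?basN ?nxt_neq ?nxt2_neq /= ?sgN; ring.
Qed.
Lemma ax_axN i e : ax i e ** ax i (~~ e) = 0.
Proof.
apply: (@row3_ext _ i) => a; elim/row4_ind: a; split; rewrite [RHS]mxE
  mprd_ax /kap ?nxt3 ?linE ?axE ?v4E ?eqxx ?basN ?nxt_neq ?nxt2_neq /= ?sgN; ring: (sgM S e).
Qed.

(* Shows that [a_i] and [a_j] generate [a_-j]. *)
Definition opp_poly (x y : V) : V :=
  let z := 2 *: (x ** y) - 3 *: x - 3 *: y in
  2 *: (x ** z) - 13 *: z + 57 *: x - 25 *: y.
Lemma opp_polyE i d e : opp_poly (ax i d) (ax (nxt i) e) = 14 *: ax (nxt i) (~~ e).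
Proof.
apply: (@row3_ext _ i) => a; elim/row4_ind: a; split; rewrite /opp_poly /= !linE
  !mprd_ax ?/kap ?nxt3 ?linE ?mprd_ax ?/kap ?nxt3 ?linE ?axE ?v4E ?eqxx ?basN ?nxt_neq ?nxt2_neq /= ?sgN; ring: (sgM S d).
Qed.
Lemma opp_polyE' i d e :
  opp_poly (ax i d) (ax (nxt (nxt i)) e) = 14 *: ax (nxt (nxt i)) (~~ e).
Proof.
apply: (@row3_ext _ i) => a; elim/row4_ind: a; split; rewrite /opp_poly /= !linE
  !mprd_ax ?/kap ?nxt3 ?linE ?mprd_ax ?/kap ?nxt3 ?linE ?axE ?v4E ?eqxx ?basN ?nxt_neq ?nxt2_neq /= ?sgN; ring: (sgM S d).
Qed.

Lemma gen_inj : injective io ->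
  forall i j d e, gen model i d = gen model j e -> (i, d) = (j, e).
Proof.
move=> inj i j d e E.
have nz n : (n.+1%:R : S) <> 0.
  rewrite -(rmorph_nat io) -(rmorph0 io) => /inj /eqP.
  by rewrite pnatr_eq0.
have {}E : ax i d = ax j e by rewrite !(ax_gen io c) E.
have /eqP ij : i == j.
  apply: contraT => /negbTE ij; have := congr1 (fun u : V => u rS i) E.
  rewrite !axE !eqxx ij /= mulr0 addr0 mulr0 addr0 => /(nz 0).
  by [].
subst j; have := congr1 (fun u : V => u rD i) E.
rewrite !axE !eqxx /= !add0r !mulr1 => Es.
case: d e Es {E} => -[] //= /eqP; rewrite -subr_eq0 ?opprK -?opprD ?oppr_eq0 => /eqP /(nz 1);
  by [].
Qed.

Definition flip (i : 'I_3) (u : V) : V :=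
  \matrix_(a, l) (if (a == rD) && (l != i) then - u a l else u a l).

Fact flip_linear i : linear (flip i).
Proof.
move=> k u v; apply/matrixP => a l; rewrite linE !mxE.
by case: ifP => // _; ring.
Qed.

(** The axis fixes the coordinates D_j and D_k, so they vanish on every eigenvector for an
    eigenvalue other than 1/32. Both a_i and a_-i have their 1/32-eigenspace spanned by D_j and D_k,
    and hence share this involution. *)
Lemma flip_miyamoto i d : exists2 t : {linear car model -> car model},
  miyamoto (gen model i d) t
  & forall j e, t (gen model j e) = gen model j (if j == i then e else ~~ e).
Proof.
pose lin := GRing.isLinear.Build S (car model) (car model) *:%R (flip i) (flip_linear i).
exists (HB.pack_for {linear car model -> car model} (flip i) lin).
  split=> [l v nl /eigen_ax E|v /eigen_ax E] /=.
    have e1 k : k = nxt i \/ k = nxt (nxt i) -> v rD k = 0.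
      move=> kk; have : (ax i d ** v) rD k = eign S l * v rD k by rewrite E scE.
      have -> : (ax i d ** v) rD k = v rD k by case: kk => ->; rewrite mprd_ax.
      case: l nl {E} => //= _ E1.
      - by apply: (canc io c (n := 30) (esym E1)); ring.
      - by rewrite mul0r in E1.
      - by apply: (canc io c (n := 6) (esym E1)); ring.
    apply/matrixP => a l'; rewrite mxE; case: eqP => //= ->.
    case: (ord3_cases i l') => ->; rewrite ?eqxx ?nxt_neq ?nxt2_neq //=.
      by rewrite e1 ?oppr0 //; left.
    by rewrite e1 ?oppr0 //; right.
  rewrite scale1r in E.
  have [p [q [Si Sj Sk Ri Rj Rk Qi Qj Qk Di Dj Dk]]] := eigen32_V32 io E.
  apply: (@row3_ext _ i) => a; elim/row4_ind: a; split;
    by rewrite !mxE /= ?eqxx ?nxt_neq ?nxt2_neq /= ?(Si, Sj, Sk, Ri, Rj, Rk, Qi, Qj, Qk, Di) ?oppr0.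
move=> j e; apply/matrixP => a l; rewrite mxE !scE !axE.
case: (altP (l =P i)) => [->|li]; rewrite ?andbF /=.
  by rewrite [i == j]eq_sym; case: (j == i) => //; rewrite !andbF !mulr0 addr0.
rewrite andbT; elim/row4_ind: a; rewrite /= ?andbF ?mulr0 ?addr0 ?add0r //.
case: (altP (j =P i)) => [->|ji]; first by rewrite (negbTE li) /= !mulr0 oppr0.
by rewrite sgN; ring.
Qed.

Lemma model_property_P : injective io -> property_P model.
Proof.
move=> inj; split=> [|i d]; first exact: gen_inj.
exact: flip_miyamoto.
Qed.

Lemma mform_ax_v4 i e : mform c (ax i e) (v4 i) = 288.
Proof.
rewrite (mformE _ i) /= /kap ?nxt3 !axE !v4E ?eqxx ?basN ?nxt_neq ?nxt2_neq /=.
ring.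
Qed.
Lemma mform_ax_v4' i e : mform c (ax (nxt i) e) (v4 i) = 288.
Proof.
rewrite (mformE _ i) /= /kap ?nxt3 !axE !v4E ?eqxx ?basN ?nxt_neq ?nxt2_neq /=.
ring.
Qed.
Lemma mform_v4_v4 i : mform c (v4 i) (v4 i) = 1152.
Proof.
rewrite (mformE _ i) /= /kap ?nxt3 !v4E ?eqxx ?basN ?nxt_neq ?nxt2_neq /=.
ring.
Qed.
End ModelShape.

Section ModelShape2.
Variables (K : realType) (S : comPzRingType) (io : {rmorphism K -> S}) (c : S).
Local Notation V := 'M[S]_(4, 3).
Implicit Types u v w : V.
Local Notation bas := (@bas S).
Local Notation model := (model io c).
Local Notation ax := (ax S).
Local Notation sg := (sg S).
Local Notation v4 := (v4 S).
Local Notation "x ** y" := (mprd c x y) (at level 40, left associativity).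
Local Notation tau := (io (1 / 192)).
Local Notation g i e := (io (1 / 32) *: ax i e).
Local Notation v i := (io (1 / 24) *: v4 i).

Lemma io32 : io (1 / 32) = 6 * tau. Proof. by apply: ioE; field. Qed.
Lemma io24 : io (1 / 24) = 8 * tau. Proof. by apply: ioE; field. Qed.
Lemma io64 : io (1 / 64) = 3 * tau. Proof. by apply: ioE; field. Qed.
Lemma io16 : io (1 / 16) = 12 * tau. Proof. by apply: ioE; field. Qed.

Lemma gen_gen i e d : let j := nxt i in
  g i e ** g j d = io (1 / 64) *:
    (3 *: g i e + 3 *: g j d + g i (~~ e) + g j (~~ d) - 3 *: v i).
Proof.
move=> j; rewrite (mZZ io); apply/matrixP => a l; rewrite !linE io32 io24 io64.
have := congr1 (fun u : V => u a l) (ax_ax c i e d); rewrite !linE => E.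
transitivity (18 * tau ^+ 2 * (2 * (ax i e ** ax j d) a l)); first by ring.
by rewrite E -/j; ring.
Qed.

Lemma gen_v i e : let j := nxt i in
  g i e ** v i = io (1 / 16) *:
    (5 *: g i e - g i (~~ e) - 2 *: g j true - 2 *: g j false + 3 *: v i).
Proof.
move=> j; rewrite (mZZ io); apply/matrixP => a l; rewrite !linE io32 io24 io16.
have := congr1 (fun u : V => u a l) (ax_v4 c i e); rewrite !linE => E.
transitivity (24 * tau ^+ 2 * (2 * (ax i e ** v4 i) a l)); first by ring.
by rewrite E -/j; ring.
Qed.

Lemma gen_v' i e : let j := nxt i in
  g j e ** v i = io (1 / 16) *:
    (5 *: g j e - g j (~~ e) - 2 *: g i true - 2 *: g i false + 3 *: v i).
Proof.
move=> j; rewrite (mZZ io); apply/matrixP => a l; rewrite !linE io32 io24 io16.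
have := congr1 (fun u : V => u a l) (ax_v4' c i e); rewrite !linE => E.
transitivity (24 * tau ^+ 2 * (2 * (ax j e ** v4 i) a l)); first by ring.
by rewrite E -/j; ring.
Qed.

Lemma v_idem i : v i ** v i = v i.
Proof.
rewrite (mZZ io) v4_idem scalerA; congr (_ *: _).
by rewrite -mulrA io_val ?mulr1 //; field.
Qed.

Lemma opp_poly_closed (G : V -> Prop) : subalgebra (A := model) G ->
  forall x y, G x -> G y -> G (opp_poly c x y).
Proof.
move=> [G0 GP GM] x y Gx Gy; rewrite /opp_poly.
have GZ r u : G u -> G (r *: u) by move=> Gu; rewrite -[_ *: _]addr0; apply: GP.
have GA u u' : G u -> G u' -> G (u + u') by move=> Gu Gu'; rewrite -[u]scale1r; apply: GP.
have GN u : G u -> G (- u) by move=> Gu; rewrite -scaleN1r; apply: GZ.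
have Gz : G (2 *: (x ** y) - 3 *: x - 3 *: y).
  by do ![done | apply: (GA) | apply: (GN) | apply: (GZ) | apply: (GM)].
by do ![done | apply: (GA) | apply: (GN) | apply: (GZ) | apply: (GM)].
Qed.

Lemma subalgebra_gens (G : V -> Prop) i : subalgebra (A := model) G ->
  G (g i true) -> G (g (nxt i) true) ->
  [/\ forall e, G (g i e), forall e, G (g (nxt i) e) & G (v i)].
Proof.
move=> sG; have [G0 GP GM] := sG.
have GZ r u : G u -> G (r *: u) by move=> Gu; rewrite -[_ *: _]addr0; apply: GP.
have GA u u' : G u -> G u' -> G (u + u') by move=> Gu Gu'; rewrite -[u]scale1r; apply: GP.
have GN u : G u -> G (- u) by move=> Gu; rewrite -scaleN1r; apply: GZ.
have Gn n u : G (n.+1%:R *: u) -> G u by apply: (io_cancel io GP G0).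
have Gax j e : G (g j e) -> G (ax j e).
  by move=> Gg; have := ax_gen io c j e; rewrite /= => ->; apply: GZ.
move=> /Gax Gi /Gax Gj.
have Gi' : G (ax i false).
  apply: (Gn 13); have := opp_polyE' c (nxt i) true true; rewrite nxt3 => <-.
  exact: opp_poly_closed.
have Gj' : G (ax (nxt i) false).
  by apply: (Gn 13); rewrite -(opp_polyE c i true true); apply: opp_poly_closed.
split=> [[]|[]|]; try exact: GZ.
apply: (GZ); apply: (Gn 3%N).
have -> : 4 *: v4 i = 3 *: ax i true + 3 *: ax (nxt i) true + ax i false + ax (nxt i) false
    - 2 *: (ax i true ** ax (nxt i) true).
  by rewrite ax_ax opprB addrC subrK.
by do ![done | apply: (GA) | apply: (GN) | apply: (GZ) | apply: (GM)].
Qed.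

(** The span of the four axes and v_(i,j) in coordinates: only S_i, S_j, R_k, D_i, D_j may occur. *)
Definition in4A i u := [/\ u rS (nxt (nxt i)) = 0, u rR i = 0, u rR (nxt i) = 0,
  forall l, u rQ l = 0 & u rD (nxt (nxt i)) = 0].

Lemma in4A_subalgebra i : subalgebra (A := model) (in4A i).
Proof.
split=> [|r u w [u1 u2 u3 u4 u5] [w1 w2 w3 w4 w5]|u w [u1 u2 u3 u4 u5] [w1 w2 w3 w4 w5]].
- by split=> *; rewrite mxE.
- by split=> *; rewrite !linE ?(u1, u2, u3, u4, u5, w1, w2, w3, w4, w5) mulr0 addr0.
- by split=> [|||l|]; rewrite /= mprdE /= /mS /mR /mQ /kap ?nxt3
    ?(u1, u2, u3, u4, u5, w1, w2, w3, w4, w5) ; try (case: (ord3_cases i l) => ->;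
    rewrite ?nxt3 ?(u1, u2, u3, u4, u5, w1, w2, w3, w4, w5)); ring.
Qed.

Lemma in4A_span i u : in4A i u ->
  exists c1 c2 c3 c4 c5 : S,
  u = c1 *: g i true + c2 *: g i false + c3 *: g (nxt i) true + c4 *: g (nxt i) false
      + c5 *: v i.
Proof.
move=> [u1 u2 u3 u4 u5]; pose r := u rR (nxt (nxt i)).
(* Substitute R_k = S_i + S_j - 24 v, S_i = 16 (a_i + a_-i) and D_i = 16 (a_i - a_-i). *)
exists (16 * (u rS i + r + u rD i)), (16 * (u rS i + r - u rD i)),
  (16 * (u rS (nxt i) + r + u rD (nxt i))), (16 * (u rS (nxt i) + r - u rD (nxt i))), (- (24 * r)).
have E32 := @io_val K S io (1 / 32) 31 _; have E24 := @io_val K S io (1 / 24) 23 _.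
have {}E32 : io (1 / 32) * 32 = 1 by apply: E32; field.
have {}E24 : io (1 / 24) * 24 = 1 by apply: E24; field.
rewrite !scalerA.
have -> : - (24 * r) * io (1 / 24) = - r by rewrite mulNr mulrAC [24 * _]mulrC E24 mul1r.
pose h := 16 * io (1 / 32).
have hE : 2 * h = 1 by transitivity (io (1 / 32) * 32); [rewrite /h; ring | exact: E32].
have H x : 16 * x * io (1 / 32) = x * h by rewrite /h; ring.
move: h hE H => h hE H.
rewrite !H; apply: (@row3_ext _ i) => a; elim/row4_ind: a; split;
  rewrite !linE !axE !v4E ?eqxx ?basN ?nxt_neq ?nxt2_neq /= ?(u1, u2, u3, u4, u5) /r.
all: rewrite /sg /=; first [ring | by rewrite -[LHS]mulr1 -[X in _ * X = _]hE; ring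
  | by rewrite -[LHS](addrK (u rR (nxt (nxt i)))) -[X in X - _ = _]mulr1 -[X in _ * X - _ = _]hE; ring].
Qed.

Lemma model_type_4A i : type_4A (A := model) i (nxt i) (v i).
Proof.
split.
- exact: v_idem.
- move=> x; split.
    move=> gx; apply: in4A_span; apply: gx (in4A_subalgebra i) _ => _ [->|->];
      split=> *; rewrite /= scE axE ?nxt3 ?eqxx ?basN ?nxt_neq ?nxt2_neq /= ?andbF; ring.
  move=> [c1 [c2 [c3 [c4 [c5 ->]]]]].
  move=> G sG XG; have [_ GP _] := sG.
  have Gi : G (g i true) by apply: XG; left.
  have Gj : G (g (nxt i) true) by apply: XG; right.
  have [gi gj gv] := subalgebra_gens sG Gi Gj.
  have GZ r u : G u -> G (r *: u) by move=> Gu; rewrite -[_ *: _]addr0; apply: GP => //; case: sG.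
  have GA u u' : G u -> G u' -> G (u + u') by move=> Gu Gu'; rewrite -[u]scale1r; apply: GP.
  by do ![apply: (gi) | apply: (gj) | apply: (gv) | apply: (GZ) | apply: (GA)].
- move=> e d; exact: gen_gen.
- split.
  + move=> e; exact: gen_v.
  + move=> e; exact: gen_v'.
  + by rewrite /= (mZZ io) (ax_axN c i true) scaler0.
  + by rewrite /= (mZZ io) (ax_axN c (nxt i) true) scaler0.
- have F x y (r s : S) : mform c (r *: x) (s *: y) = r * s * mform c x y.
    exact: (formZZ (A := model)).
  have T : tau * 192 = 1 := tau1 io.
  split.
  + move=> e d; rewrite /= F mform_ax_nxt io32.
    by transitivity (6 * tau * (tau * 192)); [ring | rewrite T mulr1].
  + by rewrite /= !F !mform_ax /sg /= !mul1r subrr !mulr0.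
  + move=> e; rewrite /= F mform_ax_v4 io32 io24 (_ : io (3 / 8) = 72 * tau); last by apply: ioE; field.
    by transitivity (72 * tau * (tau * 192)); [ring | rewrite T mulr1].
  + move=> e; rewrite /= F mform_ax_v4' io32 io24 (_ : io (3 / 8) = 72 * tau); last by apply: ioE; field.
    by transitivity (72 * tau * (tau * 192)); [ring | rewrite T mulr1].
  + rewrite /= F mform_v4_v4 io24.
    by transitivity (2 * (tau * 192) * (tau * 192)); [ring | rewrite T !mulr1].
Qed.

Lemma type_4A_sym (A : algebra K) i j (w : car A) : (forall x y : car A, form x y = form y x) ->
  type_4A i j w -> type_4A j i w.
Proof.
move=> fC [ww span ab [av bv aa bb] [fab [fa fb] fav fbv fww]]; split=> //.
- move=> x; split.
    move=> gx; have /span [c1 [c2 [c3 [c4 [c5 ->]]]]] :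
        generated_by (fun y => y = gen A i true \/ y = gen A j true) x.
      by move=> B sB XB; apply: gx sB _ => y [] ->; apply: XB; [right|left].
    exists c3, c4, c1, c2, c5; congr (_ + _).
    by rewrite -[LHS]addrA addrC !addrA.
  move=> [c1 [c2 [c3 [c4 [c5 ->]]]]] B sB XB.
  have gx : generated_by (fun y => y = gen A i true \/ y = gen A j true)
      (c3 *: gen A i true + c4 *: gen A i false + c1 *: gen A j true + c2 *: gen A j false + c5 *: w).
    by apply/span; exists c3, c4, c1, c2, c5.
  rewrite -[X in X + _]addrA [X in X + _]addrC addrA.
  by apply: gx sB _ => y [] ->; apply: XB; [right|left].
- move=> e d; rewrite prdC ab; congr (_ *: (_ - _)).
  by rewrite [3 *: _ + _]addrC -addrA [X in _ + X]addrC addrA.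
- by split=> // e d; rewrite fC.
Qed.

Lemma model_shape_4A : shape_4A model.
Proof.
pose W (i j : 'I_3) : V := if j == nxt i then v i else v j.
exists W => [i j|i j ij].
  rewrite /W; case: (ord3_cases i j) => ->.
  - by rewrite [i == nxt i]eq_sym nxt_neq.
  - by rewrite eqxx basN.
  - by rewrite nxt3 eqxx nxt_neq.
have sym (x y : car model) : form x y = form y x := mformC c x y.
rewrite /W; case: (ord3_cases i j) ij => ->; rewrite ?eqxx // => _.
  exact: model_type_4A.
rewrite nxt_neq; apply: type_4A_sym => //.
by have := model_type_4A (nxt (nxt i)); rewrite nxt3.
Qed.

Lemma model_class_4A : injective io -> class_4A model.
Proof.
move=> inj; split; first exact: model_axial.
  exact: model_property_P.
exact: model_shape_4A.
Qed.

End ModelShape2.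

(** * Universality *)

Section PrimitiveFrobenius.
Variables (K : realType) (A : algebra K).
Hypothesis pfa : primitive_frobenius_axial A.
Implicit Types x y z : car A.

(** Associativity of the form and commutativity of the product give symmetry as soon as one argument
    is a product. Axes are products because they are idempotent, and they generate. *)
Lemma form_sym x y : form x y = form y x.
Proof.
have [_ ax gn [_ assoc _]] := pfa.
have M (u v w : car A) : form (prd u v) w = form w (prd u v).
  by rewrite -assoc [RHS]assoc [prd w u]prdC -[RHS]assoc [prd w v]prdC.
move: x (gn x) y => x /(_ (fun x => forall y, form x y = form y x)); apply.
  split=> [y|r u v Hu Hv y|u v _ _ y].
  - by rewrite form0l form0r.
  - by rewrite formPl formPr Hu Hv.
  - exact: M.
move=> _ [i [e ->]] y.
by have [[aa _ _ _] _] := ax i e; rewrite -aa M.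
Qed.

(** The product x y is a multiple m a of the axis plus a 0-eigenvector, which is orthogonal to a.
    Hence m = <a, x y> = <a x, y> = <x, y> / 4. This makes the two-valued rule for 1/4 times 1/4 as
    usable as the single-valued ones. *)
Lemma axis_quarter i e x y :
  eigen (gen A i e) ev4 x -> eigen (gen A i e) ev4 y ->
  prd (gen A i e) (prd x y) = (iota A (1 / 4) * form x y) *: gen A i e.
Proof.
have [_ ax _ [_ assoc g1]] := pfa.
have [[aa _ _ fus] prim] := ax i e; set a := gen A i e in aa fus prim *.
move=> ex ey; have [f ef] := fus _ _ _ _ ex ey.
rewrite /= !big_cons big_nil addr0 => E.
have [m Em] := (prim (f ev1)).1 (ef ev1).
have E0 : form a (f ev0) = 0.
  rewrite -[X in form X _]aa -assoc.
  by rewrite (ef ev0) /= scale0r form0r.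
have -> : prd a (prd x y) = m *: a.
  rewrite E prdDr (ef ev1) (ef ev0) /= scale1r scale0r addr0.
  exact: Em.
congr (_ *: _); have : form a (prd x y) = m.
  by rewrite E formDr E0 addr0 Em formZr g1 mulr1.
by rewrite assoc ex formZl => <-.
Qed.
End PrimitiveFrobenius.

(** * The comparison map from the model to an algebra of the class *)

Section Universal.
Variables (K : realType) (A : algebra K).
Hypothesis cA : class_4A A.
Local Notation S := (coef A).
Local Notation io := (iota A).
Local Notation a := (gen A).
Local Notation V := 'M[S]_(4, 3).
Local Notation bas := (@bas S).
Local Notation ax := (ax S).
Local Notation sg := (sg S).
Implicit Types u w : V.

Let pfa : primitive_frobenius_axial A. Proof. by case: cA. Qed.

Definition vA i := v_4A A i (nxt i).
Definition sA i := a i true + a i false.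
Definition dA i := a i true - a i false.
(** The elements [rA] and [qA] are forced by relations of the model: R_l = S_j + S_k - 24 v_(j,k)
    and 4 Q_l = X_j + X_k - X_l with X_l = S_l R_l, each divided by the scale 16. *)
Definition rA l := sA (nxt l) + sA (nxt (nxt l)) - io (3 / 2) *: vA (nxt l).
Definition xA l := prd (sA l) (rA l).
Definition qA l := 4 *: (xA (nxt l) + xA (nxt (nxt l)) - xA l).

(** In the model <s_1, s_2 s_3> = c / 32 ([model_cA4]), so no other value of the parameter is
    possible. *)
Definition cA4 : S := 32 * form (sA 0) (prd (sA (nxt 0)) (sA (nxt (nxt 0)))).
Local Notation c := cA4.

Lemma vA_type i : type_4A i (nxt i) (vA i).
Proof.
have [_ _ [v _ tv]] := cA.
have ij : i != nxt i by rewrite eq_sym nxt_neq.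
by have := tv _ _ ij; rewrite (type_4A_v (tv _ _ ij)).
Qed.

Definition bA (b : 'I_4) l : car A :=
  16 *: match val b with 0 => sA l | 1 => rA l | 2 => qA l | _ => dA l end.
Definition Psi u : car A := \sum_b \sum_l u b l *: bA b l.

Lemma PsiP k u w : Psi (k *: u + w) = k *: Psi u + Psi w.
Proof.
rewrite /Psi scaler_sumr -big_split; apply: eq_bigr => b _.
rewrite scaler_sumr -big_split; apply: eq_bigr => l _ /=.
by rewrite !linE scalerDl scalerA.
Qed.
Lemma PsiD u w : Psi (u + w) = Psi u + Psi w.
Proof. by rewrite -[u in LHS]scale1r PsiP scale1r. Qed.
Lemma Psi0 : Psi 0 = 0.
Proof. by apply: (addIr (Psi 0)); rewrite -PsiD !add0r. Qed.
Lemma PsiZ k u : Psi (k *: u) = k *: Psi u.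
Proof. by rewrite -[_ *: _ in LHS]addr0 PsiP Psi0 addr0. Qed.
Lemma PsiN u : Psi (- u) = - Psi u.
Proof. by rewrite -[X in Psi X]scaleN1r PsiZ scaleN1r. Qed.
Lemma PsiB u w : Psi (u - w) = Psi u - Psi w.
Proof. by rewrite PsiD PsiN. Qed.

Lemma Psi_bas b l : Psi (bas b l) = bA b l.
Proof.
have z b' l' : (b' != b) || (l' != l) -> bas b l b' l' *: bA b' l' = 0.
  by rewrite basE -negb_and => /negbTE ->; rewrite scale0r.
rewrite /Psi (bigD1 b) //= (bigD1 l) //= basE !eqxx scale1r.
rewrite big1 => [|l' nl]; last by rewrite z // nl orbT.
rewrite big1 => [|b' nb]; first by rewrite !addr0.
by rewrite big1 // => l' _; rewrite z // nb.
Qed.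

Lemma Psi_ax i e : Psi (ax i e) = 32 *: a i e.
Proof.
rewrite ax.unlock addrC PsiP !Psi_bas /bA /=.
have -> : a i e = io (1 / 2) *: (sA i + sg e *: dA i).
  rewrite /sA /dA /sg; apply/eqP; rewrite -subr_eq0; apply/eqP.
  apply: (@natr_scale_inj _ _ 1); rewrite scalerBr scalerA -(rmorph_nat io) -rmorphM.
  rewrite (_ : 2 * (1 / 2) = 1) ?rmorph1 ?scale1r; last by field.
  rewrite (rmorph_nat io) scaler_nat mulr2n.
  case: e; rewrite ?scale1r ?scaleN1r.
    by rewrite [X in _ - X](_ : _ = a i true + a i true) ?subrr // addrACA subrr addr0.
  rewrite [X in _ - X](_ : _ = a i false + a i false) ?subrr //.
  by rewrite opprB [X in X + _]addrC addrACA subrr addr0.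
rewrite [32 *: _]scalerA; have -> : 32 * io (1 / 2) = 16.
  by rewrite -!(rmorph_nat io) -rmorphM; congr (io _); field.
by rewrite [RHS]scalerDr addrC !scalerA [sg e * _]mulrC.
Qed.

End Universal.

(* The failures of [Psi] to be multiplicative and isometric. *)
HB.lock Definition dl (K : realType) (A : algebra K) (u w : 'M[coef A]_(4, 3)) : car A :=
  prd (Psi u) (Psi w) - Psi (mprd (cA4 A) u w).
HB.lock Definition phi (K : realType) (A : algebra K) (u w : 'M[coef A]_(4, 3)) : coef A :=
  form (Psi u) (Psi w) - mform (cA4 A) u w.

(** * Defects that vanish by the 4A relations *)

Section UniversalDefect.
Variables (K : realType) (A : algebra K).
Hypothesis cA : class_4A A.
Local Notation S := (coef A).
Local Notation io := (iota A).
Local Notation a := (gen A).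
Local Notation V := 'M[S]_(4, 3).
Local Notation bas := (@bas S).
Local Notation ax := (ax S).
Local Notation sg := (sg S).
Local Notation g i e := (io (1 / 32) *: ax i e : V).
Implicit Types u w : V.

Let pfa : primitive_frobenius_axial A. Proof. by case: cA. Qed.

Local Notation vA := (@vA K A).
Local Notation sA := (@sA K A).
Local Notation dA := (@dA K A).
Local Notation rA := (@rA K A).
Local Notation xA := (@xA K A).
Local Notation qA := (@qA K A).

Local Notation c := (cA4 A).
Local Notation N := (model io c).
Local Notation "x ** y" := (mprd c x y) (at level 40, left associativity).

Lemma dlC u w : dl u w = dl w u.
Proof. by rewrite dl.unlock prdC mprdC. Qed.
Lemma dlP k u u' w : dl (k *: u + u') w = k *: dl u w + dl u' w.
Proof. by rewrite dl.unlock PsiP prdP mprdP PsiP scalerBr opprD addrACA. Qed.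
Lemma dl0 w : dl 0 w = 0.
Proof.
have m0 : 0 ** w = 0 := prd0l (A := N) w.
by rewrite dl.unlock m0 Psi0 prd0l subrr.
Qed.
Lemma dlZ k u w : dl (k *: u) w = k *: dl u w.
Proof. by rewrite -[_ *: _ in LHS]addr0 dlP dl0 addr0. Qed.
Lemma dlD u u' w : dl (u + u') w = dl u w + dl u' w.
Proof. by rewrite -[u in LHS]scale1r dlP scale1r. Qed.
Lemma dlN u w : dl (- u) w = - dl u w.
Proof. by rewrite -[X in dl X]scaleN1r dlZ scaleN1r. Qed.
Lemma dlB u u' w : dl (u - u') w = dl u w - dl u' w.
Proof. by rewrite dlD dlN. Qed.
Lemma dlr k u w w' : dl u (k *: w + w') = k *: dl u w + dl u w'.
Proof. by rewrite ![dl u _]dlC dlP. Qed.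

Lemma dl_cancel n u w : dl (n.+1%:R *: u) w = 0 -> dl u w = 0.
Proof. by rewrite dlZ => /natr_scale_inj. Qed.

Lemma Psi_g i e : Psi (g i e) = a i e.
Proof.
rewrite PsiZ Psi_ax scalerA -(rmorph_nat io) -rmorphM.
by rewrite (_ : _ * _ = 1) ?rmorph1 ?scale1r //; field.
Qed.

Lemma Psi_v i : Psi (io (1 / 24) *: v4 S i) = vA i.
Proof.
rewrite PsiZ v4.unlock PsiB PsiD !Psi_bas /bA /= -scalerDr -scalerBr /rA !nxt3.
rewrite opprB addrC subrK; move: (vA i) => x.
rewrite !scalerA -(rmorph_nat io) -!rmorphM.
by rewrite (_ : _ * _ = 1) ?rmorph1 ?scale1r //; field.
Qed.

Lemma dl_eq u w x : prd (Psi u) (Psi w) = x -> Psi (u ** w) = x -> dl u w = 0.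
Proof. by rewrite dl.unlock => -> ->; rewrite subrr. Qed.

Lemma dl_gg i e d : dl (g i e) (g (nxt i) d) = 0.
Proof.
have [_ _ ab _ _] := vA_type cA i.
apply: dl_eq; first by rewrite !Psi_g ab.
by rewrite gen_gen PsiZ PsiB !PsiD !(PsiZ 3) Psi_v !Psi_g.
Qed.
Lemma dl_gv i e : dl (g i e) (io (1 / 24) *: v4 S i) = 0.
Proof.
have [_ _ _ [av _ _ _] _] := vA_type cA i.
apply: dl_eq; first by rewrite Psi_g Psi_v av.
by rewrite gen_v PsiZ PsiD !PsiB !(PsiZ 5, PsiZ 2, PsiZ 3) Psi_v !Psi_g.
Qed.
Lemma dl_gv' i e : dl (g (nxt i) e) (io (1 / 24) *: v4 S i) = 0.
Proof.
have [_ _ _ [_ bv _ _] _] := vA_type cA i.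
apply: dl_eq; first by rewrite Psi_g Psi_v bv.
by rewrite gen_v' PsiZ PsiD !PsiB !(PsiZ 5, PsiZ 2, PsiZ 3) Psi_v !Psi_g.
Qed.
Lemma dl_g i e d : dl (g i e) (g i d) = 0.
Proof.
have [_ _ _ [_ _ aa _] _] := vA_type cA i.
have [_ ax _ _] := pfa; have [[ii _ _ _] _] := ax i e.
case: (boolP (d == e)) => [/eqP ->|de].
  apply: (dl_eq (x := a i e)); first by rewrite Psi_g.
  by have [gg _ _ _] := model_axis io c i e; rewrite -Psi_g; congr Psi.
have -> : d = ~~ e by case: (d) (e) de => -[].
apply: (dl_eq (x := 0)).
  by rewrite !Psi_g; case: (e); rewrite //= prdC.
by rewrite (mZZ io) ax_axN scaler0 Psi0.
Qed.

Lemma dl_ax i e j d : dl (ax i e) (ax j d) = 0.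
Proof.
rewrite !(ax_gen io c) dlZ dlC dlZ dlC [dl _ _](_ : _ = 0) ?scaler0 //=.
case: (ord3_cases i j) => ->; first exact: dl_g.
  exact: dl_gg.
by rewrite dlC; have := dl_gg (nxt (nxt i)) d e; rewrite nxt3.
Qed.

Lemma dl_axv i e : dl (ax i e) (v4 S i) = 0 /\ dl (ax (nxt i) e) (v4 S i) = 0.
Proof.
have v1 : 24 *: (io (1 / 24) *: v4 S i) = v4 S i.
  by rewrite scalerA -(rmorph_nat io) -rmorphM (_ : _ * _ = 1) ?rmorph1 ?scale1r //; field.
by split; rewrite !(ax_gen io c) dlZ -v1 dlC dlZ dlC ?dl_gv ?dl_gv' !scaler0.
Qed.

Lemma dl_SD w : (forall i e, dl (ax i e) w = 0) ->
  forall i, dl (bas rS i) w = 0 /\ dl (bas rD i) w = 0.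
Proof.
move=> H i; split; apply: (@dl_cancel 1).
  by rewrite -axD dlD !H addr0.
by rewrite -axB dlB !H subr0.
Qed.

Lemma dl_SD_SD i j b b' : b = rS \/ b = rD -> b' = rS \/ b' = rD ->
  dl (bas b i) (bas b' j) = 0.
Proof.
have H k d b1 l : b1 = rS \/ b1 = rD -> dl (ax k d) (bas b1 l) = 0.
  move=> Hb; have [] := @dl_SD (ax k d) (fun _ _ => dl_ax _ _ _ _) l.
  by rewrite dlC; case: Hb => -> // _; rewrite dlC.
move=> Hb Hb'; have [] := @dl_SD (bas b' j) (fun k d => H k d b' j Hb') i.
by case: Hb => ->.
Qed.

(** For k different from i, R_k is a combination of S coordinates and of the idempotent v of a 4A
    subalgebra containing a_i, whose products with the axis are prescribed. *)
Lemma dl_axR i e k : k != i -> dl (ax i e) (bas rR k) = 0.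
Proof.
have P l d : dl (ax l d) (bas rR (nxt (nxt l))) = 0 /\
    dl (ax (nxt l) d) (bas rR (nxt (nxt l))) = 0.
  have S0 m j : dl (bas rS j) (ax m d) = 0.
    by have [] := @dl_SD (ax m d) (fun _ _ => dl_ax _ _ _ _) j.
  have E : bas rR (nxt (nxt l)) = bas rS l + bas rS (nxt l) - v4 S l.
    by rewrite v4.unlock opprB addrC subrK.
  have [v1 v2] := dl_axv l d.
  by split; rewrite E dlC dlB dlD !S0 dlC ?v1 ?v2 addr0 subr0.
case: (ord3_cases i k) => -> ne; first by rewrite eqxx in ne.
  by have [_] := P (nxt (nxt i)) e; rewrite nxt3.
by have [] := P i e.
Qed.

Lemma Psi_S i : Psi (bas rS i) = 16 *: sA i. Proof. exact: Psi_bas. Qed.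

(** For k = i the equation S_i R_i = 2 (Q_j + Q_k) holds in A by the choice of [qA]. The other cases
    follow from [dl_axR]. *)
Lemma dl_SR i k : dl (bas rS i) (bas rR k) = 0.
Proof.
have [->|ki] := eqVneq k i; last first.
  apply: (@dl_cancel 1).
  by rewrite -axD dlD !dl_axR // addr0.
apply: (dl_eq (x := 256 *: xA i)); rewrite ?mprd_SR ?PsiZ ?PsiD !Psi_bas /bA /=.
  by rewrite prdZl prdZr scalerA -natrM.
rewrite /qA !nxt3 -!scalerDr !scalerA; move: (xA i) (xA (nxt i)) (xA (nxt (nxt i))) => x y z.
have -> : z + x - y + (x + y - z) = 2 *: x.
  have -> : z + x - y = x + (z - y) by rewrite [z + x]addrC addrA.
  have -> : x + y - z = x + (y - z) by rewrite addrA.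
  by rewrite addrACA -[z - y]opprB addNr addr0 scaler_nat mulr2n.
by rewrite scalerA -!natrM.
Qed.

Lemma phiP k u u' w : phi (k *: u + u') w = k * phi u w + phi u' w.
Proof. by rewrite phi.unlock PsiP formPl mformPl; ring. Qed.
Lemma phiC u w : phi u w = phi w u.
Proof. by rewrite phi.unlock mformC (form_sym pfa). Qed.
Lemma phi0 w : phi 0 w = 0.
Proof.
have m0 : mform c 0 w = 0 := form0l (A := N) w.
by rewrite phi.unlock m0 Psi0 form0l subrr.
Qed.
Lemma phiZ k u w : phi (k *: u) w = k * phi u w.
Proof. by rewrite -[_ *: _ in LHS]addr0 phiP phi0 addr0. Qed.
Lemma phiD u u' w : phi (u + u') w = phi u w + phi u' w.
Proof. by rewrite -[u in LHS]scale1r phiP mul1r. Qed.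
Lemma phiN u w : phi (- u) w = - phi u w.
Proof. by rewrite -[X in phi X]scaleN1r phiZ mulN1r. Qed.
Lemma phiB u u' w : phi (u - u') w = phi u w - phi u' w.
Proof. by rewrite phiD phiN. Qed.
Lemma phi_cancel n u w : phi (n.+1%:R *: u) w = 0 -> phi u w = 0.
Proof. by rewrite phiZ => /natr_mul_inj. Qed.

(** Both forms associate with their products, so [phi] inherits adjointness of any x whose products
    are respected by [Psi]. *)
Lemma phi_adj x u w : dl x u = 0 -> dl x w = 0 -> phi (x ** u) w = phi u (x ** w).
Proof.
have [_ _ _ [_ assoc _]] := pfa.
rewrite dl.unlock => /eqP; rewrite subr_eq0 => /eqP xu /eqP; rewrite subr_eq0 => /eqP xw.
rewrite phi.unlock -xu -xw -(prdC (Psi u)) -assoc; congr (_ - _).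
by rewrite [x ** u]mprdC mformA.
Qed.

Lemma phi_ax i e j d : phi (ax i e) (ax j d) = 0.
Proof.
rewrite !(ax_gen io c) phiZ phiC phiZ [phi _ _](_ : _ = 0) ?mulr0 //= phiC.
rewrite phi.unlock !Psi_g.
have nx l e' d' : form (a l e') (a (nxt l) d') = mform c (g l e') (g (nxt l) d').
  have [_ _ _ _ [fab _ _ _ _]] := vA_type cA l; rewrite fab.
  by have [_ _ _ _ [fab' _ _ _ _]] := model_type_4A io c l; exact: esym (fab' _ _).
case: (ord3_cases i j) => ->.
- have [_ _ _ _ [_ [faa _] _ _ _]] := vA_type cA i.
  have [_ _ _ _ [_ [faa' _] _ _ _]] := model_type_4A io c i.
  have [_ _ _ [_ _ g1]] := pfa.
  have g1' e' : mform c (g i e') (g i e') = 1 := form_gen_gen io c i e'.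
  have {}faa : form (a i true) (a i false) = 0 := faa.
  have {}faa' : mform c (g i true) (g i false) = 0 := faa'.
  case: e; case: d; first by rewrite g1 g1' subrr.
  + by rewrite faa faa' subrr.
  + by rewrite (form_sym pfa (a i false)) faa mformC faa' subrr.
  + by rewrite g1 g1' subrr.
- by rewrite nx subrr.
- rewrite (form_sym pfa) mformC.
  by have := nx (nxt (nxt i)) d e; rewrite nxt3 => ->; rewrite subrr.
Qed.

Lemma phi_SD_SD i j b b' : b = rS \/ b = rD -> b' = rS \/ b' = rD ->
  phi (bas b i) (bas b' j) = 0.
Proof.
have H w : (forall k d, phi (ax k d) w = 0) ->
    forall k, phi (bas rS k) w = 0 /\ phi (bas rD k) w = 0.
  move=> Hw k; split; apply: (@phi_cancel 1).
    by rewrite -axD phiD !Hw addr0.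
  by rewrite -axB phiB !Hw subr0.
have H' k d b1 l : b1 = rS \/ b1 = rD -> phi (ax k d) (bas b1 l) = 0.
  move=> Hb; have [] := H (ax k d) (fun _ _ => phi_ax _ _ _ _) l.
  by rewrite phiC; case: Hb => -> // _; rewrite phiC.
move=> Hb Hb'; have [] := H (bas b' j) (fun k d => H' k d b' j Hb') i.
by case: Hb => ->.
Qed.

(** Up to scale this is <s_i, s_j s_k>, which is invariant under cyclic permutation and equals c /
    32 in both algebras by the choice of [cA4]. *)
Lemma phi_SR i : phi (bas rS i) (bas rR i) = 0.
Proof.
have [_ _ _ [_ assoc _]] := pfa.
pose T l := form (sA l) (prd (sA (nxt l)) (sA (nxt (nxt l)))).
have Tn l : T (nxt (nxt l)) = T l by rewrite /T [RHS]assoc [RHS](form_sym pfa) !nxt3.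
have Ti : 32 * T i = c.
  rewrite /cA4 -/(T 0); congr (_ * _).
  by case: (ord3_cases 0 i) => ->; rewrite ?Tn // -(Tn 0) -{2}(nxt3 0) Tn.
rewrite phiC; apply: (@phi_cancel 1); rewrite -{1}(nxt3 i) -(mprd_SS c).
set j := nxt i; set k := nxt j.
have : dl (bas rS j) (bas rS k) = 0 by apply: dl_SD_SD; left.
rewrite phi.unlock dl.unlock => /eqP; rewrite subr_eq0 => /eqP <-.
rewrite !Psi_S prdZl prdZr !formZl formZr (form_sym pfa) -/(T i).
have -> : mform c (bas rS j ** bas rS k) (bas rS i) = 128 * c.
  rewrite /k /j mprd_SS !nxt3 (mformE _ i) /= /kap ?nxt3 !scE !basE.
  by rewrite ?eqxx ?basN ?nxt_neq ?nxt2_neq /=; ring.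
by rewrite -Ti; ring.
Qed.

End UniversalDefect.

(** * Fusion rules as equations for the defects *)

Section UniversalFusion.
Variables (K : realType) (A : algebra K).
Hypothesis cA : class_4A A.
Local Notation S := (coef A).
Local Notation io := (iota A).
Local Notation a := (gen A).
Local Notation V := 'M[S]_(4, 3).
Local Notation bas := (@bas S).
Local Notation ax := (ax S).
Local Notation sg := (sg S).
Local Notation c := (cA4 A).
Local Notation N := (model io c).
Local Notation "x ** y" := (mprd c x y) (at level 40, left associativity).
Implicit Types u w y : V.

Let pfa : primitive_frobenius_axial A. Proof. by case: cA. Qed.
Let inj : injective io. Proof. by case: pfa. Qed.

Lemma eigen_Psi_ax i e l (x : car A) :
  eigen (a i e) l x <-> prd (Psi (ax i e)) x = eign S l *: x.
Proof.
rewrite /eigen Psi_ax prdZl.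
have -> : eigval_of A l = io (1 / 32) * eign S l.
  by rewrite -(eignE io c) !eigval_ofE.
split=> [->|E].
  rewrite scalerA mulrA -(rmorph_nat io) -rmorphM (_ : 32 * (1 / 32) = 1) ?rmorph1 ?mul1r //.
  by field.
rewrite -scalerA -E scalerA -(rmorph_nat io) -rmorphM (_ : _ * _ = 1) ?rmorph1 ?scale1r //.
by field.
Qed.

Lemma Psi_eigen i e l u : ax i e ** u = eign S l *: u -> dl (ax i e) u = 0 ->
  eigen (a i e) l (Psi u).
Proof.
rewrite dl.unlock => E /eqP; rewrite subr_eq0 => /eqP D; apply/eigen_Psi_ax.
by rewrite D E PsiZ.
Qed.

(** The product of the images is an n-eigenvector of the axis in A, and u w is one in the model. The
    image of u w differs from an eigenvector only through the defect of the axis against u w;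
    subtracting the two eigenvector equations gives the claim. *)
Lemma dl_fuse i e l m n u w : fuse l m = [:: n] ->
  ax i e ** u = eign S l *: u -> ax i e ** w = eign S m *: w ->
  dl (ax i e) u = 0 -> dl (ax i e) w = 0 ->
  dl (ax i e) (u ** w) + prd (Psi (ax i e)) (dl u w) = eign S n *: dl u w.
Proof.
move=> F Eu Ew Du Dw.
have : eigen (a i e) n (prd (Psi u) (Psi w)).
  apply: eigen_sum1; rewrite -F; have [_ ax' _ _] := pfa.
  have [[_ _ _ fus] _] := ax' i e.
  by apply: fus; apply: Psi_eigen.
move=> /eigen_Psi_ax EA.
have : eigen (gen N i e) n (u ** w).
  by apply: eigen_sum1; rewrite -F; apply: ax_fusion.
move=> /eigen_ax EN.
rewrite dl.unlock EN PsiZ prdBr EA scalerBr addrC -[LHS]addrA; congr (_ + _).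
by rewrite addrA addNr add0r.
Qed.

(** By [axis_quarter] the axis sends each of the two products to a quarter of a form value times
    itself. The values agree because [phi u w] is zero. *)
Lemma dl_fuse44 i e u w : ax i e ** u = 8 *: u -> ax i e ** w = 8 *: w ->
  dl (ax i e) u = 0 -> dl (ax i e) w = 0 -> phi u w = 0 ->
  dl (ax i e) (u ** w) + prd (Psi (ax i e)) (dl u w) = 0.
Proof.
rewrite phi.unlock => Eu Ew Du Dw /eqP; rewrite subr_eq0 => /eqP Ph.
have QA := axis_quarter pfa (Psi_eigen (l := ev4) Eu Du) (Psi_eigen (l := ev4) Ew Dw).
have QN : (ax i e : V) ** (u ** w) = (io (1 / 4) * mform c u w) *: ax i e.
  have := @axis_quarter _ _ (model_axial c inj) i e u w.
  move=> /(_ ((eigen_ax io c i e ev4 u).2 Eu) ((eigen_ax io c i e ev4 w).2 Ew)) Q.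
  rewrite (ax_gen io c).
  have -> : (32 *: (gen N i e : V)) ** (u ** w) = 32 *: @prd K N (gen N i e) (u ** w).
    exact: (prdZl (A := N)).
  by rewrite Q !scalerA [32 * _]mulrC.
rewrite dl.unlock prdBr QN PsiZ [X in _ + (X - _)](_ : _ = (io (1 / 4) * mform c u w) *: Psi (ax i e)).
  by rewrite addrC addrA subrK subrr.
by rewrite Psi_ax prdZl QA Ph !scalerA mulrC.
Qed.

(* Eigenvectors of both axes [a_i] and [a_-i]. *)
Definition z1 i : V := 16 *: bas rS (nxt i) - 4 *: bas rR (nxt (nxt i)) + bas rS i.
Definition z2 i : V := 16 *: bas rS (nxt (nxt i)) - 4 *: bas rR (nxt i) + bas rS i.
Definition h1 i : V := 2 *: bas rR (nxt (nxt i)) - bas rS i.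
Definition h2 i : V := 2 *: bas rR (nxt i) - bas rS i.

Lemma ax_z1 i e : ax i e ** z1 i = 0.
Proof.
apply: (@V0_eigen _ _ _ _ _ 1 0 0 0 0).
by split; rewrite /z1 !linE !basE ?eqxx ?nxt_neq ?nxt2_neq ?basN /=; ring.
Qed.
Lemma ax_z2 i e : ax i e ** z2 i = 0.
Proof.
apply: (@V0_eigen _ _ _ _ _ 0 1 0 0 0).
by split; rewrite /z2 !linE !basE ?eqxx ?nxt_neq ?nxt2_neq ?basN /=; ring.
Qed.
Lemma ax_h1 i e : ax i e ** h1 i = 8 *: h1 i.
Proof.
apply: (@V4_eigen _ _ _ _ _ 0 1 0 0).
by split; rewrite /h1 !linE !basE ?eqxx ?nxt_neq ?nxt2_neq ?basN /=; ring.
Qed.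
Lemma ax_h2 i e : ax i e ** h2 i = 8 *: h2 i.
Proof.
apply: (@V4_eigen _ _ _ _ _ 1 0 0 0).
by split; rewrite /h2 !linE !basE ?eqxx ?nxt_neq ?nxt2_neq ?basN /=; ring.
Qed.

Lemma z1_mprd i u b l : (z1 i ** u) b l = 16 * (bas rS (nxt i) ** u) b l
  - 4 * (bas rR (nxt (nxt i)) ** u) b l + (bas rS i ** u) b l.
Proof.
rewrite /z1 -addrA mprdP -scaleNr mprdP !linE; ring.
Qed.
Lemma h1_mprd i u b l : (h1 i ** u) b l = 2 * (bas rR (nxt (nxt i)) ** u) b l - (bas rS i ** u) b l.
Proof.
rewrite /h1 mprdP -[- bas rS i]scaleN1r -[-1 *: _]addr0 mprdP.
have -> : 0 ** u = 0 := prd0l (A := N) u.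
rewrite !linE mxE; ring.
Qed.

Lemma z1z2 i : z1 i ** z2 i = 512 *: bas rR i
  - 128 *: (bas rQ i + bas rQ (nxt i) + bas rQ (nxt (nxt i)))
  + (32 *: (bas rR (nxt i) + bas rR (nxt (nxt i))) + (64 * c - 16) *: bas rS i).
Proof.
have Sj := mprd_S c (nxt i) (z2 i); have Rk := mprd_R c (nxt (nxt i)) (z2 i).
rewrite !nxt3 in Sj Rk.
apply: (@row3_ext _ i) => b; elim/row4_ind: b; split; rewrite z1_mprd Sj Rk mprd_S /z2
   !linE !basE ?eqxx ?nxt_neq ?nxt2_neq ?basN /=; ring.
Qed.
Lemma z1h2 i : z1 i ** h2 i = 64 *: bas rQ (nxt (nxt i))
  + (- 16 *: bas rR (nxt (nxt i)) + (8 - 32 * c) *: bas rS i).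
Proof.
have Sj := mprd_S c (nxt i) (h2 i); have Rk := mprd_R c (nxt (nxt i)) (h2 i).
rewrite !nxt3 in Sj Rk.
apply: (@row3_ext _ i) => b; elim/row4_ind: b; split; rewrite z1_mprd Sj Rk mprd_S /h2
   !linE !basE ?eqxx ?nxt_neq ?nxt2_neq ?basN /=; ring.
Qed.
Lemma h1z2 i : h1 i ** z2 i = 64 *: bas rQ (nxt i)
  + (- 16 *: bas rR (nxt i) + (8 - 32 * c) *: bas rS i).
Proof.
have Rk := mprd_R c (nxt (nxt i)) (z2 i); rewrite !nxt3 in Rk.
apply: (@row3_ext _ i) => b; elim/row4_ind: b; split; rewrite h1_mprd Rk mprd_S /z2
   !linE !basE ?eqxx ?nxt_neq ?nxt2_neq ?basN /=; ring.
Qed.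
Lemma h1h2 i : h1 i ** h2 i = 32 *: bas rQ i
  + (- 8 *: (bas rR (nxt i) + bas rR (nxt (nxt i))) + 16 * c *: bas rS i).
Proof.
have Rk := mprd_R c (nxt (nxt i)) (h2 i); rewrite !nxt3 in Rk.
apply: (@row3_ext _ i) => b; elim/row4_ind: b; split; rewrite h1_mprd Rk mprd_S /h2
   !linE !basE ?eqxx ?nxt_neq ?nxt2_neq ?basN /=; ring.
Qed.

End UniversalFusion.

(* Linear identities in a module are checked coefficientwise. *)
Section LinearIdentities.
Variables (R : comPzRingType) (M : lmodType R).

Inductive lexp := LAtom of nat | LZero | LAdd of lexp & lexp | LOpp of lexp | LScale of R & lexp.

Fixpoint leval (l : seq M) (e : lexp) : M :=
  match e with
  | LAtom n => nth 0 l n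
  | LZero => 0
  | LAdd e1 e2 => leval l e1 + leval l e2
  | LOpp e1 => - leval l e1
  | LScale k e1 => k *: leval l e1
  end.

Fixpoint lcoef (e : lexp) (i : nat) : R :=
  match e with
  | LAtom n => if n == i then 1 else 0
  | LZero => 0
  | LAdd e1 e2 => lcoef e1 i + lcoef e2 i
  | LOpp e1 => - lcoef e1 i
  | LScale k e1 => k * lcoef e1 i
  end.

Lemma levalE l e : leval l e = \sum_(i < size l) lcoef e i *: nth 0 l i.
Proof.
elim: e => [n||e1 IH1 e2 IH2|e1 IH1|k e1 IH1] /=.
- have [nl|nl] := ltnP n (size l); last first.
    rewrite nth_default // big1 // => i _; rewrite eqn_leq.
    by rewrite [(n <= i)%N]leqNgt (leq_trans (ltn_ord i) nl) scale0r.
  rewrite (bigD1 (Ordinal nl)) //= eqxx scale1r big1 ?addr0 // => i ni.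
  by case: eqP => [E|]; rewrite ?scale0r //; case/eqP: ni; apply: val_inj.
- by rewrite big1 // => i _; rewrite scale0r.
- by rewrite IH1 IH2 -big_split; apply: eq_bigr => i _; rewrite scalerDl.
- by rewrite IH1 -sumrN; apply: eq_bigr => i _; rewrite scaleNr.
- by rewrite IH1 scaler_sumr; apply: eq_bigr => i _; rewrite scalerA.
Qed.

Lemma leval_eq l e1 e2 :
  (forall i, (i < size l)%N -> lcoef e1 i = lcoef e2 i) -> leval l e1 = leval l e2.
Proof. by move=> E; rewrite !levalE; apply: eq_bigr => i _; rewrite E. Qed.
End LinearIdentities.

Ltac lin_mem x l := match l with
  | nil => constr:(false) | cons x _ => constr:(true) | cons _ ?l' => lin_mem x l' end.
Ltac lin_index x l := match l with
  | cons x _ => constr:(0%N) | cons _ ?l' => let n := lin_index x l' in constr:(n.+1) end.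
Ltac lin_atoms l t := match t with
  | 0 => l
  | ?x + ?y => let l1 := lin_atoms l x in lin_atoms l1 y
  | - ?x => lin_atoms l x
  | _ *: ?x => lin_atoms l x
  | _ => match lin_mem t l with true => l | false => constr:(cons t l) end
  end.
Ltac lin_reify R l t := match t with
  | 0 => constr:(@LZero R)
  | ?x + ?y => let a := lin_reify R l x in let b := lin_reify R l y in constr:(@LAdd R a b)
  | - ?x => let a := lin_reify R l x in constr:(@LOpp R a)
  | ?k *: ?x => let a := lin_reify R l x in constr:(@LScale R k a)
  | _ => let n := lin_index t l in constr:(@LAtom R n)
  end.
Ltac lin_ring R :=
  match goal with |- @eq ?M ?x ?y =>
    let l := lin_atoms (@nil M) x in let l := lin_atoms l y in
    let e1 := lin_reify R l x in let e2 := lin_reify R l y in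
    apply: (@leval_eq R _ l e1 e2) => -[|[|[|[|[|[|[|[|[|[|[|[|]]]]]]]]]]]] //= _; ring
  end.


(** * Axes are respected, and so is the form *)

Section UniversalMap.
Variables (K : realType) (A : algebra K).
Hypothesis cA : class_4A A.
Local Notation S := (coef A).
Local Notation io := (iota A).
Local Notation V := 'M[S]_(4, 3).
Local Notation bas := (@bas S).
Local Notation ax := (ax S).
Local Notation sg := (sg S).
Local Notation c := (cA4 A).
Local Notation "x ** y" := (mprd c x y) (at level 40, left associativity).
Implicit Types u w y : V.

Let pfa : primitive_frobenius_axial A. Proof. by case: cA. Qed.

Lemma dlrZ k u w : dl u (k *: w) = k *: dl u w.
Proof. by rewrite dlC dlZ dlC. Qed.
Lemma dlrD u w w' : dl u (w + w') = dl u w + dl u w'.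
Proof. by rewrite dlC dlD !(dlC u). Qed.
Lemma dlrN u w : dl u (- w) = - dl u w.
Proof. by rewrite dlC dlN dlC. Qed.
Lemma dlrB u w w' : dl u (w - w') = dl u w - dl u w'.
Proof. by rewrite dlC dlB !(dlC u). Qed.
Definition dl_lin := (dlD, dlB, dlZ, dlN, dlrD, dlrB, dlrZ, dlrN).

Lemma dl_SS i j : dl (bas rS i) (bas rS j) = 0.
Proof. by apply: (dl_SD_SD cA); left. Qed.
Lemma dl_axS i e j : dl (ax i e) (bas rS j) = 0.
Proof.
by rewrite ax.unlock !dl_lin dl_SS (dl_SD_SD cA) ?scaler0 ?addr0 //; [right|left].
Qed.
Lemma dl_RS i j : dl (bas rR i) (bas rS j) = 0.
Proof. by rewrite dlC (dl_SR cA). Qed.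
Lemma dl_axR_diag i e : dl (ax i e) (bas rR i) = sg e *: dl (bas rD i) (bas rR i).
Proof. by rewrite ax.unlock !dl_lin (dl_SR cA) add0r. Qed.

Lemma dl_ax_zh i e :
  [/\ dl (ax i e) (z1 A i) = 0, dl (ax i e) (z2 A i) = 0,
      dl (ax i e) (h1 A i) = 0 & dl (ax i e) (h2 A i) = 0].
Proof.
have [n1 n2] : nxt i != i /\ nxt (nxt i) != i by rewrite nxt_neq nxt2_neq.
by split; rewrite /z1 /z2 /h1 /h2 !dl_lin ?dl_axS !(dl_axR cA) // !scaler0 ?subr0 ?addr0.
Qed.

Lemma phi_SS i j : phi (bas rS i) (bas rS j) = 0.
Proof. by apply: (phi_SD_SD cA); left. Qed.
Lemma phi_SR_off i : phi (bas rS i) (bas rR (nxt i)) = 0 /\ phi (bas rS i) (bas rR (nxt (nxt i))) = 0.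
Proof.
split; rewrite (phiC cA); apply: (@phi_cancel _ _ 1).
  have := mprd_SS c (nxt (nxt i)); rewrite !nxt3 => <-.
  by rewrite [bas rS (nxt (nxt i)) ** _]mprdC (phi_adj cA) ?dl_SS // mprd_SSd (phiC cA) phiZ phi_SS mulr0.
by rewrite -(mprd_SS c) (phi_adj cA) ?dl_SS // mprd_SSd (phiC cA) phiZ phi_SS mulr0.
Qed.
(** The hypothesis of [dl_fuse44] for this pair. It is available at this stage because R coordinates
    are products of S coordinates, which can be moved across [phi]. *)
Lemma phi_h1h2 i : phi (h1 A i) (h2 A i) = 0.
Proof.
have [p1 p2] := phi_SR_off i.
have RR : phi (bas rR (nxt (nxt i))) (bas rR (nxt i)) = 0.
  apply: (@phi_cancel _ _ 1); rewrite -(mprd_SS c) (phi_adj cA) ?dl_SS ?(dl_SR cA) //.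
  by rewrite mprd_SRj (phiC cA) phiD !phiZ !(phiC cA _ (bas rS (nxt i))) (phi_SR cA) phi_SS !mulr0 addr0.
rewrite /h1 phiB phiZ !(phiC cA _ (h2 A i)) /h2 !phiB !phiZ.
by rewrite !(phiC cA (bas rR (nxt i))) RR p1 (phi_SS i i) p2 !mulr0 !subr0 !mulr0.
Qed.

(** The four products of a [z] with a [z] or [h], or of an [h] with either, have defects that are
    multiples of the single vector E. Each gives a linear equation between E, its image B under the
    axis, and the defects of the axis against R_i and the Q coordinates. *)
Lemma dl_phase1 i : let E := dl (bas rR (nxt i)) (bas rR (nxt (nxt i))) in
  forall e, 2 *: (sg e *: dl (bas rD i) (bas rR i)) + E = 0 /\
  let B := prd (Psi (ax i e)) E in
  [/\ 32 *: dl (ax i e) (bas rQ i) + 4 *: B = 0,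
      64 *: dl (ax i e) (bas rQ (nxt i)) - 8 *: B = - (64 *: E)
    & 64 *: dl (ax i e) (bas rQ (nxt (nxt i))) - 8 *: B = - (64 *: E)].
Proof.
move=> E e; pose B := prd (Psi (ax i e)) E.
have [dz1 dz2 dh1 dh2] := dl_ax_zh i e.
have [n1 n2] : nxt i != i /\ nxt (nxt i) != i by rewrite nxt_neq nxt2_neq.
have E' : dl (bas rR (nxt (nxt i))) (bas rR (nxt i)) = E by rewrite dlC.
have az1 := ax_z1 A i e; have az2 := ax_z2 A i e.
rewrite -(scale0r (z1 A i)) in az1; rewrite -(scale0r (z2 A i)) in az2.
have R1 := dl_axR cA e n1; have R2 := dl_axR cA e n2.
have F1 := @dl_fuse _ _ cA i e ev0 ev0 ev0 _ _ erefl az1 az2 dz1 dz2.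
have F2 := @dl_fuse _ _ cA i e ev0 ev4 ev4 _ _ erefl az1 (ax_h2 A i e) dz1 dh2.
have F3 := @dl_fuse _ _ cA i e ev4 ev0 ev4 _ _ erefl (ax_h1 A i e) az2 dh1 dz2.
have ph := phi_h1h2 i.
have F4 := dl_fuse44 cA (ax_h1 A i e) (ax_h2 A i e) dh1 dh2 ph.
rewrite z1z2 /z1 /z2 in F1.
rewrite z1h2 /z1 /h2 in F2.
rewrite h1z2 /h1 /z2 in F3.
rewrite h1h2 /h1 /h2 in F4.
rewrite /= ?(dlD, dlrD) ?(dlN, dlrN) ?(dlZ, dlrZ) ?(dlD, dlrD) ?dl_SS ?dl_RS ?(dl_SR cA) ?dl_axS ?R1 ?R2 ?E' in F1.
rewrite /= ?(dlD, dlrD) ?(dlN, dlrN) ?(dlZ, dlrZ) ?(dlD, dlrD) ?dl_SS ?dl_RS ?(dl_SR cA) ?dl_axS ?R1 ?R2 ?E' in F2.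
rewrite /= ?(dlD, dlrD) ?(dlN, dlrN) ?(dlZ, dlrZ) ?(dlD, dlrD) ?dl_SS ?dl_RS ?(dl_SR cA) ?dl_axS ?R1 ?R2 ?E' in F3.
rewrite /= ?(dlD, dlrD) ?(dlN, dlrN) ?(dlZ, dlrZ) ?(dlD, dlrD) ?dl_SS ?dl_RS ?(dl_SR cA) ?dl_axS ?R1 ?R2 ?E' in F4.
rewrite (dl_axR_diag i e) ?(prdDr, prdNr, prdZr, prd0r) -/B in F1.
rewrite ?(prdDr, prdNr, prdZr, prd0r) -/B in F2.
rewrite ?(prdDr, prdNr, prdZr, prd0r) -/B in F3.
rewrite ?(prdDr, prdNr, prdZr, prd0r) -/B in F4.
have T (k1 k2 k3 k4 : S) (l1 r1 l2 r2 l3 r3 l4 r4 : car A) :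
    l1 = r1 -> l2 = r2 -> l3 = r3 -> l4 = r4 ->
    k1 *: (l1 - r1) + k2 *: (l2 - r2) + k3 *: (l3 - r3) + k4 *: (l4 - r4) = 0.
  by move=> -> -> -> ->; rewrite !subrr !scaler0 !addr0.
move: (dl (bas rD i) (bas rR i)) F1 => Y F1; rewrite -/B.
move: (dl (ax i e) (bas rQ i)) (dl (ax i e) (bas rQ (nxt i)))
  (dl (ax i e) (bas rQ (nxt (nxt i)))) F1 F2 F3 F4 => Q0 Q1 Q2 F1 F2 F3 F4.
clearbody B; clearbody E.
split.
  (* The weights 1, 2, 2, 4 cancel B and the three Q defects and leave 256 times the claim. *)
  apply: (@natr_scale_inj _ _ 255); apply: etrans (T 1 2 2 4 _ _ _ _ _ _ _ _ F1 F2 F3 F4).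
  lin_ring (coef A).
move=> B0; rewrite /B0; split.
- apply: etrans (T 0 0 0 1 _ _ _ _ _ _ _ _ F1 F2 F3 F4).
  lin_ring (coef A).
- apply/eqP; rewrite -subr_eq0; apply/eqP.
  apply: etrans (T 0 0 1 0 _ _ _ _ _ _ _ _ F1 F2 F3 F4).
  lin_ring (coef A).
- apply/eqP; rewrite -subr_eq0; apply/eqP.
  apply: etrans (T 0 1 0 0 _ _ _ _ _ _ _ _ F1 F2 F3 F4).
  lin_ring (coef A).
Qed.

Lemma dl_phase1' i : [/\ dl (bas rR (nxt i)) (bas rR (nxt (nxt i))) = 0,
  dl (bas rD i) (bas rR i) = 0 & forall e l, dl (ax i e) (bas rQ l) = 0].
Proof.
have := dl_phase1 i; set E := dl _ _; set Y := dl (bas rD i) _ => H /=.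
have [T _] := H true; have [F _] := H false; rewrite /= scale1r in T; rewrite /= scaleN1r in F.
(* The axes a_i and a_-i give the defect of D_i against R_i opposite signs; adding both equations
   leaves 2 E = 0. *)
have E0 : E = 0.
  apply: (@natr_scale_inj _ _ 1); rewrite -[RHS]addr0 -{1}T -F; lin_ring (coef A).
have Y0 : Y = 0 by move: T; rewrite E0 addr0 => /natr_scale_inj.
split=> // e l; have [_ [q0 q1 q2]] := H e.
rewrite E0 prd0r !scaler0 addr0 in q0; rewrite E0 prd0r !scaler0 subr0 oppr0 in q1.
rewrite E0 prd0r !scaler0 subr0 oppr0 in q2.
case: (ord3_cases i l) => ->; [exact: natr_scale_inj q0 | exact: natr_scale_inj q1
  | exact: natr_scale_inj q2].
Qed.

Lemma dl_ax0 i e w : dl (ax i e) w = 0.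
Proof.
have [_ Y0 Q0] := dl_phase1' i.
elim/matrix_linear_ind: w => [|k u w Hu Hw|b l].
- by rewrite dlC dl0.
- by rewrite dlr Hu Hw scaler0 addr0.
elim/row4_ind: b => //.
- by rewrite dl_axS.
- have [->|li] := eqVneq l i; last exact: (dl_axR cA).
  by rewrite dl_axR_diag Y0 scaler0.
- by rewrite ax.unlock !(dlD, dlZ) !(dl_SD_SD cA) ?scaler0 ?addr0 //; by [left|right].
Qed.

Lemma dl_SD0 i w : dl (bas rS i) w = 0 /\ dl (bas rD i) w = 0.
Proof. by apply: dl_SD => j e; apply: dl_ax0. Qed.
Lemma dl_S0 i w : dl (bas rS i) w = 0. Proof. by case: (dl_SD0 i w). Qed.
Lemma dl_D0 i w : dl (bas rD i) w = 0. Proof. by case: (dl_SD0 i w). Qed.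

Lemma phi_r u w w' k : phi u (k *: w + w') = k * phi u w + phi u w'.
Proof. by rewrite !(phiC cA u) phiP. Qed.

(** S_i and D_i are now self-adjoint for [phi]. As 16 S_i = D_i D_i, 16 D_i = D_i S_i, and D_i y
    lies in the span of D_i and S_i, pairings with S_i or D_i reduce to known zeros. Products with
    S_i then reach the rest of the spanning set. *)
Lemma phi_all u w : phi u w = 0.
Proof.
have adjS i x y : phi (bas rS i ** x) y = phi x (bas rS i ** y).
  by apply: (phi_adj cA); apply: dl_S0.
have adjD i x y : phi (bas rD i ** x) y = phi x (bas rD i ** y).
  by apply: (phi_adj cA); apply: dl_D0.
have Dmul i y : exists k m, bas rD i ** y = k *: bas rD i + m *: bas rS i.
  exists (kap c y i), (16 * y rD i).
  apply: (@row3_ext _ i) => b; elim/row4_ind: b; split;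
    rewrite !linE mprd_D !basE ?eqxx ?basN ?nxt_neq ?nxt2_neq /=; ring.
have DD i j : phi (bas rD i) (bas rD j) = 0 by apply: (phi_SD_SD cA); right.
have DS i j : phi (bas rD i) (bas rS j) = 0.
  by apply: (phi_SD_SD cA); [right | left].
have phS i y : phi (bas rS i) y = 0.
  have E : 16 *: bas rS i = bas rD i ** bas rD i.
    apply: (@row3_ext _ i) => b; elim/row4_ind: b; split;
      rewrite !linE mprd_D /kap !basE ?eqxx ?basN ?nxt_neq ?nxt2_neq /=; ring.
  apply: (@phi_cancel _ _ 15); rewrite E adjD.
  by have [k [m ->]] := Dmul i y; rewrite phi_r (phiC cA _ (m *: _)) phiZ
    (phiC cA (bas rS i)) DD DS !mulr0 addr0.
have phD i y : phi (bas rD i) y = 0.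
  have E : 16 *: bas rD i = bas rD i ** bas rS i.
    apply: (@row3_ext _ i) => b; elim/row4_ind: b; split;
      rewrite !linE mprd_D /kap !basE ?eqxx ?basN ?nxt_neq ?nxt2_neq /=; ring.
  apply: (@phi_cancel _ _ 15); rewrite E adjD.
  have [k [m ->]] := Dmul i y; rewrite phi_r phS (phiC cA _ (m *: _)) phiZ phS.
  by rewrite !mulr0 addr0.
have phR i y : phi (bas rR i) y = 0.
  by apply: (@phi_cancel _ _ 1); rewrite -(nxt3 i) -(mprd_SS c) adjS phS.
move: u; apply: (@model_ind K S io c (fun u => phi u w = 0)) => [|k x y Hx Hy|i|i|i j|i] //.
- by rewrite phi0.
- by rewrite phiP Hx Hy mulr0 addr0.
- by rewrite adjS phS.
- by rewrite adjS phR.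
Qed.

End UniversalMap.

(** * The comparison map is multiplicative *)

Section UniversalHom.
Variables (K : realType) (A : algebra K).
Hypothesis cA : class_4A A.
Local Notation S := (coef A).
Local Notation io := (iota A).
Local Notation a := (gen A).
Local Notation V := 'M[S]_(4, 3).
Local Notation bas := (@bas S).
Local Notation ax := (ax S).
Local Notation sg := (sg S).
Local Notation c := (cA4 A).
Local Notation N := (model io c).
Local Notation "x ** y" := (mprd c x y) (at level 40, left associativity).
Implicit Types u w y : V.

Let pfa : primitive_frobenius_axial A. Proof. by case: cA. Qed.

(* The components of an even [y] in the eigenspaces of [a_i] for 0 and 1/4. *)
Definition part0 i y : V := 16 *: y + kap c y i *: bas rS i - 2 *: (bas rS i ** y).
Definition part4 i y : V := 2 *: (bas rS i ** y) - (2 * kap c y i) *: bas rS i.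

Lemma part_sum i y : 16 *: y = part0 i y + part4 i y + kap c y i *: bas rS i.
Proof. by rewrite /part0 /part4; lin_ring (coef A). Qed.

Lemma ax_part i e y : (forall l, y rD l = 0) ->
  ax i e ** part0 i y = 0 *: part0 i y /\ ax i e ** part4 i y = 8 *: part4 i y.
Proof.
have mD u w z : (u + w) ** z = u ** z + w ** z by exact: (prdDl (A := N)).
have mZ k u w : (k *: u) ** w = k *: (u ** w) by exact: (prdZl (A := N)).
move=> y0; rewrite ax.unlock !mD !mZ.
split; apply: (@row3_ext _ i) => b; elim/row4_ind: b; split;
  rewrite ?(linE, mprd_S c i, mprd_D c i) /kap /part0 /part4 /kap ?(linE, mprd_S c i) ?y0
    ?basE ?nxt3 ?eqxx ?basN ?nxt_neq ?nxt2_neq /=; ring.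
Qed.


(* Multiplying the defect of a part for 1/4 and a part for 0 by an axis gives *)
(* both 0 and a quarter of it, because the sum of the two parts of [y] agrees *)
(* with a multiple of an axis up to [y].                                      *)
Lemma dl_S_mul i y : (forall l, y rD l = 0) -> (forall w, dl y w = 0) ->
  forall w, dl (bas rS i ** y) w = 0.
Proof.
move=> y0 dy.
have dS w : dl (bas rS i) w = 0 := dl_S0 cA i w.
have dSr w : dl w (bas rS i) = 0 by rewrite dlC.
have dp w : dl (part0 i y) w = - dl (part4 i y) w.
  apply/eqP; rewrite -addr_eq0 -dlD; apply/eqP.
  have /(congr1 (fun z => dl z w)) := part_sum i y.
  by rewrite [in RHS]dlD !dlZ dy dS !scaler0 addr0.
have d4 w : (forall l, w rD l = 0) -> dl (part4 i y) w = 0.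
  move=> w0; apply: (@natr_scale_inj _ _ 15); rewrite -dlrZ (part_sum i w) dlrD [dl _ (part0 _ _ + _)]dlrD dlrZ dSr.
  rewrite scaler0 addr0.
  have [yp0 yp4] := ax_part i true y0; have [wp0 wp4] := ax_part i true w0.
  have dx := dl_ax0 cA i true.
  have F00 := @dl_fuse _ _ cA i true ev0 ev0 ev0 _ _ erefl yp0 wp0 (dx _) (dx _).
  have F40 := @dl_fuse _ _ cA i true ev4 ev0 ev4 _ _ erefl yp4 wp0 (dx _) (dx _).
  have F04 := @dl_fuse _ _ cA i true ev0 ev4 ev4 _ _ erefl yp0 wp4 (dx _) (dx _).
  have F44 := dl_fuse44 cA yp4 wp4 (dx _) (dx _) (phi_all cA _ _).
  rewrite !dx !add0r !dp /= scale0r prdNr in F00.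
  rewrite dx add0r in F40; rewrite dx add0r !dp scalerN prdNr in F04.
  rewrite dx add0r in F44.
  have e8 : eign S ev4 = 8 by [].
  have G1 : dl (part4 i y) (part0 i w) = 0.
    apply: (@natr_scale_inj _ _ 7); rewrite -e8 -F40.
    by apply/eqP; rewrite -oppr_eq0 F00.
  have G2 : dl (part4 i y) (part4 i w) = 0.
    apply: (@natr_scale_inj _ _ 7); move/eqP: F04; rewrite eqr_opp => /eqP E.
    by rewrite -[RHS]F44 E.
  by rewrite G1 G2 addr0.
have dS_even w : (forall l, w rD l = 0) -> dl (bas rS i ** y) w = 0.
  move=> w0; apply: (@natr_scale_inj _ _ 1); rewrite -dlZ.
  have -> : 2 *: (bas rS i ** y) = part4 i y + (2 * kap c y i) *: bas rS i.
    by rewrite /part4 subrK.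
  by rewrite dlD dlZ dS scaler0 addr0 d4.
move=> w.
elim/matrix_linear_ind: w => [|k u w Hu Hw|b l].
- by rewrite dlC dl0.
- by rewrite dlr Hu Hw scaler0 addr0.
elim/row4_ind: b; last by rewrite dlC (dl_D0 cA).
- by apply: dS_even => m; rewrite basE.
- by apply: dS_even => m; rewrite basE.
- by apply: dS_even => m; rewrite basE.
Qed.

(** By [dl_S_mul], the even elements with zero defect are stable under multiplication by S_i. Two
    such multiplications, starting from the S_i, reach the even spanning elements of [model_ind]. *)
Lemma dl_all u w : dl u w = 0.
Proof.
have dR i w' : dl (bas rR i) w' = 0.
  apply: (@natr_scale_inj _ _ 1); rewrite -dlZ -(nxt3 i) -(mprd_SS c).
  by apply: dl_S_mul => [l|w'']; [rewrite basE | apply: dl_S0].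
move: u; apply: (@model_ind K S io c (fun u => dl u w = 0)) => [|k x y Hx Hy|i|i|i j|i].
- by rewrite dl0.
- by rewrite dlP Hx Hy scaler0 addr0.
- exact: dl_S0.
- exact: dl_D0.
- by apply: dl_S_mul => [l|w'']; [rewrite basE | apply: dl_S0].
- by apply: dl_S_mul => [l|w'']; [rewrite basE | apply: dR].
Qed.

Fact Psi_prd u w : Psi (u ** w) = prd (Psi u) (Psi w).
Proof. by have := dl_all u w; rewrite dl.unlock => /eqP; rewrite subr_eq0 eq_sym => /eqP. Qed.
Fact Psi_form u w : form (Psi u) (Psi w) = mform c u w.
Proof. by have := phi_all cA u w; rewrite phi.unlock => /eqP; rewrite subr_eq0 => /eqP. Qed.

End UniversalHom.

Definition universal_hom (K : realType) (A : algebra K) (cA : class_4A A) :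
  ahom (model (iota A) (cA4 A)) A :=
  @Ahom K (model (iota A) (cA4 A)) A idfun (@Psi K A) (fun=> erefl) (@PsiP K A)
    (Psi_prd cA) (fun u w => esym (Psi_form cA u w)) (@Psi_g K A).

(** * Change of coefficients and initiality of the generic model *)

Section ModelMap.
Variables (K : realType) (R S : comPzRingType) (ior : {rmorphism K -> R}) (ios : {rmorphism K -> S}).
Variables (psi : {rmorphism R -> S}) (r : R) (s : S).
Hypothesis psiI : forall k, psi (ior k) = ios k.
Hypothesis psir : psi r = s.

Definition mapV (u : 'M[R]_(4, 3)) : 'M[S]_(4, 3) := map_mx psi u.

Lemma mapVE u b l : mapV u b l = psi (u b l). Proof. exact: mxE. Qed.

Fact mapV_prd u v : mapV (mprd r u v) = mprd s (mapV u) (mapV v).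
Proof.
apply/matrixP => b i; rewrite mapVE -psir.
elim/row4_ind: b; rewrite !mprdE /= /mS /mR /mQ /kap !mapVE
  !(rmorphD, rmorphB, rmorphM, rmorph_nat, rmorphN); ring.
Qed.

Fact mapV_form u v : psi (mform r u v) = mform s (mapV u) (mapV v).
Proof.
rewrite /mform -mapV_prd /mtr -psir !mapVE.
rewrite !(rmorphD, rmorphM, rmorph_nat); ring.
Qed.

Fact mapV_linear k u v : mapV (k *: u + v) = psi k *: mapV u + mapV v.
Proof. by apply/matrixP => b i; rewrite !(mapVE, linE) rmorphD rmorphM. Qed.

Fact mapV_gen i e : mapV (gen (model ior r) i e) = gen (model ios s) i e.
Proof.
apply/matrixP => b l; rewrite mapVE /= !ax.unlock !(linE, basE).
rewrite rmorphM rmorphD rmorphM !rmorph_nat psiI /sg.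
by case: (e); rewrite ?rmorphN rmorph1.
Qed.

Definition model_map : ahom (model ior r) (model ios s) :=
  @Ahom K (model ior r) (model ios s) psi mapV psiI mapV_linear mapV_prd mapV_form mapV_gen.

End ModelMap.

Lemma poly_hom (K : realType) (S : comPzRingType) (io : {rmorphism K -> S}) (c : S) :
  injective io -> exists f : {rmorphism {poly K} -> S}, (forall k, f k%:P = io k) /\ f 'X = c.
Proof.
move=> inj; have nz : (1 : S) != 0 by rewrite -(rmorph1 io) -(rmorph0 io) (inj_eq inj) oner_eq0.
(* Polynomial evaluation is stated for nonzero rings; here 1 differs from 0 because [io] is
   injective. *)
pose R : comNzRingType := HB.pack (GRing.ComPzRing.sort S) (GRing.ComPzRing.class S)
  (GRing.PzSemiRing_isNonZero.Build S nz).
pose io' : {rmorphism K -> R} := io.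
have cc : commr_rmorph io' (c : R) by move=> x; apply: mulrC.
pose f : {rmorphism {poly K} -> R} := horner_morph cc.
by exists f; split=> [k|]; [apply: (horner_morphC cc) | apply: (horner_morphX cc)].
Qed.

Definition generic (K : realType) : algebra K := model (@polyC K) 'X.

Lemma generic_class_4A (K : realType) : class_4A (generic K).
Proof. apply: model_class_4A; exact: polyC_inj. Qed.

(** Evaluate X at the parameter [cA4 A] of the target and compose with [universal_hom]. *)
Lemma generic_universal (K : realType) (A : algebra K) :
  class_4A A -> exists F : ahom (generic K) A, True.
Proof.
move=> cA; have [[inj _ _ _] _ _] := cA; have [f [fC fX]] := poly_hom (cA4 A) inj.
by exists (comp_ahom (universal_hom cA) (@model_map K _ _ (@polyC K) (iota A) f 'X _ fC fX)).
Qed.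

(** * The free algebra *)

Section MonomialEvaluation.
Variables (I : choiceType) (S : comNzRingType) (h : I -> S).
Local Open Scope fset_scope.

Definition cmeval (m : {cmonom I}) : S := \prod_(i <- finsupp m) h i ^+ m i.

Lemma cmevalEw (d : {fset I}) (m : {cmonom I}) : finsupp m `<=` d ->
  cmeval m = \prod_(i <- d) h i ^+ m i.
Proof.
move=> le; rewrite /cmeval (big_fset_incl _ le) // => i _ im.
by rewrite (_ : m i = 0%N) // -[LHS]/(m i); apply/eqP; rewrite cmE_eq0.
Qed.

Fact cmeval_morph : mmorphism cmeval.
Proof.
split=> [m n|]; last by rewrite /cmeval mdom1 big_seq_fset0.
rewrite {1}/cmeval mdomD (cmevalEw (fsubsetUl _ (finsupp n))).
rewrite (cmevalEw (fsubsetUr (finsupp m) _)) -big_split /=.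
by apply: eq_bigr => i _; rewrite cmM exprD.
Qed.
HB.instance Definition _ := monalg.isMultiplicative.Build {cmonom I} S cmeval cmeval_morph.

Lemma cmeval_ucm i : cmeval (ucm i) = h i.
Proof. by rewrite /cmeval mdomU big_seq_fset1 cmUU expr1. Qed.
End MonomialEvaluation.

Lemma cmonom_ind (I : choiceType) (P : {cmonom I} -> Prop) : P mone ->
  (forall i m, P m -> P (mmul (ucm i) m)) -> forall m, P m.
Proof.
move=> P1 PM m; have [n] := ubnP (mdeg m); elim: n => // n IH in m *.
have [/mdeg_eq0I -> //|m0] := eqVneq (mdeg m) 0%N.
have [i im] : exists i, i \in finsupp m.
  case: (fset_0Vmem (finsupp m)) => [e|[i im]]; last by exists i.
  by case/eqP: m0; rewrite mdegE e big_seq_fset0.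
have E : m = mmul (ucm i) (divcm m (ucm i)).
  apply/eqP/cmP => j; rewrite cmM cmU divcmE cmU.
  have [<-|_] := eqVneq i j; last by rewrite subn0.
  by rewrite addnC subnK // lt0n cmE_neq0.
by rewrite E mdegM mdegU add1n ltnS => lt; apply/PM/IH.
Qed.

Lemma malgU_scale (R : nzRingType) (X : choiceType) (k : R) (x : X) :
  << k *g x >> = k *: << x >> :> {malg R[X]}.
Proof. by apply/malgP => y; rewrite mcoeffZ !mcoeffU mulr_natr. Qed.

Lemma malg_hom_eq (K : comNzRingType) (I : choiceType) (S : comPzRingType)
  (f g : {rmorphism {malg K[{cmonom I}]} -> S}) :
  (forall k, f (@malgC {cmonom I} K k) = g (@malgC {cmonom I} K k)) ->
  (forall i, f << ucm i >> = g << ucm i >>) -> f =1 g.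
Proof.
move=> fgC fgU u; rewrite [u]monalgE !raddf_sum; apply: eq_bigr => m _ /=.
rewrite malgU_scale -mul_malgC.
have fM x y : f (x * y) = f x * f y by rewrite rmorphM.
have gM x y : g (x * y) = g x * g y by rewrite rmorphM.
rewrite fM gM; congr (_ * _); first exact: fgC.
elim/cmonom_ind: m => [|i m IH]; first exact: etrans (rmorph1 f) (esym (rmorph1 g)).
have -> : << mmul (ucm i) m >> = << ucm i >> * << m >> :> {malg K[{cmonom I}]}.
  by rewrite malgM_def fgmulUU mulr1.
by rewrite fM gM; congr (_ * _); [apply: fgU | apply: IH].
Qed.

(** * Evaluation of the free algebra in the generic model *)

Section MagmaEvaluation.
Local Open Scope quotient_scope.
Variables (K : realType) (B : algebra K).

Fixpoint teval (x : tree) : car B :=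
  match x with Leaf a => gen B a.1 a.2 | Node x y => prd (teval x) (teval y) end.

Lemma teval_eqv x y : tree_eqv x y -> teval x = teval y.
Proof.
elim: x y => [a|x1 IH1 x2 IH2] [b|y1 y2] //=; first by move=> /eqP ->.
case/orP => /andP [/IH1 -> /IH2 ->] //; exact: prdC.
Qed.

Definition meval (x : magma) : car B := teval (repr x).

Lemma meval_pi x : meval (\pi_magma x) = teval x.
Proof. by apply: teval_eqv; apply/(@eqquotP _ tree_eqv magma); rewrite reprK. Qed.
Lemma meval_dot x y : meval (mdot x y) = prd (meval x) (meval y).
Proof. by rewrite meval_pi. Qed.
Lemma meval_gen i e : meval (mgen i e) = gen B i e.
Proof. by rewrite meval_pi. Qed.

Definition peval (p : pair_class) : coef B :=
  form (meval (repr p).1) (meval (repr p).2).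

(** An associating form is constant along [assoc_eqv], so the representative chosen in [peval] does
    not matter. *)
Lemma peval_class x y : (forall u v w : car B, form u (prd v w) = form (prd u v) w) ->
  peval (pclass x y) = form (meval x) (meval y).
Proof.
move=> assoc; rewrite /peval; set p := repr _.
have E : assoc_eqv p (x, y).
  by apply/asboolP/(@eqquotP _ assoc_eqvb pair_class); rewrite reprK.
have: forall p q, assoc_eqv p q ->
    form (meval p.1) (meval p.2) = form (meval q.1) (meval q.2).
  by move=> ? ?; elim=> //= [x' y' z|*]; [rewrite !meval_dot assoc | congruence].
by move=> /(_ _ _ E).
Qed.

End MagmaEvaluation.

Lemma magma_ind (P : magma -> Prop) : (forall i e, P (mgen i e)) ->
  (forall x y, P x -> P y -> P (mdot x y)) -> forall x, P x.
Proof.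
move=> Pg Pd x; rewrite -[x]reprK; elim: (repr x) => [[i e]|y Py z Pz]; first exact: Pg.
by rewrite -mdot_pi; apply: Pd.
Qed.

Section FreeHom.
Local Open Scope quotient_scope.
Variables (K : realType).
Local Notation Mh := (free_algebra K).

(** The generators determine the values on the magma. The indeterminates of the coefficient ring are
    form values of magma elements, so they are determined as well. *)
Lemma free_hom_eq (B : algebra K) (F G : ahom Mh B) : hc F =1 hc G /\ hv F =1 hv G.
Proof.
have FGm x : hv F << x >> = hv G << x >>.
  elim/magma_ind: x => [i e|x y IHx IHy]; first exact: etrans (hvG F i e) (esym (hvG G i e)).
  by rewrite -MprdE -[Mprd _ _]/(@prd K Mh _ _) !hvM IHx IHy.
have FGc : hc F =1 hc G.
  apply: malg_hom_eq => [k|p]; first exact: etrans (hcI F k) (esym (hcI G k)).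
  rewrite -[p]reprK; case: (repr p) => x y; rewrite -[\pi__ _]/(pclass x y).
  rewrite -[<< _ >>]/(lambda K x y) -MformE -[Mform _ _]/(@form K Mh _ _).
  by rewrite !hvF !FGm.
split=> // u; rewrite [u]monalgE !hv_sum; apply: eq_bigr => x _.
rewrite malgU_scale -[_ *: _]/((u@_x : coef Mh) *: (<< x >> : car Mh)).
by rewrite !hvZ FGm FGc.
Qed.

End FreeHom.

Section FreeEvaluation.
Variables (K : realType).
Local Notation Mh := (free_algebra K).
Local Notation B := (generic K).

Let assoc (u v w : car B) : form u (prd v w) = form (prd u v) w.
Proof. by have [[_ _ _ []]] := generic_class_4A K. Qed.

Definition peval_poly (p : pair_class) : {poly K} := @peval K B p.
Definition fc : {rmorphism coef Mh -> coef B} := @mmap _ _ _ (@polyC K) (cmeval peval_poly).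

Lemma fc_lambda x y : fc (lambda K x y) = form (meval B x) (meval B y).
Proof.
have -> : fc (lambda K x y) = 1 * cmeval peval_poly (ucm (pclass x y)) by exact: mmapU.
by rewrite mul1r cmeval_ucm; apply: peval_class.
Qed.
Lemma fc_iota k : fc (iota Mh k) = iota B k.
Proof. exact: mmapC. Qed.

Definition fv (u : car Mh) : car B := \sum_(x <- msupp u) (fc u@_x) *: meval B x.

Lemma fvEw (d : {fset magma}) u : (msupp u `<=` d)%fset ->
  fv u = \sum_(x <- d) (fc u@_x) *: meval B x.
Proof.
move=> le; rewrite /fv (big_fset_incl _ le) // => x _ xu.
by rewrite mcoeff_outdom // rmorph0 scale0r.
Qed.

Lemma fvU x : fv << x >> = meval B x.
Proof. by rewrite (fvEw msuppU_le) big_seq_fset1 mcoeffUU rmorph1 scale1r. Qed.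

Fact fvP k u v : fv (k *: u + v) = fc k *: fv u + fv v.
Proof.
set d := (msupp u `|` msupp v `|` msupp (k *: u + v))%fset.
have du : (msupp u `<=` d)%fset by rewrite /d -fsetUA; apply: fsubsetUl.
have dv : (msupp v `<=` d)%fset by rewrite /d fsetUAC; apply: fsubsetUr.
have dw : (msupp (k *: u + v) `<=` d)%fset by apply: fsubsetUr.
rewrite (fvEw du) (fvEw dv) (fvEw dw).
rewrite scaler_sumr -big_split /=; apply: eq_bigr => x _.
have -> : (k *: u + v)@_x = k * u@_x + v@_x by rewrite mcoeffD mcoeffZ.
by rewrite rmorphD rmorphM scalerDl scalerA.
Qed.

Lemma malg_magma_ind (P : car Mh -> Prop) : P 0 ->
  (forall k u v, P u -> P v -> P (k *: u + v)) -> (forall x, P << x >>) -> forall u, P u.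
Proof.
move=> P0 PP PU u; rewrite [u]monalgE; elim: (enum_fset _) => [|x s IH].
  by rewrite big_nil.
by rewrite big_cons malgU_scale; apply: PP.
Qed.

Lemma fv0 : fv 0 = 0.
Proof. by rewrite /fv msupp0 big_seq_fset0. Qed.

Fact fvM u v : fv (prd u v) = prd (fv u) (fv v).
Proof.
elim/malg_magma_ind: u => [|k u w IHu IHw|x].
- by rewrite prd0l fv0 prd0l.
- by rewrite (fvP k u w) (@prdP K B) (@prdP K Mh) fvP; congr (_ *: _ + _).
elim/malg_magma_ind: v => [|k u w IHu IHw|y].
- by rewrite prd0r fv0 prd0r.
- rewrite (fvP k u w) (@prdDr K B) (@prdZr K B) (@prdDr K Mh) (@prdZr K Mh) fvP.
  by congr (_ *: _ + _).
- by rewrite -[prd _ _]/(Mprd _ _) MprdE !fvU meval_dot.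
Qed.

Fact fvF u v : fc (form u v) = form (fv u) (fv v).
Proof.
elim/malg_magma_ind: u => [|k u w IHu IHw|x].
- by rewrite form0l fv0 form0l rmorph0.
- rewrite (fvP k u w) (@formPl K B) (@formPl K Mh) rmorphD rmorphM.
  by congr (_ * _ + _).
elim/malg_magma_ind: v => [|k u w IHu IHw|y].
- by rewrite form0r fv0 form0r rmorph0.
- rewrite (fvP k u w) (@formPr K B) (@formPr K Mh) rmorphD rmorphM.
  by congr (_ * _ + _).
- by rewrite -[form _ _]/(Mform _ _) MformE !fvU fc_lambda.
Qed.

Fact fvG i e : fv (gen Mh i e) = gen B i e.
Proof. by rewrite fvU meval_gen. Qed.

Definition free_eval : ahom Mh B := @Ahom K Mh B fc fv fc_iota fvP fvM fvF fvG.

End FreeEvaluation.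

Lemma inj_surj_bijective (T U : Type) (f : T -> U) :
  injective f -> (forall y, exists x, f x = y) -> bijective f.
Proof.
move=> inj surj; pose g y := projT1 (cid (surj y)).
have fg : cancel g f by move=> y; apply: projT2 (cid (surj y)).
by exists g => // x; apply: inj; rewrite fg.
Qed.


Lemma hv_surj (K : realType) (A B : algebra K) (F : ahom A B) :
  (forall r, exists s, hc F s = r) -> (forall v, generated_by (@axes K B) v) ->
  forall v, exists u, hv F u = v.
Proof.
move=> cs gB v; apply: (gB v (fun v => exists u, hv F u = v)).
  split=> [|r u w [u' <-] [w' <-]|u w [u' <-] [w' <-]]; first by exists 0; rewrite hv0.
  - by have [s <-] := cs r; exists (s *: u' + w'); rewrite hvP.
  - by exists (prd u' w'); rewrite hvM.
by move=> _ [i [e ->]]; exists (gen A i e); rewrite hvG.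
Qed.

Lemma hc_cA4 (K : realType) (A B : algebra K) (F : ahom A B) : hc F (cA4 A) = cA4 B.
Proof. by rewrite /cA4 rmorphM rmorph_nat hvF hvM !hvD !hvG. Qed.

Section ModelInvariants.
Variables (K : realType) (S : comPzRingType) (io : {rmorphism K -> S}) (c : S).
Local Notation N := (model io c).

Let inv n (k : K) : k * n.+1%:R = 1 -> io k * n.+1%:R = 1.
Proof. by move=> E; rewrite -(rmorph_nat io) -rmorphM E rmorph1. Qed.

Lemma model_sA i : sA N i = io (1 / 16) *: (bas S rS i : car N).
Proof.
rewrite /sA /= -scalerDr axD scalerA; congr (_ *: _).
rewrite -(rmorph_nat io) -rmorphM; congr (io _). by field.
Qed.

Lemma form_SSS i : mform c (bas S rS i) (mprd c (bas S rS (nxt i)) (bas S rS (nxt (nxt i)))) = 128 * c.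
Proof.
have := mprd_SS c (nxt i); rewrite nxt3 => ->.
rewrite (mformE c i) /= /kap ?nxt3 !scE !basE.
by rewrite ?eqxx ?basN ?nxt_neq ?nxt2_neq /=; ring.
Qed.

Lemma model_cA4 : cA4 N = c.
Proof.
rewrite /cA4 !model_sA (@prdZl K N) (@formZl K N).
rewrite [@prd K N _ _](@prdC K N) (@prdZl K N) !(@formZr K N) (@prdC K N).
rewrite -[@form K N _ _]/(mform c _ (mprd c _ _)) form_SSS.
rewrite (_ : 32 * _ = (io (1 / 16) * 16) * (io (1 / 16) * 16) * (io (1 / 16) * 16) * c); last ring.
by rewrite inv ?mul1r //; field.
Qed.

Lemma mform_ax_v4_opp i e : mform c (ax S i e) (v4 S (nxt i)) = 64 * (1 - c).
Proof.
rewrite (mformE c i) /= /kap ?nxt3 !axE !v4E ?nxt3 ?eqxx ?basN ?nxt_neq ?nxt2_neq /=.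
ring.
Qed.

Lemma model_t : injective io -> 12 * form (gen N 0 true) (v_4A N (nxt 0) (nxt (nxt 0))) = 1 - c.
Proof.
move=> inj; rewrite -(type_4A_v (model_type_4A io c (nxt 0))).
rewrite [gen N 0 true]/(io (1 / 32) *: ax S 0 true : car N).
rewrite (@formZZ K N) -[@form K N _ _]/(mform c _ _) mform_ax_v4_opp.
rewrite (_ : 12 * _ = (io (1 / 32) * 32) * (io (1 / 24) * 24) * (1 - c)); last ring.
by rewrite !inv ?mul1r //; field.
Qed.
End ModelInvariants.

(** * Identification of the universal algebra and of M(t) *)

Section Identification.
Variable K : realType.
Local Notation Mh := (free_algebra K).

(** The variable X is reached because it is the invariant [cA4] of the generic model, a form value
    of elements built from the generators. *)
Lemma free_eval_hc_surj (p : coef (generic K)) : exists r, hc (free_eval K) r = p.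
Proof.
have X : hc (free_eval K) (cA4 Mh) = 'X by rewrite hc_cA4; apply: model_cA4.
move: p; elim/(@poly_ind K) => [|p k [r Er]]; first by exists 0; rewrite rmorph0.
by exists (r * cA4 Mh + iota Mh k); rewrite rmorphD rmorphM X Er hcI.
Qed.

Lemma free_eval_hv_surj v : exists u, hv (free_eval K) u = v.
Proof.
apply: hv_surj; first exact: free_eval_hc_surj.
by have [[_ _ ]] := generic_class_4A K.
Qed.

Lemma ker_hom_bij (A B : algebra K) (F : ahom A B) :
  (forall r, exists s, hc F s = r) -> (forall v, exists u, hv F u = v) ->
  bijective (hc (ker_hom F)) /\ bijective (hv (ker_hom F)).
Proof.
move=> cs vs; split; apply: inj_surj_bijective.
- exact: ker_hc_inj.
- by move=> r; have [s <-] := cs r; exists (hc (pi_hom (ker_pair F)) s); apply: ker_hc_pi.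
- exact: ker_hv_inj.
- by move=> v; have [u <-] := vs v; exists (hv (pi_hom (ker_pair F)) u); apply: ker_hv_pi.
Qed.

(** The kernel belongs to the class since its quotient is isomorphic to the generic model. It lies
    below every other pair Q of the class: the projection to the quotient by Q agrees, by
    uniqueness, with a map factoring through the generic model. *)
Lemma pair_4AE : pair_4A K = ker_pair (free_eval K).
Proof.
have CP : in_class_4A (ker_pair (free_eval K)).
  split; first by move=> /= /eqP; rewrite rmorph1 oner_eq0.
  have [bc bv] := ker_hom_bij free_eval_hc_surj free_eval_hv_surj.
  have [G [FcK GcK FvK GvK]] := inverse_ahom bc bv.
  exact: (iso_class_4A FcK GcK FvK GvK (generic_class_4A K)).
have le Q : in_class_4A Q -> le_pair (ker_pair (free_eval K)) Q.
  move=> [_ cQ]; have [G _] := generic_universal cQ.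
  have [Ec Ev] := free_hom_eq (comp_ahom G (free_eval K)) (pi_hom Q).
  split=> [x Fx|r Fr].
    have /pi_carE : hv (pi_hom Q) x = hv (pi_hom Q) 0.
      by rewrite -Ev hv0 -[LHS]/(hv G (hv (free_eval K) x)) Fx hv0.
    by rewrite subr0.
  have /pi_coefE : hc (pi_hom Q) r = hc (pi_hom Q) 0.
    by rewrite -Ec rmorph0 -[LHS]/(hc G (hc (free_eval K) r)) Fr rmorph0.
  by rewrite subr0.
apply: ideal_pair_eq; apply/seteqP; split=> x.
- exact.
- by move=> Fx Q /le [+ _]; apply.
- exact.
- by move=> Fr Q /le [_ +]; apply.
Qed.

Lemma M4A_generic : exists F : ahom (M4A K) (generic K), bijective (hc F) /\ bijective (hv F).
Proof.
rewrite /M4A pair_4AE; exists (ker_hom (free_eval K)).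
exact: ker_hom_bij free_eval_hc_surj free_eval_hv_surj.
Qed.

Definition real_model (c : K) : algebra K := model (idfun : {rmorphism K -> K}) c.

Lemma real_model_class c : class_4A (real_model c).
Proof. by apply: model_class_4A => x y. Qed.

Definition specialise (c : K) : ahom (generic K) (real_model c) :=
  @model_map K _ _ (@polyC K) idfun (horner_eval c) 'X c (fun k => hornerC k c) (hornerX c).

(** The kernel of evaluation at c consists of the multiples of X - c, coordinate by coordinate, and
    t_4A - t corresponds to X - c up to the unit -1/12. Dividing by t_4A - t is therefore evaluating
    X at c. *)
Lemma M_at_model (t : K) : exists F : ahom (M_at t) (real_model (1 - 12 * t)),
  bijective (hc F) /\ bijective (hv F).
Proof.
set c := 1 - 12 * t; have [F [Fc Fv]] := M4A_generic.
pose H := comp_ahom (specialise c) F.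
have [G [FcK GcK FvK GvK]] := inverse_ahom Fc Fv.
have n0 : nxt 0 = 1 by rewrite nxt.unlock; apply: val_inj.
have n1 : nxt 1 = 2%:R by rewrite nxt.unlock; apply: val_inj.
have Ht : hc F (t_4A K - iota (M4A K) t) = (1 / 12 : K)%:P * ('X - c%:P) * -1.
  rewrite rmorphB hvF hvG hv_v_4A hcI.
  have := @model_t K _ (@polyC K) 'X (@polyC_inj K); rewrite n0 n1 => E.
  set f := form _ _; have {}E : 12 * f = 1 - 'X := E.
  have -> : f = (1 / 12 : K)%:P * (1 - 'X).
    rewrite -E mulrA -[12]/(12%:R) -(rmorph_nat (@polyC K)) -rmorphM.
    by rewrite (_ : 1 / 12 * 12 = 1) ?rmorph1 ?mul1r //; field.
  have -> : iota (generic K) t = (1 / 12 : K)%:P * (1 - c%:P).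
    rewrite -[LHS]/(t%:P) -(polyC1 K) -polyCB -polyCM; congr (_%:P).
    by rewrite /c; field.
  by ring.
have k12 : (1 / 12 : K)%:P * 12%:P = 1.
  by rewrite -polyCM (_ : 1 / 12 * 12 = 1 :> K) ?polyC1 //; field.
(* The factor -12 undoes the unit -1/12 relating t_4A - t to X - c. *)
have fac (p : {poly K}) : p.[c] = 0 ->
    p = hc F (t_4A K - iota (M4A K) t) * (- 12%:P * (p %/ ('X - c%:P))).
  move=> /eqP; rewrite -[_ == _]/(root p c) root_factor_theorem => /divpK E.
  rewrite Ht; move: (p %/ _) E => q <-; rewrite -[LHS]mul1r -{1}k12; ring.
have e : mult_pair (t_4A K - iota (M4A K) t) = ker_pair H.
  have Hs : hc H (t_4A K - iota (M4A K) t) = 0.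
    rewrite -[LHS]/((hc F _).[c]) Ht !hornerM hornerXsubC subrr mulr0 mul0r //.
  apply: ideal_pair_eq; apply/seteqP; split.
  - by move=> x [y ->]; rewrite /= -[LHS]/(hv H _) hvZ Hs scale0r.
  - move=> x Hx; pose M : 'M[{poly K}]_(4, 3) := map_mx (fun p => - 12%:P * (p %/ ('X - c%:P))) (hv F x).
    exists (hv G M); apply: (can_inj FvK); rewrite hvZ GvK.
    apply/matrixP => b l; rewrite mxE [M b l]mxE; apply: fac.
    by have := congr1 (fun u : 'M[K]_(4, 3) => u b l) Hx; rewrite !mxE.
  - by move=> r [q ->]; rewrite /= -[LHS]/(hc H _) rmorphM Hs mul0r.
  - move=> r Hr; exists (hc G (- 12%:P * (hc F r %/ ('X - c%:P)))); apply: (can_inj FcK).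
    by rewrite rmorphM GcK; apply: fac.
rewrite /M_at e; exists (ker_hom H); apply: ker_hom_bij.
  by move=> r; exists (hc G r%:P); rewrite /= GcK; apply: hornerC.
apply: hv_surj.
  by move=> r; exists (hc G r%:P); rewrite /= GcK; apply: hornerC.
by have [[_ _ ]] := real_model_class c.
Qed.
End Identification.

(** * Positivity and Norton's inequality *)

Lemma sum3 (R : nmodType) (F : 'I_3 -> R) :
  \sum_i F i = F 0 + F (nxt 0) + F (nxt (nxt 0)).
Proof.
rewrite !big_ord_recl big_ord0 addr0 addrA; congr (_ + F _ + F _);
  by rewrite nxt.unlock; apply: val_inj.
Qed.

(* An even element is [\sum_ij X_ij |v_i><v_j|] for vectors [v_i] with Gram   *)
(* matrix [gram / 4]; [w] is the phase of the product of the inner products   *)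
(* <v_i|v_(i+1)>.                                                             *)
Section HermitianModel.
Local Open Scope complex_scope.
Variables (K : realType) (c : K) (w : K[i]).
Local Notation w' := (2 * c%:C - w).
Hypothesis ww : w * w = 2 * c%:C * w - 1.
Local Notation V := 'M[K]_(4, 3).
Local Notation "x ** y" := (mprd c x y) (at level 40, left associativity).
Local Notation even u := (forall l, u rD l = 0).
Implicit Types (u v x y : V).

(** Rescaling the v_i by unit scalars preserves only the phase of the cyclic product of the inner
    products, so all of it is placed on one edge. *)
Definition phase (i : 'I_3) : K[i] := if i == nxt (nxt 0) then w else 1.
Definition phase' (i : 'I_3) : K[i] := if i == nxt (nxt 0) then w' else 1.
Definition gram : 'M[K[i]]_3 := \matrix_(i, j)
  if j == i then 4 else if j == nxt i then phase i else phase' j.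
Definition herm u : 'M[K[i]]_3 := \matrix_(i, j)
  if j == i then 16 * (u rS i)%:C
  else if j == nxt i then 16 * phase i * ((u rR (nxt j))%:C + w' * (u rQ (nxt j))%:C)
  else 16 * phase' j * ((u rR (nxt i))%:C + w * (u rQ (nxt i))%:C).

Lemma matrix3_ext (A B : 'M[K[i]]_3) : (forall i, [/\ A i i = B i i,
  A i (nxt i) = B i (nxt i) & A (nxt i) i = B (nxt i) i]) -> A = B.
Proof.
move=> E; apply/matrixP => i j; have [E1 E2 _] := E i.
case: (ord3_cases i j) => -> //; have [_ _] := E (nxt (nxt i)).
by rewrite nxt3.
Qed.

(** This is the Jordan product: for operators with coefficient matrices X and Y in the v_i, (xy +
    yx) / 2 has matrix (XGY + YGX) / 8, as G = [gram] is four times the Gram matrix. *)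
Lemma herm_prd u v : even u -> even v ->
  8 *: herm (u ** v) = herm u *m gram *m herm v + herm v *m gram *m herm u.
Proof.
move=> u0 v0; apply: matrix3_ext => i.
case: (ord3_cases 0 i) => ->; split; rewrite !mxE !sum3 !mxE !sum3 !mxE
  ?nxt3 ?(eqxx, basN, nxt_neq, nxt2_neq) /phase /phase' ?nxt3 ?(eqxx, basN, nxt_neq, nxt2_neq) /=
  !mprdE /= /mS /mR /mQ ?nxt3 ?u0 ?v0; ring: ww.
Qed.
End HermitianModel.

Definition adj (K : realType) (X : 'M[K[i]]_3) := map_mx Num.conj X^T.

Section HermitianForm.
Local Open Scope complex_scope.
Variables (K : realType) (c : K) (w : K[i]).
Local Notation w' := (2 * c%:C - w).
Hypothesis ww : w * w = 2 * c%:C * w - 1.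
Hypothesis wJ : w^*%R = w'.
Local Notation V := 'M[K]_(4, 3).
Local Notation even u := (forall l, u rD l = 0).
Local Notation herm := (herm c w).
Local Notation gram := (gram c w).
Implicit Types (u v x y : V) (X Y H : 'M[K[i]]_3).

Lemma conj_realC (k : K) : (k%:C)^*%R = k%:C.
Proof. exact: conjc_real. Qed.

Lemma conj_w' : (w')^*%R = w.
Proof. by rewrite rmorphB rmorphM rmorph_nat /= wJ conj_realC; ring. Qed.

Lemma adjM X Y : adj (X *m Y) = adj Y *m adj X.
Proof. by rewrite /adj trmx_mul map_mxM. Qed.
Lemma adjK X : adj (adj X) = X.
Proof. by apply/matrixP => i j; rewrite !mxE conjCK. Qed.

Lemma gram_adj : adj gram = gram.
Proof.
apply: matrix3_ext => i; split; rewrite !mxE ?(eqxx, basN, nxt_neq, nxt2_neq) ?rmorph_nat //;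
  rewrite /phase /phase'; case: eqP => _; rewrite ?rmorph1 ?wJ ?conj_w' //.
Qed.

Lemma herm_adj u : adj (herm u) = herm u.
Proof.
have pJ i : (phase w i)^*%R = phase' c w i by rewrite /phase /phase'; case: eqP => _; rewrite ?rmorph1.
have pJ' i : (phase' c w i)^*%R = phase w i by rewrite -pJ conjCK.
apply: matrix3_ext => i; split; rewrite !mxE ?(eqxx, basN, nxt_neq, nxt2_neq);
  rewrite !(rmorphM, rmorphD, rmorphN, rmorph_nat) /= ?conj_realC ?wJ ?pJ ?pJ'; ring.
Qed.

(** The form is 2 tr(xy), and tr(xy) = tr(XGYG) / 16. *)
Lemma herm_tr u v : even u -> even v ->
  8 * (mform c u v)%:C = \tr (herm u *m gram *m (herm v *m gram)).
Proof.
move=> u0 v0; rewrite (mformE c 0) /= /kap ?nxt3 ?u0 ?v0.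
rewrite /mxtrace !sum3 !mxE !sum3 !mxE !sum3 !mxE.
rewrite ?nxt3 ?(eqxx, basN, nxt_neq, nxt2_neq) /phase /phase' ?nxt3 ?(eqxx, basN, nxt_neq, nxt2_neq) /=.
ring: ww.
Qed.

Definition pivots : 'rV[K[i]]_3 := \row_i
  if i == 0 then 4 else if i == nxt 0 then 15 / 4 else ((52 + 2 * c) / 15)%:C.
Definition unitri : 'M[K[i]]_3 := \matrix_(i, j)
  if j == i then 1 else if i == 0 then (if j == nxt 0 then 1 / 4 else w' / 4)
  else if (i == nxt 0) && (j == nxt (nxt 0)) then (4 - w') / 15 else 0.

(** The leading minors of [gram] are 4, 15 and 52 + 2 c, whence the pivots. They stay positive at c
    = 1 and c = -1: the form degenerates there because [herm] loses injectivity, not because the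
    Hermitian space degenerates. *)
Lemma gram_LDL : gram = adj unitri *m diag_mx pivots *m unitri.
Proof.
rewrite mul_mx_diag; apply: matrix3_ext => i.
case: (ord3_cases 0 i) => ->; split; rewrite !mxE !sum3 !mxE
  ?nxt3 ?(eqxx, basN, nxt_neq, nxt2_neq) /phase /phase' ?nxt3 ?(eqxx, basN, nxt_neq, nxt2_neq) /=;
  rewrite ?(rmorph0, rmorph1, fmorph_div, rmorph_nat, rmorphB, rmorphM) /= ?conj_realC ?wJ; by field: ww.
Qed.

End HermitianForm.

(** * Commutators, positivity and Norton's inequality on even elements *)

(** Cyclicity of the trace reduces the left side to 2 tr(AABB) - 2 tr(ABAB), which is minus the
    trace of the squared commutator. The factor 'i absorbs the sign and makes the commutator of
    Hermitian matrices Hermitian. *)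
Lemma trace_commutator_sq (C : numClosedFieldType) n (A B : 'M[C]_n) :
  \tr ((A *m A + A *m A) *m (B *m B + B *m B)) - \tr ((A *m B + B *m A) *m (A *m B + B *m A))
  = \tr ('i *: (A *m B - B *m A) *m ('i *: (A *m B - B *m A))).
Proof.
have E1 : \tr (A *m B *m (B *m A)) = \tr (A *m A *m (B *m B)).
  by rewrite mulmxA [LHS]mxtrace_mulC !mulmxA.
have E2 : \tr (B *m A *m (A *m B)) = \tr (A *m A *m (B *m B)).
  by rewrite mxtrace_mulC E1.
have E3 : \tr (B *m A *m (B *m A)) = \tr (A *m B *m (A *m B)).
  by rewrite -mulmxA mxtrace_mulC !mulmxA.
rewrite -scalemxAl -scalemxAr scalerA mulCii scaleN1r.
have tN (M : 'M[C]_n) : \tr (- M) = - \tr M by rewrite -scaleN1r mxtraceZ mulN1r.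
rewrite !(mulmxDl, mulmxDr, mulNmx, mulmxN) !(mxtraceD, tN) E1 E2 E3.
ring.
Qed.

Lemma norton_trace (C : numClosedFieldType) n (X Y G : 'M[C]_n) :
  \tr ((X *m G *m X + X *m G *m X) *m G *m ((Y *m G *m Y + Y *m G *m Y) *m G))
  - \tr ((X *m G *m Y + Y *m G *m X) *m G *m ((X *m G *m Y + Y *m G *m X) *m G))
  = \tr ('i *: (X *m G *m Y - Y *m G *m X) *m G *m ('i *: (X *m G *m Y - Y *m G *m X) *m G)).
Proof.
have E U W : (U *m G *m W + W *m G *m U) *m G = U *m G *m (W *m G) + W *m G *m (U *m G).
  by rewrite mulmxDl !mulmxA.
have -> : 'i *: (X *m G *m Y - Y *m G *m X) *m G = 'i *: (X *m G *m (Y *m G) - Y *m G *m (X *m G)).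
  by rewrite -scalemxAl mulmxBl !mulmxA.
by rewrite !E trace_commutator_sq.
Qed.

Section HermitianPositivity.
Local Open Scope complex_scope.
Variables (K : realType) (c : K) (w : K[i]).
Local Notation w' := (2 * c%:C - w).
Hypothesis ww : w * w = 2 * c%:C * w - 1.
Hypothesis wJ : w^*%R = w'.
Local Notation V := 'M[K]_(4, 3).
Local Notation "x ** y" := (mprd c x y) (at level 40, left associativity).
Local Notation even u := (forall l, u rD l = 0).
Local Notation herm := (herm c w).
Local Notation gram := (gram c w).
Implicit Types (u v x y : V) (X Y H : 'M[K[i]]_3).

Lemma trace_diag_sq H (d : 'rV[K[i]]_3) :
  \tr (H *m diag_mx d *m (H *m diag_mx d)) = \sum_i \sum_j d 0 i * d 0 j * (H i j * H j i).
Proof.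
rewrite !mul_mx_diag /mxtrace; apply: eq_bigr => i _; rewrite mxE.
by apply: eq_bigr => j _; rewrite !mxE; ring.
Qed.

Hypothesis cb : -1 <= c <= 1.

Lemma pivots_gt0 i : 0 < pivots c 0 i.
Proof.
rewrite mxE; case: eqP => _ //; case: eqP => _; first by rewrite divr_gt0.
by rewrite -[0]/(0%:C) ltcR; case/andP: cb => c0 c1; lra.
Qed.

Definition conj_unitri X := unitri c w *m X *m adj (unitri c w).

(** With [gram] = A' D A, where A' is the adjoint of A, cyclicity turns X into H = A X A'. For
    Hermitian X the summands are products of pivots with |H_ij|^2. *)
Lemma trace_gram X : \tr (X *m gram *m (X *m gram)) =
  \sum_i \sum_j pivots c 0 i * pivots c 0 j * (conj_unitri X i j * conj_unitri X j i).
Proof.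
set A := unitri c w; set D := diag_mx (pivots c).
rewrite -trace_diag_sq (gram_LDL ww wJ) /conj_unitri -/A -/D.
rewrite (_ : X *m _ *m _ = (X *m adj A *m D *m A *m X *m adj A *m D) *m A).
  by rewrite mxtrace_mulC !mulmxA.
by rewrite !mulmxA.
Qed.

Lemma conj_unitri_adj X : adj X = X -> adj (conj_unitri X) = conj_unitri X.
Proof. by move=> X0; rewrite /conj_unitri !adjM adjK X0 mulmxA. Qed.

Lemma conj_unitri_eq0 X : conj_unitri X = 0 -> X = 0.
Proof.
move=> E; pose A := unitri c w.
have H (B : 'M[K[i]]_3) : A *m B = 0 -> B = 0.
  move=> AB; have e i j : (A *m B) i j = 0 by rewrite AB mxE.
  have b2 j : B (nxt (nxt 0)) j = 0.
    have := e (nxt (nxt 0)) j; rewrite !mxE !sum3 !mxE ?nxt3 ?(eqxx, basN, nxt_neq, nxt2_neq) /=.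
    by rewrite !mul0r !add0r mul1r.
  have b1 j : B (nxt 0) j = 0.
    have := e (nxt 0) j; rewrite !mxE !sum3 !mxE ?nxt3 ?(eqxx, basN, nxt_neq, nxt2_neq) /=.
    by rewrite b2 mul0r mulr0 add0r addr0 mul1r.
  have b0 j : B 0 j = 0.
    have := e 0 j; rewrite !mxE !sum3 !mxE ?nxt3 ?(eqxx, basN, nxt_neq, nxt2_neq) /=.
    by rewrite b1 b2 !mulr0 !addr0 mul1r.
  by apply/matrixP => i j; rewrite mxE; case: (ord3_cases 0 i) => ->.
have /H {}E : A *m (X *m adj A) = 0 by rewrite mulmxA.
have : A *m adj X = 0 by rewrite -[A]adjK -adjM E; apply/matrixP => i j; rewrite !mxE rmorph0.
by move=> /H X0; rewrite -[X]adjK X0; apply/matrixP => i j; rewrite !mxE rmorph0.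
Qed.

Lemma trace_gram_ge0 X : adj X = X -> 0 <= \tr (X *m gram *m (X *m gram)).
Proof.
move=> /conj_unitri_adj HX; rewrite trace_gram.
apply: sumr_ge0 => i _; apply: sumr_ge0 => j _.
apply: mulr_ge0; first by apply: mulr_ge0; apply/ltW/pivots_gt0.
by rewrite -{2}HX !mxE mul_conjC_ge0.
Qed.

Lemma trace_gram_eq0 X : adj X = X -> \tr (X *m gram *m (X *m gram)) = 0 -> X = 0.
Proof.
move=> /conj_unitri_adj HX; rewrite trace_gram => T; apply: conj_unitri_eq0.
have ge i j : 0 <= pivots c 0 i * pivots c 0 j * (conj_unitri X i j * conj_unitri X j i).
  apply: mulr_ge0; first by apply: mulr_ge0; apply/ltW/pivots_gt0.
  by rewrite -{2}HX !mxE mul_conjC_ge0.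
apply/matrixP => i j; rewrite [RHS]mxE.
have T1 : \sum_j pivots c 0 i * pivots c 0 j * (conj_unitri X i j * conj_unitri X j i) = 0.
  by apply: (psumr_eq0P _ T) => // k _; apply: sumr_ge0.
have /eqP : pivots c 0 i * pivots c 0 j * (conj_unitri X i j * conj_unitri X j i) = 0.
  by apply: (psumr_eq0P _ T1).
rewrite !mulf_eq0 !(gt_eqF (pivots_gt0 _)) /=.
have -> : conj_unitri X j i = (conj_unitri X i j)^*%R by rewrite -{1}HX !mxE.
by rewrite conjC_eq0 orbb => /eqP.
Qed.

Lemma form_even_ge0 u : even u -> 0 <= mform c u u.
Proof.
move=> u0; have := trace_gram_ge0 (herm_adj wJ u).
by rewrite -herm_tr // pmulr_rge0 // -[0]/(0%:C) lecR.
Qed.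

Lemma form_even_eq0 u : even u -> mform c u u = 0 -> herm u = 0.
Proof.
move=> u0 E; apply: trace_gram_eq0; first exact: herm_adj.
by rewrite -herm_tr // E rmorph0 mulr0.
Qed.

Lemma even_prd u v : even u -> even v -> even (u ** v).
Proof. by move=> u0 v0 l; rewrite mprdE /= u0 v0 !mul0r addr0. Qed.

Definition norton_gap u v : K := mform c (u ** u) (v ** v) - mform c (u ** v) (u ** v).

(* With X, Y the Hermitian matrices of u, v, the Norton difference is a       *)
(* positive multiple of the squared norm of their commutator.                 *)
Lemma norton_even u v : even u -> even v -> 0 <= norton_gap u v.
Proof.
move=> u0 v0; pose X := herm u; pose Y := herm v.
pose Z := X *m gram *m Y - Y *m gram *m X.
have iZ : adj ('i *: Z) = 'i *: Z.
  have adjE (B : 'M[K[i]]_3) i j : adj B i j = (B j i)^*%R by rewrite mxE mxE.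
  have adjB (A B : 'M[K[i]]_3) : adj (A - B) = adj A - adj B.
    apply/matrixP => k l; rewrite !adjE [X in X^*%R = _]mxE [RHS]mxE [(- adj B) k l]mxE.
    by rewrite [X in (_ + X)^*%R]mxE rmorphB !adjE.
  have ZJ : adj Z = - Z.
    by rewrite adjB !adjM (gram_adj wJ) !(herm_adj wJ) !mulmxA opprB.
  have sE (k : K[i]) (B : 'M[K[i]]_3) i j : (k *: B) i j = k * B i j by rewrite mxE.
  apply/matrixP => i j; rewrite adjE !sE rmorphM /= conjCi.
  by rewrite -adjE ZJ [(- Z) i j]mxE mulrNN.
have Epos := trace_gram_ge0 iZ.
have uv0 := even_prd u0 v0.
(* The factor 512 is 8 from [herm_tr] times 64 from the two scalings by 8 that [herm_prd] needs. *)
have T x y : even x -> even y -> 512 * (mform c x y)%:C =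
    \tr (8 *: herm x *m gram *m (8 *: herm y *m gram)).
  move=> x0 y0; rewrite -!scalemxAl -scalemxAr scalerA mxtraceZ -herm_tr // mulrA.
  by congr (_ * _); ring.
have E : 512 * (norton_gap u v)%:C = \tr ('i *: Z *m gram *m ('i *: Z *m gram)).
  rewrite /norton_gap rmorphB mulrBr !T //; try exact: even_prd.
  rewrite !(herm_prd ww) // -/X -/Y.
  exact: norton_trace.
have : 0 <= 512 * (norton_gap u v)%:C by rewrite E.
by rewrite pmulr_rge0 // -[0]/(0%:C) lecR.
Qed.
End HermitianPositivity.

(** * Reduction of Norton's inequality to even elements *)

Section NortonInequality.
Variables (K : realType) (c : K).
Local Notation V := 'M[K]_(4, 3).
Local Notation "x ** y" := (mprd c x y) (at level 40, left associativity).
Local Notation even u := (forall l, u rD l = 0).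
Local Notation kap := (kap c).
Implicit Types (u v x y : V).

Definition even_part u : V := \matrix_(b, l) if b == rD then 0 else u b l.
Definition add_SD x (f g : 'I_3 -> K) : V :=
  \matrix_(b, l) if b == rD then g l else if b == rS then x rS l + f l else x b l.

Lemma even_partE u : even (even_part u). Proof. by move=> l; rewrite mxE. Qed.

Lemma prd_split u v : let x := even_part u in let y := even_part v in
  u ** v = add_SD (x ** y) (fun l => 16 * (u rD l * v rD l))
             (fun l => u rD l * kap y l + v rD l * kap x l).
Proof.
move=> x y; apply/matrixP => b i; rewrite mxE.
by elim/row4_ind: b; rewrite !mprdE /= /mS /mR /mQ /kap /x /y !mxE /=; ring.
Qed.

Lemma form_add_SD x y f g f' g' : even x -> even y ->
  mform c (add_SD x f g) (add_SD y f' g') = mform c x y +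
    \sum_l (32 * (f l * kap y l + f' l * kap x l)
            + 32 * (f l * (16 * f' l + f' (nxt l) + f' (nxt (nxt l)))) + 512 * (g l * g' l)).
Proof.
move=> x0 y0; rewrite !(mformE c 0) !sum3 /= /kap !mxE /= ?nxt3 !x0 !y0; ring.
Qed.

Lemma form_split u : mform c u u = mform c (even_part u) (even_part u) + 512 * \sum_l u rD l ^+ 2.
Proof.
by rewrite !(mformE c 0) !sum3 /= /kap !mxE /= ?nxt3; ring.
Qed.

(** The Cauchy-Schwarz excess <v_i|x^2|v_i> - <v_i|x|v_i>^2 is itself a Norton difference of even
    elements, for x and S_i, so its sign is known from [norton_even]. *)
Lemma kap_gap i x : even x ->
  512 * (kap (x ** x) i - kap x i ^+ 2) = 2 * norton_gap c x (bas K rS i).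
Proof.
move=> x0; rewrite /norton_gap mprd_SSd.
have ZR k u v : mform c u (k *: v) = k * mform c u v.
  by rewrite -[_ *: _]addr0 mformPr (_ : mform c u 0 = 0) ?addr0 //; apply: (form0r (A := real_model c)).
rewrite ZR [x ** bas _ _ _]mprdC.
rewrite !(mformE c i) /= /kap !basE ?nxt3 ?(eqxx, basN, nxt_neq, nxt2_neq) /=.
rewrite !(mprd_S c i) !mprdE /= /mS /mR /mQ /kap ?nxt3 !x0; ring.
Qed.
End NortonInequality.

Section Norton.
Local Open Scope complex_scope.
Variables (K : realType) (c : K).
Local Notation V := 'M[K]_(4, 3).
Local Notation "x ** y" := (mprd c x y) (at level 40, left associativity).
Local Notation even u := (forall l, u rD l = 0).
Local Notation kap := (kap c).
Implicit Types (u v x y : V).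

Lemma kap_comb a b x y i : let z := a *: x - b *: y in
  kap z i = a * kap x i - b * kap y i /\
  kap (z ** z) i = a ^+ 2 * kap (x ** x) i - 2 * (a * b) * kap (x ** y) i + b ^+ 2 * kap (y ** y) i.
Proof.
have kD u v : kap (u + v) i = kap u i + kap v i by rewrite /kap !linE; ring.
have kZ k u : kap (k *: u) i = k * kap u i by rewrite /kap !linE; ring.
split; first by rewrite -scaleNr kD !kZ mulNr.
rewrite -scaleNr.
have mD u v u' : (u + v) ** u' = u ** u' + v ** u' := prdDl (A := real_model c) u v u'.
have mDr u v u' : u' ** (u + v) = u' ** u + u' ** v := prdDr (A := real_model c) u v u'.
have mZ k u v : (k *: u) ** v = k *: (u ** v) := prdZl (A := real_model c) k u v.
have mZr k u v : u ** (k *: v) = k *: (u ** v) := prdZr (A := real_model c) k u v.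
rewrite !(mD, mDr) !(mZ, mZr) !(kD, kZ) (mprdC c y x); ring.
Qed.

(** The polynomial identity behind [norton_gap_split]: [P], [Q], [M], [k], [h] stand for the values
    of [kap] at x^2, y^2, xy, x, y, and [a], [b] for the D coordinates. *)
Lemma norton_sum (a b P Q M k h : 'I_3 -> K) :
  \sum_l (32 * (16 * (a l * a l) * Q l + 16 * (b l * b l) * P l)
     + 32 * (16 * (a l * a l) * (16 * (16 * (b l * b l)) + 16 * (b (nxt l) * b (nxt l))
         + 16 * (b (nxt (nxt l)) * b (nxt (nxt l)))))
     + 512 * ((a l * k l + a l * k l) * (b l * h l + b l * h l)))
  - \sum_l (32 * (16 * (a l * b l) * M l + 16 * (a l * b l) * M l)
     + 32 * (16 * (a l * b l) * (16 * (16 * (a l * b l)) + 16 * (a (nxt l) * b (nxt l))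
         + 16 * (a (nxt (nxt l)) * b (nxt (nxt l)))))
     + 512 * ((a l * h l + b l * k l) * (a l * h l + b l * k l)))
  = \sum_l (512 * (b l ^+ 2 * P l - 2 * (b l * a l) * M l + a l ^+ 2 * Q l
                    - (b l * k l - a l * h l) ^+ 2)
            + 8192 * (a l * b (nxt l) - a (nxt l) * b l) ^+ 2).
Proof. rewrite !sum3 ?nxt3; ring. Qed.

(** For each l the mixed terms form the Cauchy-Schwarz excess of b_l x - a_l y at v_l, and the terms
    of degree four in the D coordinates are Lagrange squares. Every summand is nonnegative for |c|
    <= 1. *)
Lemma norton_gap_split u v : let x := even_part u in let y := even_part v in
  let a := u rD in let b := v rD in
  norton_gap c u v = norton_gap c x y
    + \sum_l (2 * norton_gap c (b l *: x - a l *: y) (bas K rS l)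
              + 8192 * (a l * b (nxt l) - a (nxt l) * b l) ^+ 2).
Proof.
move=> x y a b.
have x0 := even_partE u; have y0 := even_partE v.
have z0 l : even (b l *: x - a l *: y) by move=> m; rewrite !linE x0 y0 !mulr0 subr0.
rewrite [in LHS]/norton_gap (prd_split c u u) (prd_split c v v) (prd_split c u v) -/x -/y -/a -/b.
rewrite !form_add_SD; try exact: even_prd.
rewrite opprD addrACA; congr (_ + _); apply: etrans (norton_sum a b (fun l => kap (x ** x) l)
  (fun l => kap (y ** y) l) (fun l => kap (x ** y) l) (fun l => kap x l) (fun l => kap y l)) _.
apply: eq_bigr => l _; congr (_ + _).
rewrite -(kap_gap c l (z0 l)).
by have [-> ->] := kap_comb (b l) (a l) x y l; rewrite -/(a l) -/(b l); ring.
Qed.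

Lemma unit_phase : -1 <= c <= 1 -> exists s, let w := c +i* s in
  [/\ w * w = 2 * c%:C * w - 1, w^*%R = 2 * c%:C - w & s ^+ 2 = 1 - c ^+ 2].
Proof.
move=> cb; have s0 : 0 <= 1 - c ^+ 2.
  by rewrite subr_ge0 expr2; case/andP: cb => c0 c1; nra.
have ss : Num.sqrt (1 - c ^+ 2) * Num.sqrt (1 - c ^+ 2) = 1 - c ^+ 2 by rewrite -expr2 sqr_sqrtr.
exists (Num.sqrt (1 - c ^+ 2)) => w; rewrite /w; split; last by rewrite expr2 ss.
  have two : (2 : K[i]) = 2%:C by rewrite rmorph_nat.
  rewrite two; apply/eqP; rewrite eq_complex /= ; apply/andP; split; apply/eqP.
    rewrite ss; ring.
  ring.
have two : (2 : K[i]) = 2%:C by rewrite rmorph_nat.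
rewrite two; apply/eqP; rewrite eq_complex /=; apply/andP; split; apply/eqP; ring.
Qed.

Hypothesis cb : -1 <= c <= 1.

Lemma norton_ge0 u v : 0 <= norton_gap c u v.
Proof.
have [s [ww wJ _]] := unit_phase cb.
have E x y : even x -> even y -> 0 <= norton_gap c x y := @norton_even _ _ _ ww wJ cb x y.
rewrite norton_gap_split; apply: addr_ge0; first by apply: E; apply: even_partE.
apply: sumr_ge0 => l _; apply: addr_ge0; last by rewrite mulr_ge0 ?sqr_ge0.
apply: mulr_ge0 => //; apply: E => m; last by rewrite basE.
by rewrite !linE !even_partE !mulr0 subr0.
Qed.

Lemma form_ge0 u : 0 <= mform c u u.
Proof.
have [s [ww wJ _]] := unit_phase cb.
rewrite form_split addr_ge0 ?(form_even_ge0 ww wJ cb) // ?mulr_ge0 ?sumr_ge0 //.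
  exact: even_partE.
by move=> l _; apply: sqr_ge0.
Qed.

(** Vanishing of the Hermitian matrix gives R + w Q = 0 for each pair of coordinates. Its real part
    is R + c Q = 0, and its imaginary part is s Q = 0 with s^2 = 1 - c^2. *)
Lemma form_eq0 u : mform c u u = 0 -> forall l,
  [/\ u rS l = 0, u rD l = 0, u rR l = - c * u rQ l & (1 - c ^+ 2) * u rQ l = 0].
Proof.
have [s [ww wJ sE]] := unit_phase cb; set w := c +i* s in ww wJ.
have E0 := even_partE u; have Eg := form_even_ge0 ww wJ cb E0.
have sq : 0 <= 512 * \sum_l u rD l ^+ 2.
  by rewrite mulr_ge0 ?sumr_ge0 // => l _; apply: sqr_ge0.
move/eqP; rewrite form_split paddr_eq0 // mulf_eq0 pnatr_eq0 /= => /andP [/eqP E1 /eqP E2].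
have H := form_even_eq0 ww wJ cb E0 E1 => l.
have d0 : u rD l = 0.
  have /eqP : u rD l ^+ 2 = 0 by apply: (psumr_eq0P _ E2) => // k _; apply: sqr_ge0.
  by rewrite sqrf_eq0 => /eqP.
have h i j : herm c w (even_part u) i j = 0 by rewrite H mxE.
have s0 : u rS l = 0.
  have /eqP := h l l; rewrite !mxE eqxx /= mulf_eq0 pnatr_eq0 /=.
  by rewrite -[0]/(0%:C) (inj_eq (@complexI K)) => /eqP.
have : (u rR l)%:C + w * (u rQ l)%:C = 0.
  have w0 : 2 * c%:C - w != 0.
    apply/eqP => w0; have : w * (2 * c%:C - w) = 1 by rewrite mulrBr ww; ring.
    by rewrite w0 mulr0 => /eqP; rewrite eq_sym oner_eq0.
  have /eqP := h (nxt (nxt l)) (nxt l); rewrite !mxE nxt3 !(eqxx, basN, nxt_neq, nxt2_neq) /=.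
  rewrite !mulf_eq0 pnatr_eq0 /= /phase'; case: ifP => _.
    by rewrite (negbTE w0) => /eqP.
  by rewrite oner_eq0 => /eqP.
move=> /eqP; rewrite eq_complex /= !mulr0 ?(add0r, addr0, subr0) => /andP [/eqP Er /eqP Ei].
split=> //; last by rewrite -sE expr2 -mulrA Ei mulr0.
by rewrite mulNr; apply/eqP; rewrite -addr_eq0 Er.
Qed.
End Norton.

(** * Radical quotients *)

Section NineDimensional.
Variables (K : realType) (c : K) (B : algebra K) (T : ahom (real_model c) B).
Local Notation V := 'M[K]_(4, 3).
Hypothesis c1 : c = 1 \/ c = -1.
Hypothesis Tc : bijective (hc T).
Hypothesis Tv : forall x, exists u, hv T u = x.
Hypothesis Tker : forall u, hv T u = 0 <-> forall w, mform c u w = 0.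

Let cb : -1 <= c <= 1.
Proof. by case: c1 => ->; apply/andP; split; lra. Qed.
Let cc : c * c = 1.
Proof. by case: c1 => ->; ring. Qed.

Lemma real_iota_bij : bijective (iota B).
Proof.
case: Tc => g gK Kg; have TI r : iota B r = hc T r by rewrite -(hcI T).
by exists g => r; rewrite TI.
Qed.

Lemma radicalP u : mform c u u = 0 <->
  forall l, [/\ u rS l = 0, u rD l = 0 & u rR l = - c * u rQ l].
Proof.
split=> [/(form_eq0 cb) E l|E]; first by have [-> -> -> _] := E l.
have e l := E l; rewrite (mformE c 0) /= /kap ?nxt3.
by have [-> -> ->] := e 0; have [-> -> ->] := e (nxt 0);
  have [-> -> ->] := e (nxt (nxt 0)); ring: cc.
Qed.

Lemma hv_eq0 u : hv T u = 0 <-> mform c u u = 0.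
Proof.
rewrite Tker; split=> [//|/radicalP E w]; have e l := E l.
rewrite (mformE c 0) /= /kap ?nxt3.
by have [-> -> ->] := e 0; have [-> -> ->] := e (nxt 0);
  have [-> -> ->] := e (nxt (nxt 0)); ring: cc.
Qed.

(** The vectors Q_l - c R_l span the radical, so the nine coordinates S, R, D are coordinates of the
    quotient and the Q row can be set to zero. *)
Definition coords (d : 'rV[K]_(3 * 3)) : V :=
  \matrix_(a, i) if unlift rQ a is Some a' then vec_mx d a' i else 0.

Lemma coords_linear k d d' : coords (k *: d + d') = k *: coords d + coords d'.
Proof.
apply/matrixP => a i; rewrite !mxE; case: unlift => [a'|]; last by rewrite mulr0 addr0.
by rewrite linearP !mxE.
Qed.

Lemma has_dimension9 : has_dimension B 9.
Proof.
split; first exact: real_iota_bij.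
case: Tc => g gK Kg.
exists (fun k => hv T (coords (delta_mx 0 k))) => x.
have sumE (d : 'rV[coef B]_9) : \sum_(k < 9) d 0 k *: hv T (coords (delta_mx 0 k)) =
    hv T (coords (\row_k g (d 0 k))).
  rewrite [in RHS](row_sum_delta (\row_k g (d 0 k))).
  have coords0 : coords 0 = 0 by apply: (addIr (coords 0)); rewrite -{1}[coords 0]scale1r -coords_linear scale1r !add0r.
  transitivity (\sum_(k < 9) hv T (g (d 0 k) *: coords (delta_mx 0 k))).
    by apply: eq_bigr => k _; rewrite hvZ Kg.
  rewrite -hv_sum; congr (hv T _).
  elim/big_ind2: _ => // [x1 y1 x2 y2 -> ->|k _].
    by rewrite -[X in _ = coords (X + _)]scale1r coords_linear scale1r.
  by rewrite -[X in _ = coords X]addr0 coords_linear coords0 addr0 mxE.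
have [u <-] := Tv x.
(* Subtracting the radical vectors Q_i - c R_i, weighted by the Q coordinates, clears the Q row and
   adds c times it to the R row. *)
pose d : 'rV[K]_(3 * 3) := mxvec (\matrix_(a, i) (u (lift rQ a) i + (lift rQ a == rR)%:R * c * u rQ i)).
have coordsE d' a i : coords d' (lift rQ a) i = vec_mx d' a i by rewrite mxE liftK.
have coordsQ d' i : coords d' rQ i = 0 by rewrite mxE unlift_none.
have lS : lift rQ 0 = rS by apply: val_inj.
have lR : lift rQ 1 = rR by apply: val_inj.
have lD : lift rQ 2%:R = rD by apply: val_inj.
exists (\row_k hc T (d 0 k)); split.
  rewrite sumE (_ : \row_k _ = d); last by apply/rowP => k; rewrite !mxE gK.
  apply/eqP; rewrite -subr_eq0 -hvB; apply/eqP/hv_eq0/radicalP => l.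
  by rewrite !linE coordsQ -lS -lR -lD !coordsE /d mxvecK !mxE !lS !lR !lD /=; split; ring.
move=> d'; rewrite sumE => /eqP; rewrite -subr_eq0 -hvB => /eqP /hv_eq0 /radicalP E.
apply/rowP => k; rewrite mxE -[RHS]Kg; congr (hc T _).
have : d = \row_k g (d' 0 k).
  apply: (can_inj (@vec_mxK K 3 3)); apply/matrixP => a i; have [] := E i.
  rewrite !linE !coordsQ -lS -lR -lD !coordsE /d mxvecK subr0.
  move=> /eqP e0 /eqP e2 e1; rewrite !subr_eq0 in e0 e2; rewrite [LHS]mxE.
  have : a = 0 \/ a = 1 \/ a = 2%:R.
    by case: a => -[|[|[|//]]] p; [left | right; left | right; right]; apply: val_inj.
  case=> [->|[->|->]]; rewrite ?lS ?lR ?lD /=.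
  - by rewrite !mul0r addr0 -lS; apply/eqP.
  - move/eqP: e1; rewrite subr_eq addrC => /eqP e1.
    by rewrite mul1r -lR e1 mulNr addrNK.
  - by rewrite !mul0r addr0 -lD; apply/eqP.
by move=> ->; rewrite mxE.
Qed.

Lemma real_Majorana : primitive_frobenius_axial B -> Majorana B.
Proof.
move=> pfa; split=> //; first exact: real_iota_bij.
- move=> x; have [u <-] := Tv x => x0; exists (mform c u u); last by rewrite -hvF -(hcI T).
  by rewrite lt_def form_ge0 // andbT; apply/eqP => /hv_eq0.
- move=> x y; have [u <-] := Tv x; have [v <-] := Tv y; exists (norton_gap c u v).
    exact: norton_ge0.
  by rewrite -!hvM -!hvF -rmorphB -(hcI T).
Qed.
End NineDimensional.

Section Radical.
Variables (K : realType) (A : algebra K).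
Hypothesis pfa : primitive_frobenius_axial A.
Let rad (x : car A) := forall y, form x y = 0.
Let zero (r : coef A) := r = 0.

Fact rad0 : rad 0. Proof. by move=> y; rewrite form0l. Qed.
Fact radP c x y : rad x -> rad y -> rad (c *: x + y).
Proof. by move=> Rx Ry z; rewrite formPl Rx Ry mulr0 addr0. Qed.
Fact radM x y : rad x -> rad (prd x y).
Proof. by move=> Rx z; have [_ _ _ [_ <- _]] := pfa. Qed.
Fact zeroP c r s : zero r -> zero s -> zero (c * r + s).
Proof. by rewrite /zero => -> ->; rewrite mulr0 addr0. Qed.
Fact zeroI r x : zero r -> rad (r *: x).
Proof. by move=> -> y; rewrite scale0r form0l. Qed.
Fact radIl x y : rad x -> zero (form x y). Proof. exact. Qed.
Fact radIr x y : rad x -> zero (form y x).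
Proof. by move=> Rx; rewrite /zero (form_sym pfa) Rx. Qed.

Definition radical_pair : ideal_pair A :=
  IdealPair rad0 radP radM (erefl 0 : zero 0) zeroP zeroI radIl radIr.
End Radical.

(** * The Majorana property of M(t) and of its quotients *)

Section Specialised.
Variables (K : realType) (t : K).
Local Notation c := (1 - 12 * t).
Local Notation N := (real_model c).

Lemma M_at_axial : primitive_frobenius_axial (M_at t).
Proof.
have [F [Fc Fv]] := M_at_model t; have [G [FcK GcK FvK GvK]] := inverse_ahom Fc Fv.
by apply: (iso_axial FcK FvK); have [] := real_model_class c.
Qed.

Lemma M_at_Majorana : -1 < c < 1 -> Majorana (M_at t).
Proof.
move=> c1; have cb : -1 <= c <= 1 by case/andP: c1 => *; rewrite !ltW.
have [F [Fc Fv]] := M_at_model t; have [G [FcK GcK FvK GvK]] := inverse_ahom Fc Fv.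
apply: (iso_Majorana FcK FvK).
- by exists id.
- by have [] := real_model_class c.
- move=> u u0; exists (mform c u u) => //; rewrite lt_def form_ge0 // andbT.
  apply/eqP => /(form_eq0 cb) E; apply: u0; apply/matrixP => b l.
  have [s0 d0 r q] := E l; rewrite [RHS]mxE.
  have {}q : u rQ l = 0.
    apply/eqP; move/eqP: q; rewrite mulf_eq0 => /orP [/eqP q|//].
    by case/andP: c1 => *; nra.
  by elim/row4_ind: b; rewrite ?s0 ?d0 ?r ?q ?mulr0.
- by move=> u v; exists (norton_gap c u v) => //; apply: norton_ge0.
Qed.

Lemma Majorana_bounds : Majorana (M_at t) -> -1 < c < 1.
Proof.
move=> [_ _ pos _].
have [F [Fc Fv]] := M_at_model t; have [G [FcK GcK FvK GvK]] := inverse_ahom Fc Fv.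
(* At c = 1 or c = -1 this vector lies in the radical. In general its norm is 960 (1 - c^2), and its
   Q coordinate 1 shows that it is nonzero. *)
pose u : car N := bas K rQ 0 - c *: bas K rR 0.
have [|r r0 E] := pos (hv G u).
  move=> u0; have : u = 0 by rewrite -[u]GvK u0 hv0.
  move=> /(congr1 (fun x : 'M[K]_(4, 3) => x rQ 0)); rewrite /u !linE !basE mxE /=.
  by rewrite mulr0 subr0 => /eqP; rewrite oner_eq0.
have {}E : mform c u u = r.
  have := congr1 (hc F) E; rewrite -hvF (hcI F) GcK; exact.
have : mform c u u = 960 * (1 - c * c).
  by rewrite (mformE c 0) /= /kap /u !linE !basE ?nxt3 ?(eqxx, basN, nxt_neq, nxt2_neq) /=; ring.
rewrite E => {}E; move: c E => c' E; apply/andP; split; nra.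
Qed.

Lemma nine_dimensional_quotient : c = 1 \/ c = -1 ->
  has_dimension (quotient (radical_pair M_at_axial)) 9
  /\ Majorana (quotient (radical_pair M_at_axial)).
Proof.
move=> c1; set P := radical_pair _.
have [F [Fc Fv]] := M_at_model t; have [G [FcK GcK FvK GvK]] := inverse_ahom Fc Fv.
pose T := comp_ahom (pi_hom P) G.
(* The radical is divided out with the zero ideal of coefficients, so the quotient is still an
   algebra over a copy of the reals. *)
have pinj : injective (pi_coef P).
  by move=> r s /pi_coefE /= /eqP; rewrite subr_eq0 => /eqP.
have Tc : bijective (hc T).
  apply: inj_surj_bijective => [r s /pinj /(can_inj GcK) //|r].
  by exists (hc F (rep_coef r)); rewrite /= FcK rep_coefK.
have Tv x : exists u, hv T u = x.
  by exists (hv F (rep_car x)); rewrite /= FvK rep_carK.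
have Tker u : hv T u = 0 <-> forall w, mform c u w = 0.
  have p0 : hv T u = 0 <-> forall y, form (hv G u) y = 0.
    have -> : 0 = hv (pi_hom P) 0 by rewrite hv0.
    split=> [/pi_carE|E]; first by rewrite subr0.
    by apply/pi_carE; rewrite subr0.
  rewrite p0; split=> [E w|E y].
    by apply: (can_inj GcK); rewrite rmorph0 -(E (hv G w)); apply: (hvF G).
  by rewrite -(FvK y) -hvF -[form u _]/(mform c u _) E rmorph0.
split; first exact: (has_dimension9 c1 Tc Tv Tker).
apply: (real_Majorana c1 Tc Tv Tker); apply: quotient_axial; last exact: M_at_axial.
have [inj _ _ _] := M_at_axial.
by move=> r s /pinj /inj.
Qed.
End Specialised.

Theorem theorem6p2 (K : realType) (t : K) :
  (Majorana (M_at t) <-> 0 < t < 1 / 6) /\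
  (t = 0 \/ t = 1 / 6 ->
    exists P : ideal_pair (M_at t),
      has_dimension (quotient P) 9 /\ Majorana (quotient P)).
Proof.
split; first split.
- by move=> /Majorana_bounds /andP [t1 t2]; apply/andP; split; lra.
- by move=> /andP [t0 t6]; apply: M_at_Majorana; apply/andP; split; lra.
move=> t06; exists (radical_pair (M_at_axial t)); apply: nine_dimensional_quotient.
by case: t06 => ->; [left | right]; field.
Qed.
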